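(* Let $(X_n)$ be deterministic $n\times p$ matrices with SVD $X_n=U_nL_nV_n^\top$, $\limsup_n\ell_{n,1}/\ell_{n,p}<\infty$ and $\liminf_n\min_{i\in[p-1]}\ell_{n,i}/\ell_{n,i+1}>1$. Let $S_{m,n}$ be sparse sign embeddings with sparsity $\zeta_m$. Suppose $m,n\to\infty$, $\zeta_m^2/m\to0$, and $(\sqrt m/\zeta_m)\,\|\mathrm{vec}(U_n)\|_4^4\to0$. Then for any $i\in[p]$, $$\sqrt{\frac m2}\;\hat\Lambda_{m,n,i}^{-1}(\hat\Lambda_{m,n,i}-\Lambda_{n,i})\Rightarrow\mathcal N(0,1),$$ and for any unit vector $c\in\mathbb R^p$ with $\limsup_{n\to\infty}(c^\top v_{n,i})^2<1$, $$\sqrt m\Big(\sum_{k\ne i}\frac{\hat\Lambda_{m,n,i}\hat\Lambda_{m,n,k}}{(\hat\Lambda_{m,n,i}-\hat\Lambda_{m,n,k})^2}(c^\top\hat v_{m,n,k})^2\Big)^{-1/2}c^\top(\hat v_{m,n,i}-v_{n,i})\Rightarrow\mathcal N(0,1).$$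
   Context: Asymptotic regime: $p$ fixed, $n\to\infty$, $m=m_n\to\infty$, $m<n$. A sparse sign embedding with sparsity $\zeta_m$ is the random $m\times n$ matrix $S_{m,n}=(R_{m,1},\dots,R_{m,n})$ whose columns are i.i.d. uniform on $\{f/\sqrt{\zeta_m}\in\mathbb R^m:f_1,\dots,f_m\in\{\pm1,0\},\ \|f\|^2=\zeta_m\}$ ($\zeta_m=1$ is CountSketch). SVD: $U_n$ is $n\times p$ with orthonormal columns, $L_n=\mathrm{diag}(\ell_{n,1},\dots,\ell_{n,p})$, $\ell_{n,1}\ge\dots\ge\ell_{n,p}>0$, $V_n$ is $p\times p$ orthogonal. $\|\mathrm{vec}(U_n)\|_4^4=\sum_{i,j}(U_n)_{ij}^4$. For a symmetric $p\times p$ matrix $\Xi$, $\lambda_i(\Xi)$ is its $i$-th largest eigenvalue and $v_i(\Xi)$ an associated unit eigenvector whose first nonzero coordinate is positive. $\Lambda_{n,i}=\lambda_i(X_n^\top X_n)$, $v_{n,i}=v_i(X_n^\top X_n)$, $\hat\Lambda_{m,n,i}=\lambda_i(X_n^\top S_{m,n}^\top S_{m,n}X_n)$, $\hat v_{m,n,i}=v_i(X_n^\top S_{m,n}^\top S_{m,n}X_n)$.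
   Formalization: As printed the eigenvector claim fails (V=I, i=2, c=e_1); it is proved with the sample eigenvector's sign chosen so its inner product with v_{n,i} is nonnegative, and literally with the stated sign rule when sqrt(m) times |first coordinate of v_{n,i}| tends to infinity. *)

(* Defs.v *)
From HB Require Import structures.
From mathcomp Require Import all_boot all_order all_algebra finmap.
From mathcomp Require Import all_classical all_reals all_analysis.
Set Implicit Arguments.
Unset Strict Implicit.
Unset Printing Implicit Defensive.
Import Order.TTheory GRing.Theory Num.Theory numFieldNormedType.Exports.
Local Open Scope classical_set_scope.
Local Open Scope ring_scope.

(* Convergence in distribution of real random variables, each of which may
   live on its own probability space, to the law mu: pointwise convergence of
   the distribution functions at the continuity points of the limit. *)
Definition cvg_in_distribution (R : realType) (d : nat -> measure_display)
    (T : forall n, measurableType (d n)) (P : forall n, probability (T n) R)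
    (Z : forall n, T n -> R) (mu : probability (measurableTypeR R) R) : Prop :=
  (\forall n \near \oo, measurable_fun [set: T n] (Z n)) /\
  (forall x : R, {for x, continuous (fun y : R => mu `]-oo, y]%classic)} ->
    P n [set w | Z n w <= x] @[n --> \oo] --> mu `]-oo, x]%classic).

Definition sparse_signs (R : realType) (m z : nat) : set 'cV[R]_m :=
  [set (Num.sqrt z%:R)^-1 *: f | f in
    [set f : 'cV[R]_m | (forall k, f k 0 \in [:: 1; -1; 0]) /\
                        \sum_k f k 0 ^+ 2 = z%:R]].
Arguments sparse_signs R m z : clear implicits.

(* The columns are random elements of the finite set sparse_signs, which
   carries the discrete sigma-algebra; hence arbitrary sets B j in the product
   rule, which includes the rule for subfamilies (take B j = setT). *)
Definition sparse_sign_embedding (R : realType) d (T : measurableType d)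
    (P : probability T R) (m n z : nat) (S : T -> 'M[R]_(m, n)) : Prop :=
  [/\ forall w j, sparse_signs R m z (col j (S w)),
      forall j r, measurable [set w | col j (S w) = r],
      forall j r, sparse_signs R m z r ->
        P [set w | col j (S w) = r] =
          ((#|` fset_set (sparse_signs R m z)|%:R)^-1)%:E
    & forall B : 'I_n -> set 'cV[R]_m,
        P [set w | forall j, B j (col j (S w))] =
          (\prod_(j < n) P [set w | B j (col j (S w))])%E].

Definition is_svd (R : realType) n p (X U : 'M[R]_(n, p)) (l : 'rV[R]_p)
    (V : 'M[R]_p) : Prop :=
  [/\ X = U *m diag_mx l *m V^T,
      U^T *m U = 1%:M,
      V^T *m V = 1%:M,
      forall i j : 'I_p, (i <= j)%N -> l 0 j <= l 0 i
    & forall i, 0 < l 0 i].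

(* The eigenvalues with multiplicity, in nonincreasing order. For symmetric Xi
   there is exactly one such vector, so the default 0 is then never used. *)
Definition eigvals (R : realType) p (Xi : 'M[R]_p) : 'rV[R]_p :=
  xget 0 [set l : 'rV[R]_p |
    (forall i j : 'I_p, (i <= j)%N -> l 0 j <= l 0 i) /\
    char_poly Xi = \prod_(i < p) ('X - (l 0 i)%:P)].

Definition eigval (R : realType) p (Xi : 'M[R]_p) (i : 'I_p) : R :=
  eigvals Xi 0 i.

Definition dot (R : realType) p (u v : 'cV[R]_p) : R := (u^T *m v) 0 0.

Definition is_unit_eigvec (R : realType) p (Xi : 'M[R]_p) (i : 'I_p)
    (v : 'cV[R]_p) : Prop :=
  [/\ Xi *m v = eigval Xi i *: v,
      dot v v = 1
    & exists j : 'I_p, 0 < v j 0 /\ forall k : 'I_p, (k < j)%N -> v k 0 = 0].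

(* A choice of v_i(Xi) for all symmetric Xi; when eigval Xi i is a multiple
   eigenvalue any admissible choice is allowed. *)
Definition eigvec_choice (R : realType) p
    (v : 'M[R]_p -> 'I_p -> 'cV[R]_p) : Prop :=
  forall (Xi : 'M[R]_p) (i : 'I_p), Xi^T = Xi -> is_unit_eigvec Xi i (v Xi i).

(* The one of v, - v that makes a nonobtuse angle with u. An eigenvector of a
   sample matrix can only be compared with its population counterpart up to
   sign, and the rule "first nonzero coordinate positive" does not align the
   two: if the first coordinate of u vanishes, that rule makes v close to u or
   to - u according to the sign of a mean-zero fluctuation. *)
Definition align (R : realType) p (u v : 'cV[R]_p) : 'cV[R]_p :=
  if 0 <= dot u v then v else - v.

(* Main.v *)
Require Import Defs.
From HB Require Import structures.
From mathcomp Require Import all_boot all_order all_algebra finmap.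
From mathcomp Require Import all_classical all_reals all_analysis.
From mathcomp Require Import perm.
From mathcomp Require Import ring lra.
Set Implicit Arguments.
Unset Strict Implicit.
Unset Printing Implicit Defensive.
Import Order.TTheory GRing.Theory Num.Theory numFieldNormedType.Exports.
Local Open Scope classical_set_scope.
Local Open Scope ring_scope.

(** Write E = U^T S^T S U - 1 for the sketching error. The sketched Gram matrix
    is V D (1 + E) D V^T with D = diag(l), so everything reduces to two facts:
    the statistics are bilinear forms of E up to second order in E, and such
    bilinear forms are asymptotically Gaussian.

    Linearization. The hypotheses on l make the squared singular values
    uniformly separated in ratio. For small E the characteristic polynomial
    changes sign across disjoint intervals around them, which localizes the
    sample eigenvalues (eigvals_scaled_near), and the eigenvector equation read
    in coordinates then gives expansions with an error quadratic in E
    (eigvec_expansion, sample_eigen). Hence the eigenvalue statistic is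
    sqrt(m/2) E_ii and the studentised eigenvector statistic is
    sqrt m (E y)_i for a unit vector y orthogonal to the i-th axis, both up to
    sqrt m O(|E|^2) (eigval_linearized, eigvec_linearized). As |E|^2 has mean
    O(1/m) (sketch_err_second_moment), the remainders vanish in probability
    (cvg_of_linearization). When the first coordinate of the population
    eigenvector is large compared with 1 / sqrt m, the sample eigenvector has
    the same sign there with probability tending to 1, so that the sign rule
    agrees with align.

    Gaussian limit. Columns of S have unit norm, so x^T E y is a purely
    off-diagonal quadratic form in the columns (sketch_err_offdiag). The law of
    a column is invariant under independent sign flips of its entries, so,
    given the squared entries, the rows of S contribute independent centred
    terms, each a Rademacher chaos of order two: their fourth moments are
    controlled by their variances (bonami_chaos2). Stein's method
    (stein_sum_bound) bounds the distance to the Gaussian law by the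
    fluctuation of the conditional variance and the sum of the squared
    conditional variances of the rows; both are second moments of U-statistics
    in the columns, computed by orthogonality (avg_sqr_linear,
    avg_sqr_quadratic) and small because of the sparsity and delocalization
    hypotheses (stein_sketch, sketch_call_cvg).

    Stein's equation is solved explicitly for the test functions
    max(t - x, 0), in terms of Mills ratios (stein_solution). Differences of
    two such functions sandwich the indicators of half-lines, so that
    convergence of their means gives convergence of the distribution functions
    (cdf_cvg_of_call). All probabilities are averages over the finite set of
    matrices with sparse sign columns (embedding_prob). *)


(** * The standard Gaussian law and its Stein equation *)

Section gaussian.
Variable R : realType.
Implicit Types t x y : R.

Definition gpdf x : R := normal_pdf 0 1 x.
Definition gcdf x : R := fine (normal_prob (0 : R) 1 `]-oo, x]%classic).

Lemma gpdfE x : gpdf x = normal_peak 1 * expR (- x ^+ 2 / 2).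
Proof.
rewrite /gpdf normal_pdfE ?oner_neq0// /normal_fun subr0 expr1n.
by rewrite mulr2n.
Qed.

Lemma gpdf_gt0 x : 0 < gpdf x.
Proof. by rewrite gpdfE mulr_gt0 ?expR_gt0 ?normal_peak_gt0 ?oner_neq0. Qed.

Lemma gpdfN x : gpdf (- x) = gpdf x.
Proof. by rewrite !gpdfE sqrrN. Qed.

Lemma is_derive_gpdf x : is_derive x 1 gpdf (- x * gpdf x).
Proof.
rewrite [gpdf](_ : _ = fun x => normal_peak 1 * expR (- x ^+ 2 / 2)).
  apply: is_derive_eq.
  by rewrite /GRing.scale /=; field.
by apply: funext => y; rewrite gpdfE.
Qed.

Lemma is_derive_gcdf x : is_derive x 1 gcdf (gpdf x).
Proof.
have ip : lebesgue_measure.-integrable [set: R] (fun x => (gpdf x)%:E).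
  exact: integrable_normal_pdf.
have [] := @continuous_FTC1 R gpdf -oo%O x (x + 1) _ _ _ _.
- by rewrite ltrDl.
- by apply: (integrableS _ _ (subsetT _)) ip.
- by rewrite ltNyr.
- exact/continuous_normal_pdf/oner_neq0.
by move=> h1 h2; split; [exact: h1|rewrite -h2 derive1E].
Qed.

Let idR : measurableTypeR R -> R := idfun.

#[local] HB.instance Definition _ :=
  @isMeasurableFun.Build _ _ _ _ idR (@measurable_id _ _ setT).

Let gcdf_cdf x :
  gcdf x = fine (cdf (idR : {RV (@normal_prob R 0 1) >-> R}) x).
Proof. by rewrite /gcdf /cdf/= /distribution /pushforward preimage_id. Qed.

Lemma cvg_gcdfNy : gcdf x @[x --> -oo] --> (0 : R).
Proof.
by rewrite (boolp.funext gcdf_cdf); exact/fine_cvg/cvg_cdfNy0.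
Qed.

Lemma cvg_gcdfy : gcdf x @[x --> +oo] --> (1 : R).
Proof.
by rewrite (boolp.funext gcdf_cdf); exact/fine_cvg/cvg_cdfy1.
Qed.

End gaussian.

Section calculus.
Variable R : realType.
Implicit Types (f F : R -> R) (a b x y : R).

Lemma MVT_closed f df a b : a <= b ->
  (forall x, a <= x <= b -> is_derive x 1 f (df x)) ->
  exists c, [/\ a <= c, c <= b & f b - f a = df c * (b - a)].
Proof.
move=> ab fd.
have [||c] := @MVT_segment R f df a b ab.
- by move=> x; rewrite in_itv/= => /andP[/ltW ax /ltW xb]; apply: fd; rewrite ax.
- apply: derivable_within_continuous => x; rewrite in_itv/= => xab.
  by have [] := fd _ xab.
by rewrite in_itv/= => /andP[ac cb] e; exists c.
Qed.

(** Each tail bound below compares two functions that vanish at infinity by the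
    sign of the derivative of their difference. *)
Lemma nonincr_cvg0_ge0 F dF a :
  (forall x, a <= x -> is_derive x 1 F (dF x)) ->
  (forall x, a <= x -> dF x <= 0) ->
  F x @[x --> +oo] --> (0 : R) -> 0 <= F a.
Proof.
move=> Fd dF0 F0; rewrite leNgt; apply/negP => Fa0.
have h1 : \forall y \near +oo, `|0 - F y| < - F a.
  by move/cvgrPdist_lt : F0; apply; rewrite oppr_gt0.
have h2 : \forall y \near +oo, a <= y by apply: nbhs_pinfty_ge; rewrite num_real.
have [y [Fy ay]] := filter_ex (filterI h1 h2).
have [|c [ac cy e]] := @MVT_closed F dF a y ay.
  by move=> x /andP[ax _]; exact: Fd.
have : F y - F a <= 0.
  by rewrite e mulr_le0_ge0 ?subr_ge0// dF0.
have : - F y < - F a by apply: le_lt_trans Fy; rewrite sub0r ler_norm.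
lra.
Qed.

Lemma lipschitz_of_bounded_derive f df a b C : a <= b ->
  (forall x, a <= x <= b -> is_derive x 1 f (df x)) ->
  (forall x, a <= x <= b -> `|df x| <= C) ->
  `|f b - f a| <= C * (b - a).
Proof.
move=> ab fd fC; have [c [ac cb ->]] := MVT_closed ab fd.
by rewrite normrM (ger0_norm (_ : 0 <= b - a)) ?subr_ge0// ler_wpM2r ?subr_ge0// fC ?ac.
Qed.

(** Differentiability at t is the point: the difference quotients of the glued
    function at t are those of f1 or of f2, and both families have limit d t. *)
Lemma is_derive_glue f1 f2 d t : f1 t = f2 t ->
  (forall x, x <= t -> is_derive x 1 f1 (d x)) ->
  (forall x, t <= x -> is_derive x 1 f2 (d x)) ->
  forall x, is_derive x 1 (fun x => if x <= t then f1 x else f2 x) (d x).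
Proof.
move=> e12 d1 d2 x; set f := fun x => _.
have [xt|tx|xt] := ltgtP x t.
- apply: (near_eq_is_derive (f := f1)); last exact/d1/ltW.
  near=> y; rewrite /f ifT// ltW//; near: y; exact: lt_nbhsl.
- apply: (near_eq_is_derive (f := f2)); last exact/d2/ltW.
  near=> y; rewrite /f ifF//; apply/negbTE; rewrite -ltNge; near: y.
  exact: lt_nbhsr.
- rewrite {}xt; set q := fun (g : R -> R) (h : R) => h^-1 *: (g (h *: 1 + t) - g t).
  have qf h : q f h = q f1 h \/ q f h = q f2 h.
    by rewrite /q /f lexx; case: ifP => _; [left|right; rewrite -e12].
  have cvg_q (g : R -> R) l : is_derive t 1 g l -> q g h @[h --> 0^'] --> l.
    by move=> [gd <-]; exact: gd.
  have qfd : q f h @[h --> 0^'] --> d t.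
    apply/cvgrPdist_lt => e e0; near=> h.
    have : `|d t - q f1 h| < e.
      by near: h; apply: (cvgrPdist_lt _ _).1 => //; exact/cvg_q/d1.
    have : `|d t - q f2 h| < e.
      by near: h; apply: (cvgrPdist_lt _ _).1 => //; exact/cvg_q/d2.
    by case: (qf h) => ->.
  split; first exact: cvgP qfd.
  exact: cvg_lim qfd.
Unshelve. all: by end_near. Qed.

End calculus.

Section mills.
Variables (R : realType) (Q : R -> R).
Hypothesis dQ : forall x : R, is_derive x 1 Q (- gpdf x).
Hypothesis Q0 : Q x @[x --> +oo] --> (0 : R).
Implicit Types x y : R.

(** For Q the Gaussian tail, the only one that the hypotheses allow. It is kept
    abstract so as to cover 1 - gcdf x and gcdf (- x) at once. *)
Definition mills x := Q x / gpdf x.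

Lemma is_derive_mills x : is_derive x 1 mills (x * mills x - 1).
Proof.
have d1 := dQ x; have d2 := is_derive_gpdf x.
have p0 : gpdf x != 0 by rewrite gt_eqF// gpdf_gt0.
rewrite (_ : mills = fun y => Q y * (gpdf y)^-1)//; apply: is_derive_eq.
by rewrite /mills /GRing.scale /=; field.
Qed.

Lemma tail_ge0 x : 0 <= Q x.
Proof.
apply: (@nonincr_cvg0_ge0 _ _ (fun y => - gpdf y)) Q0 => // y _.
by rewrite oppr_le0 ltW// gpdf_gt0.
Qed.

Let gpdf_scaled_cvg0 (h : R -> R) :
  (forall y, 0 < y -> 0 <= h y <= y^-1) ->
  gpdf y * h y @[y --> +oo] --> (0 : R).
Proof.
move=> hb; apply: (@squeeze_cvgr _ _ _ _ (fun=> 0) (fun y => normal_peak 1 * y^-1)).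
- near=> y; have y0 : 0 < y by near: y; exact: nbhs_pinfty_gt.
  have /andP[h0 h1] := hb _ y0.
  rewrite mulr_ge0// ?(ltW (gpdf_gt0 _))//= ler_pM ?(ltW (gpdf_gt0 _))//.
  exact/normal_pdf_ub/oner_neq0.
- exact: cvg_cst.
- rewrite -[X in _ --> X](mulr0 (normal_peak 1)); apply: cvgM; first exact: cvg_cst.
  apply/gtr0_cvgV0; last exact: cvg_id.
  by near=> y; near: y; exact: nbhs_pinfty_gt.
Unshelve. all: by end_near. Qed.

(** The difference of the two sides has derivative - gpdf x / x^2. *)
Lemma tail_upper x : 0 < x -> Q x <= gpdf x / x.
Proof.
move=> x0; rewrite -subr_ge0.
apply: (@nonincr_cvg0_ge0 _ (fun y => gpdf y / y - Q y) (fun y => - gpdf y / y ^+ 2)).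
- move=> y xy; have y0 : y != 0 by rewrite gt_eqF// (lt_le_trans x0).
  have d1 := dQ y; have d2 := is_derive_gpdf y.
  have d3 := @is_deriveV R id y 1 1 y0 (is_derive_id _ _).
  apply: is_derive_eq.
  by rewrite /GRing.scale /=; field.
- by move=> y _; rewrite mulNr oppr_le0 mulr_ge0 ?invr_ge0 ?sqr_ge0// ltW// gpdf_gt0.
- rewrite -[X in _ --> X](subr0 0); apply: cvgB; last exact: Q0.
  by apply: gpdf_scaled_cvg0 => y y0; rewrite lexx invr_ge0 ltW.
Qed.

(** The difference of the two sides has derivative - 2 gpdf x / (1 + x^2)^2. *)
Lemma tail_lower x : 0 < x -> gpdf x * (x / (1 + x ^+ 2)) <= Q x.
Proof.
move=> x0; rewrite -subr_ge0.
apply: (@nonincr_cvg0_ge0 _ (fun y => Q y - gpdf y * (y / (1 + y ^+ 2)))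
  (fun y => - 2 * gpdf y / (1 + y ^+ 2) ^+ 2)).
- move=> y xy; have y0 : 1 + y ^+ 2 != 0 by rewrite gt_eqF// ltr_pwDl// sqr_ge0.
  have d1 := dQ y; have d2 := is_derive_gpdf y.
  apply: is_derive_eq.
  by rewrite /GRing.scale /=; field.
- move=> y _; rewrite mulr_le0_ge0 ?invr_ge0 ?sqr_ge0// mulNr oppr_le0.
  by rewrite mulr_ge0// ltW// gpdf_gt0.
- rewrite -[X in _ --> X](subr0 0); apply: cvgB; first exact: Q0.
  apply: gpdf_scaled_cvg0 => y y0.
  have y1 : 0 < 1 + y ^+ 2 by rewrite ltr_pwDl// sqr_ge0.
  rewrite divr_ge0 ?(ltW y0) ?(ltW y1)//= ler_pdivrMr// mulrDr mulr1.
  by rewrite expr2 mulKf ?gt_eqF// lerDr invr_ge0 ltW.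
Qed.

(** The three functions are the Mills ratio, its derivative and its second
    derivative. They are bounded on [t, +oo): by crude bounds up to |t| + 1, and
    beyond by the two tail bounds, whose gap is of order x^-3. *)
Lemma mills_bounds t : (forall x, Q x <= 1) ->
  exists C, 0 <= C /\ forall x, t <= x -> [/\ `|mills x| <= C,
    `|x * mills x - 1| <= C & `|mills x + x * (x * mills x - 1)| <= C].
Proof.
move=> Q1; set T := `|t| + 1; have T1 : 1 <= T by rewrite lerDr normr_ge0.
set B := (gpdf T)^-1.
have B0 : 0 < B by rewrite invr_gt0 gpdf_gt0.
exists (B + T * (T * B + 1) + 2); split.
  by rewrite !addr_ge0 ?mulr_ge0 ?addr_ge0 ?mulr_ge0// ?(ltW B0)//; lra.
move=> x tx.
have M0 : 0 <= mills x by rewrite divr_ge0 ?tail_ge0// ltW// gpdf_gt0.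
have TB0 : 0 <= T * B by apply: mulr_ge0; lra.
have TTB0 : 0 <= T * (T * B + 1) by apply: mulr_ge0; lra.
have [xT|Tx] := leP x T.
- have xT' : `|x| <= T.
    by rewrite ler_norml xT andbT /T; have := ler_norm (- t); rewrite normrN; lra.
  have MB : mills x <= B.
    rewrite /mills /B -[leRHS]mul1r ler_pM ?tail_ge0 ?invr_ge0 ?(ltW (gpdf_gt0 _))//.
    rewrite lef_pV2 ?posrE ?gpdf_gt0// !gpdfE ler_pM2l ?normal_peak_gt0 ?oner_neq0//.
    rewrite ler_expR ler_pM2r ?invr_gt0// lerN2 -(real_normK (num_real x)).
    by rewrite ler_sqr ?nnegrE ?normr_ge0//; lra.
  have h2 : `|x * mills x - 1| <= T * B + 1.
    by apply: (le_trans (ler_normB _ _)); rewrite normr1 lerD2r normrM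
      [ `|mills x|]ger0_norm// ler_pM.
  have h3 : `|x * (x * mills x - 1)| <= T * (T * B + 1) by rewrite normrM ler_pM.
  have TB1 : T * B + 1 <= T * (T * B + 1) by rewrite ler_peMl; lra.
  split.
  + by rewrite ger0_norm//; lra.
  + lra.
  + by apply: (le_trans (ler_normD _ _)); rewrite [ `|mills x|]ger0_norm//; lra.
- have x0 : 0 < x by lra.
  have x2 : 0 < 1 + x ^+ 2 by rewrite ltr_pwDl// sqr_ge0.
  have Mu : x * mills x <= 1.
    rewrite /mills mulrA ler_pdivrMr ?gpdf_gt0// mul1r mulrC -ler_pdivlMr//.
    exact: tail_upper.
  have Ml : x <= (1 + x ^+ 2) * mills x.
    have := tail_lower x0; rewrite mulrA ler_pdivrMr// => h.
    by rewrite /mills mulrA ler_pdivlMr ?gpdf_gt0// mulrC [leRHS]mulrC.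
  have xM0 : 0 <= x * mills x by rewrite mulr_ge0// ltW.
  have M1 : mills x <= 1.
    by apply: le_trans Mu; rewrite ler_peMl//; lra.
  split.
  + by rewrite ger0_norm//; lra.
  + by rewrite ler_norml; apply/andP; split; lra.
  + have -> : mills x + x * (x * mills x - 1) = (1 + x ^+ 2) * mills x - x by ring.
    rewrite ger0_norm ?subr_ge0//.
    have : (x * mills x) * x <= 1 * x by rewrite ler_wpM2r// ltW.
    have -> : (1 + x ^+ 2) * mills x = mills x + x * mills x * x by ring.
    lra.
Qed.

End mills.

Section stein.
Variable R : realType.
Implicit Types t x y : R.

(** The integral of gcdf up to t, which is the mean of the positive part of
    t - Z for Z standard Gaussian. *)
Definition gcall t : R := t * gcdf t + gpdf t.

Lemma is_derive_gcall t : is_derive t 1 gcall (gcdf t).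
Proof.
have d1 := is_derive_gcdf t; have d2 := is_derive_gpdf t.
apply: is_derive_eq.
by rewrite /GRing.scale /=; ring.
Qed.

Let Q1 x : R := 1 - gcdf x.
Let Q2 x : R := gcdf (- x).

Let dQ1 x : is_derive x 1 Q1 (- gpdf x).
Proof.
rewrite (_ : Q1 = (fun y => 1 - gcdf y))//.
have d1 := is_derive_gcdf x.
by apply: is_derive_eq; rewrite add0r mul1r.
Qed.

Let dQ2 x : is_derive x 1 Q2 (- gpdf x).
Proof.
have d1 := is_derive_gcdf (- x).
have d2 : is_derive x 1 (fun y : R => - y) (-1) by apply: is_derive_eq.
by have := is_derive1_comp d1 d2; rewrite gpdfN mulrN1.
Qed.

Let Q10 : Q1 x @[x --> +oo] --> (0 : R).
Proof.
rewrite -[X in _ --> X](subrr 1); apply: cvgB; first exact: cvg_cst.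
exact: cvg_gcdfy.
Qed.

Let Q20 : Q2 x @[x --> +oo] --> (0 : R).
Proof. exact: (cvgNy_compNP _ _).1 (@cvg_gcdfNy R). Qed.

Lemma gcdf_ge0 x : 0 <= gcdf x.
Proof. by rewrite -[x]opprK; exact: (tail_ge0 dQ2 Q20). Qed.

Lemma gcdf_le1 x : gcdf x <= 1.
Proof. by rewrite -subr_ge0; exact: (tail_ge0 dQ1 Q10). Qed.

(** Stein's equation for the test function x -> max(t - x, 0). Solving the
    linear equation on each side of t gives an affine function of a Mills
    ratio; the two pieces agree at t together with their first
    derivatives, and the second derivatives stay bounded on each side, so that
    g' is Lipschitz. *)
Lemma stein_solution t : exists (g g' : R -> R) (C : R), [/\ 0 <= C,
  forall x, is_derive x 1 g (g' x),
  forall x, `|g' x| <= C,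
  forall x y, `|g' x - g' y| <= C * `|x - y|
  & forall x, g' x - x * g x = Num.max (t - x) 0 - gcall t].
Proof.
pose M1 := mills Q1; pose M2 x := mills Q2 (- x).
pose P := gcall t.
(* g1, h1, k1 are the solution left of t with its two derivatives, and g2, h2,
   k2 those right of t *)
pose g1 x := 1 + (t - P) * M2 x; pose g2 x := P * M1 x.
pose h1 x := (t - P) * (1 + x * M2 x); pose h2 x := P * (x * M1 x - 1).
pose k1 x := (t - P) * (M2 x + x * (1 + x * M2 x)).
pose k2 x := P * (M1 x + x * (x * M1 x - 1)).
have dM1 x : is_derive x 1 M1 (x * M1 x - 1) by exact: is_derive_mills.
have dM2 x : is_derive x 1 M2 (1 + x * M2 x).
  have d1 := is_derive_mills dQ2 (- x).
  have d2 : is_derive x 1 (fun y : R => - y) (-1) by apply: is_derive_eq.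
  by have := is_derive1_comp d1 d2; rewrite mulrN1 mulNr -opprD opprK addrC.
have dg1 x : is_derive x 1 g1 (h1 x).
  have d := dM2 x; apply: is_derive_eq.
  by rewrite /h1 /GRing.scale /=; ring.
have dg2 x : is_derive x 1 g2 (h2 x).
  by have d := dM1 x; apply: is_derive_eq.
have dh1 x : is_derive x 1 h1 (k1 x).
  have d := dM2 x; apply: is_derive_eq.
  by rewrite /k1 /GRing.scale /=; ring.
have dh2 x : is_derive x 1 h2 (k2 x).
  have d := dM1 x; apply: is_derive_eq.
  by rewrite /k2 /GRing.scale /=; ring.
have ft : gpdf t != 0 by rewrite gt_eqF// gpdf_gt0.
have g12 : g1 t = g2 t.
  rewrite /g1 /g2 /M1 /M2 /mills /Q1 /Q2 opprK gpdfN /P /gcall.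
  by field.
have h12 : h1 t = h2 t.
  rewrite /h1 /h2 /M1 /M2 /mills /Q1 /Q2 opprK gpdfN /P /gcall.
  by field.
have Q1le x : Q1 x <= 1 by rewrite gerBl gcdf_ge0.
have Q2le x : Q2 x <= 1 by exact: gcdf_le1.
have [C1 [C10 B1]] := mills_bounds dQ1 Q10 t Q1le.
have [C2 [C20 B2]] := mills_bounds dQ2 Q20 (- t) Q2le.
have tP0 : 0 <= `|t - P| by exact: normr_ge0.
have P0 : 0 <= `|P| by exact: normr_ge0.
pose C := `|t - P| * C2 + `|P| * C1.
have C'0 : 0 <= C by rewrite addr_ge0 ?mulr_ge0.
have le2C (a : R) : a <= C2 -> `|t - P| * a <= C.
  by move=> h; rewrite (le_trans (ler_wpM2l tP0 h))// lerDl mulr_ge0.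
have le1C (a : R) : a <= C1 -> `|P| * a <= C.
  by move=> h; rewrite (le_trans (ler_wpM2l P0 h))// lerDr mulr_ge0.
have h1C x : x <= t -> `|h1 x| <= C /\ `|k1 x| <= C.
  rewrite -lerN2 => /B2[_ b2 b3]; rewrite !normrM; split; apply: le2C.
    by rewrite -normrN opprD -mulNr addrC.
  move: b3; rewrite -/(M2 x); congr (`|_| <= _); ring.
have h2C x : t <= x -> `|h2 x| <= C /\ `|k2 x| <= C.
  by move=> /B1[_ b2 b3]; rewrite !normrM; split; apply: le1C.
pose g x := if x <= t then g1 x else g2 x.
pose g' x := if x <= t then h1 x else h2 x.
have g'2 x : t <= x -> g' x = h2 x.
  by rewrite /g' le_eqVlt => /orP[/eqP <-|]; [rewrite lexx|case: ltP].
have g'1 x : x <= t -> g' x = h1 x by rewrite /g' => ->.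
have lip x y : y <= x -> `|g' x - g' y| <= C * (x - y).
  move=> yx.
  have l1 a b : a <= b -> b <= t -> `|g' b - g' a| <= C * (b - a).
    move=> ab bt; rewrite !g'1 ?(le_trans ab)//.
    apply: (lipschitz_of_bounded_derive (df := k1)) => // z /andP[_ zb].
    by have [] := h1C z (le_trans zb bt).
  have l2 a b : a <= b -> t <= a -> `|g' b - g' a| <= C * (b - a).
    move=> ab bt; rewrite !g'2 ?(le_trans _ ab)//.
    apply: (lipschitz_of_bounded_derive (df := k2)) => // z /andP[zb _].
    by have [] := h2C z (le_trans bt zb).
  have [xt|/ltW tx] := leP x t; first exact: l1.
  have [ty|/ltW yt] := leP t y; first exact: l2.
  have -> : g' x - g' y = (g' x - g' t) + (g' t - g' y) by ring.
  have -> : x - y = (x - t) + (t - y) by ring.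
  rewrite mulrDr; apply: (le_trans (ler_normD _ _)).
  by apply: lerD; [exact: l2|exact: l1].
exists g, g', C; split => //.
- apply: is_derive_glue => // x xt; first by rewrite g'1.
  by rewrite g'2.
- by move=> x; rewrite /g'; case: (leP x t) => [/h1C[]//|/ltW/h2C[]].
- move=> x y; have [yx|/ltW xy] := leP y x.
    by rewrite (ger0_norm (_ : 0 <= x - y)) ?subr_ge0// lip.
  by rewrite distrC (distrC x) (ger0_norm (_ : 0 <= y - x)) ?subr_ge0// lip.
- move=> x; rewrite /g /g'; have [xt|/ltW tx] := leP x t.
    by rewrite max_l ?subr_ge0// /h1 /g1 -/P; ring.
  by rewrite max_r ?subr_le0// /h2 /g2 -/P; ring.
Qed.

End stein.

(** * Averages over finite types *)

Section average.
Variable R : realFieldType.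

(** Expectation under the uniform law; all the randomness of a sketch is
    uniform on a finite type. *)
Definition avg (W : finType) (F : W -> R) : R := (\sum_w F w) / #|W|%:R.

Section basics.
Variable W : finType.
Implicit Types F G : W -> R.

Lemma eq_avg F G : F =1 G -> avg F = avg G.
Proof. by move=> FG; rewrite /avg (eq_bigr G). Qed.

Lemma avgD F G : avg (fun w => F w + G w) = avg F + avg G.
Proof. by rewrite /avg big_split mulrDl. Qed.

Lemma avgN F : avg (fun w => - F w) = - avg F.
Proof. by rewrite /avg sumrN mulNr. Qed.

Lemma avgB F G : avg (fun w => F w - G w) = avg F - avg G.
Proof. by rewrite avgD avgN. Qed.

Lemma avgZ (c : R) F : avg (fun w => c * F w) = c * avg F.
Proof. by rewrite /avg -mulr_sumr mulrA. Qed.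

Lemma avgZr (c : R) F : avg (fun w => F w * c) = avg F * c.
Proof. by rewrite mulrC -avgZ; apply: eq_avg => w; rewrite mulrC. Qed.

Lemma avg_sum (J : Type) (s : seq J) (P : pred J) (F : J -> W -> R) :
  avg (fun w => \sum_(j <- s | P j) F j w) = \sum_(j <- s | P j) avg (F j).
Proof. by rewrite /avg exchange_big /= mulr_suml. Qed.

Lemma ler_avg F G : (forall w, F w <= G w) -> avg F <= avg G.
Proof.
by move=> FG; rewrite /avg ler_wpM2r ?invr_ge0// ler_sum.
Qed.

Lemma avg_ge0 F : (forall w, 0 <= F w) -> 0 <= avg F.
Proof. by move=> F0; rewrite /avg divr_ge0// sumr_ge0. Qed.

Lemma ler_norm_avg F : `|avg F| <= avg (fun w => `|F w|).
Proof.
rewrite /avg normrM [ `|_^-1|]ger0_norm ?invr_ge0//.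
by rewrite ler_wpM2r ?invr_ge0// ler_norm_sum.
Qed.

Lemma avg_cst (c : R) : (0 < #|W|)%N -> avg (fun _ : W => c) = c.
Proof.
move=> W0; rewrite /avg big_const iter_addr_0 -[c *+ _]mulr_natr.
by rewrite mulfK// pnatr_eq0 -lt0n.
Qed.

Lemma avg_le0_eq0 F : (forall w, 0 <= F w) -> avg F <= 0 -> forall w, F w = 0.
Proof.
move=> F0 aF w; have W0 : (0 < #|W|)%N by apply/card_gt0P; exists w.
move: aF; rewrite /avg pmulr_lle0 ?invr_gt0 ?ltr0n// => s0.
apply/eqP; rewrite eq_le F0 andbT (le_trans _ s0)//.
by rewrite (bigD1 w)//= lerDl sumr_ge0.
Qed.

(** With a, b, c the means of F^2, G^2 and F G, the mean of (b F - c G)^2 is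
    b (a b - c^2). *)
Lemma avg_CauchySchwarz F G :
  avg (fun w => F w * G w) ^+ 2 <=
  avg (fun w => F w ^+ 2) * avg (fun w => G w ^+ 2).
Proof.
set a := avg (fun w => F w ^+ 2); set b := avg (fun w => G w ^+ 2).
set c := avg _.
have b0 : 0 <= b by apply: avg_ge0 => w; exact: sqr_ge0.
have : 0 <= avg (fun w => (b * F w - c * G w) ^+ 2).
  by apply: avg_ge0 => w; exact: sqr_ge0.
have -> : avg (fun w => (b * F w - c * G w) ^+ 2) = b * (a * b - c ^+ 2).
  under eq_avg => w.
    have -> : (b * F w - c * G w) ^+ 2 = b ^+ 2 * F w ^+ 2
        + ((- 2 * b * c) * (F w * G w) + c ^+ 2 * G w ^+ 2) by ring.
    over.
  by rewrite !avgD !avgZ -/a -/b -/c; ring.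
move: b0; rewrite le_eqVlt => /predU1P[b0 _|b0]; last first.
  by rewrite pmulr_rge0// subr_ge0.
have G0 w : G w = 0.
  have := @avg_le0_eq0 (fun w => G w ^+ 2) (fun=> sqr_ge0 _).
  by rewrite -/b -b0 lexx => /(_ isT w)/eqP; rewrite sqrf_eq0 => /eqP.
rewrite -b0 mulr0 /c.
under eq_avg do rewrite G0 mulr0.
by rewrite /avg big1// mul0r expr0n.
Qed.

End basics.

Lemma avg_exchange (V W : finType) (F : V -> W -> R) :
  avg (fun v => avg (F v)) = avg (fun w => avg (F^~ w)).
Proof.
rewrite /avg -2!mulr_suml exchange_big /= -!mulrA; congr (_ * _).
exact: mulrC.
Qed.

Lemma avg_bij (V W : finType) (h : V -> W) (F : W -> R) :
  bijective h -> avg (fun v => F (h v)) = avg F.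
Proof.
move=> bh; rewrite /avg (bij_eq_card bh); congr (_ / _).
by rewrite [RHS](reindex h)//; apply: onW_bij.
Qed.

Section product.
Variables I K : finType.
Implicit Types (f : {ffun I -> K}) (a : I) (k : K).

Definition upd f a k : {ffun I -> K} := [ffun i => if i == a then k else f i].

Lemma updE f a k : upd f a k a = k.
Proof. by rewrite ffunE eqxx. Qed.

Lemma upd_neq f a k i : i != a -> upd f a k i = f i.
Proof. by rewrite ffunE => /negbTE ->. Qed.

(** Resampling one coordinate preserves the uniform law: exchanging the a-th
    coordinate of f with k is an involution on the pairs (f, k). *)
Lemma avg_upd a (F : {ffun I -> K} -> R) : (0 < #|K|)%N ->
  avg F = avg (fun f => avg (fun k => F (upd f a k))).
Proof.
move=> K0; rewrite /avg -mulr_suml; congr (_ / _).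
rewrite pair_bigA /=.
pose h (p : {ffun I -> K} * K) := (upd p.1 a p.2, p.1 a).
have hK : involutive h.
  move=> [f k]; rewrite /h /= updE; congr pair.
  by apply/ffunP => i; rewrite !ffunE; case: eqP => [->|].
rewrite (reindex_inj (inv_inj hK)) /=.
under [X in _ = X / _]eq_bigr => p _.
  have -> : upd (upd p.1 a p.2) a (p.1 a) = p.1.
    by apply/ffunP => i; rewrite !ffunE; case: eqP => [->|].
  over.
rewrite -(pair_bigA _ (fun f _ => F f)) /=.
under [X in _ = X / _]eq_bigr => f _ do rewrite sumr_const -mulr_natr.
by rewrite -mulr_suml mulfK// pnatr_eq0 -lt0n.
Qed.

(** By avg_upd, as resampling the coordinate a leaves h unchanged. *)
Lemma avg_indep a (g : K -> R) (h : {ffun I -> K} -> R) : (0 < #|K|)%N ->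
  (forall f k, h (upd f a k) = h f) ->
  avg (fun f => g (f a) * h f) = avg g * avg h.
Proof.
move=> K0 hh; rewrite (avg_upd a)//.
under eq_avg => f do under eq_avg => k do rewrite updE hh.
under eq_avg => f do rewrite avgZr.
by rewrite avgZ.
Qed.

End product.
End average.

(** * Moments of linear and quadratic forms in independent variables *)

Section ustat.
Variables (R : realFieldType) (I K : finType).
Hypothesis K0 : (0 < #|K|)%N.

Lemma avg_marginal (a : I) (g : K -> R) :
  avg (fun f : {ffun I -> K} => g (f a)) = avg g.
Proof.
have F0 : (0 < #|{ffun I -> K}|)%N by rewrite card_ffun expn_gt0 K0.
have := @avg_indep R I K a g (fun=> 1) K0 (fun _ _ => erefl).
by rewrite avg_cst// mulr1 => <-; apply: eq_avg => f; rewrite mulr1.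
Qed.

Lemma avg_marginal2 (a b : I) (g : K -> K -> R) : a != b ->
  avg (fun f : {ffun I -> K} => g (f a) (f b)) = avg (fun x => avg (g x)).
Proof.
move=> ab; rewrite (avg_upd a)//.
transitivity (avg (fun x => avg (fun f : {ffun I -> K} => g x (f b)))).
  rewrite -avg_exchange; apply: eq_avg => f; apply: eq_avg => k.
  by rewrite updE upd_neq 1?eq_sym.
by apply: eq_avg => x; rewrite (avg_marginal b).
Qed.

(** Independent centred terms are orthogonal. *)
Lemma avg_sqr_linear (c : I -> R) (psi : K -> R) : avg psi = 0 ->
  avg (fun f : {ffun I -> K} => (\sum_j c j * psi (f j)) ^+ 2) =
  (\sum_j c j ^+ 2) * avg (fun x => psi x ^+ 2).
Proof.
move=> psi0.
under eq_avg => f do rewrite expr2 mulr_suml.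
rewrite avg_sum mulr_suml; apply: eq_bigr => j _.
under eq_avg => f do rewrite mulr_sumr.
rewrite avg_sum (bigD1 j)//= big1 => [|i ij].
  rewrite addr0 -avgZ -(avg_marginal j).
  by apply: eq_avg => f; ring.
under eq_avg => f do rewrite mulrACA mulrC -mulrA.
rewrite avg_indep// ?psi0 ?mul0r// => f k.
by rewrite !upd_neq// eq_sym.
Qed.

Variables (B : I -> I -> R) (psi : K -> K -> R).
Hypothesis Bsym : forall j k, B j k = B k j.
Hypothesis Bdiag : forall j, B j j = 0.
Hypothesis psi_sym : forall x y, psi x y = psi y x.
Hypothesis psi_deg : forall x, avg (psi x) = 0.

Let e j k j' k' :=
  avg (fun f : {ffun I -> K} => psi (f j) (f k) * psi (f j') (f k')).

Let e0 j k j' k' : j' != k' -> k' != j -> k' != k -> e j k j' k' = 0.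
Proof.
move=> jk' k'j k'k; rewrite /e (avg_upd k')//.
under eq_avg => f.
  under eq_avg => y.
    rewrite (upd_neq _ _ jk') updE [in X in X * _]upd_neq 1?eq_sym//.
    rewrite [in X in X * _]upd_neq 1?eq_sym//.
    over.
  rewrite avgZ psi_deg mulr0.
  over.
by rewrite /avg big1// mul0r.
Qed.

Let eC j k j' k' : e j k j' k' = e j k k' j'.
Proof. by apply: eq_avg => f; rewrite [in LHS](psi_sym (f j')). Qed.

(** For a symmetric degenerate kernel, two distinct unordered pairs of indices
    give uncorrelated terms, so only the two orderings of a pair interact. *)
Lemma avg_sqr_quadratic :
  avg (fun f : {ffun I -> K} => (\sum_j \sum_k B j k * psi (f j) (f k)) ^+ 2) =
  2 * (\sum_j \sum_k B j k ^+ 2) * avg (fun x => avg (fun y => psi x y ^+ 2)).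
Proof.
set v := avg (fun x => _).
have ev j k : j != k -> e j k j k = v.
  move=> jk; rewrite /e /v -(avg_marginal2 _ jk).
  by apply: eq_avg => f; rewrite expr2.
have inner j k : B j k * \sum_j' \sum_k' B j' k' * e j k j' k' = 2 * B j k ^+ 2 * v.
  have [->|jk] := eqVneq j k.
    by rewrite Bdiag mul0r expr0n mulr0 mul0r.
  have row a b : a != b -> (forall k', k' != a -> k' != b -> e j k a k' = 0) ->
      \sum_k' B a k' * e j k a k' = B a b * e j k a b.
    move=> ab h; rewrite (bigD1 b)//= big1 ?addr0// => k' k'b.
    have [->|k'a] := eqVneq k' a; first by rewrite Bdiag mul0r.
    by rewrite h// mulr0.
  rewrite (bigD1 j)//= [X in _ + X](bigD1 k) 1?eq_sym//=.
  rewrite [X in _ + (_ + X)]big1 => [|i /andP[ij ik]].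
    rewrite addr0 (row j k)//; last first.
      by move=> k' k'j k'k; rewrite e0// eq_sym.
    rewrite (row k j) 1?eq_sym//; last first.
      by move=> k' k'k k'j; rewrite e0// eq_sym.
    by rewrite (eC j k k j) (ev _ _ jk) (Bsym k j); ring.
  rewrite big1// => k' _; have [<-|ik'] := eqVneq i k'; first by rewrite Bdiag mul0r.
  by rewrite eC e0 ?mulr0// eq_sym.
transitivity (\sum_j \sum_k B j k * \sum_j' \sum_k' B j' k' * e j k j' k').
  under eq_avg => f do rewrite expr2 mulr_suml.
  rewrite avg_sum; apply: eq_bigr => j _.
  under eq_avg => f do rewrite mulr_suml.
  rewrite avg_sum; apply: eq_bigr => k _.
  under eq_avg => f do rewrite -mulrA mulr_sumr.
  rewrite avgZ avg_sum; congr (_ * _); apply: eq_bigr => j' _.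
  under eq_avg => f do rewrite mulr_sumr.
  rewrite avg_sum; apply: eq_bigr => k' _.
  by rewrite -avgZ; apply: eq_avg => f; ring.
under eq_bigr => j _ do under eq_bigr => k _ do rewrite inner.
rewrite mulr_sumr mulr_suml; apply: eq_bigr => j _.
by rewrite mulr_sumr mulr_suml.
Qed.

End ustat.

Section bonami.
Variables (R : realFieldType) (I : finType).
Implicit Types (s : seq I) (f : {ffun I -> bool}).

(** The sign (-1)^b, a Rademacher variable under the uniform law of b. *)
Definition sg (b : bool) : R := (-1) ^+ b.

Lemma sg_sqr b : sg b ^+ 2 = 1.
Proof. by rewrite /sg -exprM muln2 -signr_odd odd_double. Qed.

Lemma avg_sg : avg sg = 0.
Proof. by rewrite /avg big_bool /= /sg expr0 expr1 addNr mul0r. Qed.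

(** The odd moments of the added sign vanish. *)
Lemma avg_pow4_add_sign k (X L : {ffun I -> bool} -> R) :
  (forall f b, X (upd f k b) = X f) -> (forall f b, L (upd f k b) = L f) ->
  avg (fun f => (X f + sg (f k) * L f) ^+ 4) =
  avg (fun f => X f ^+ 4) + 6 * avg (fun f => X f ^+ 2 * L f ^+ 2)
  + avg (fun f => L f ^+ 4).
Proof.
move=> hX hL.
under eq_avg => f.
  have -> : (X f + sg (f k) * L f) ^+ 4 =
     X f ^+ 4 + 6 * ((sg (f k) ^+ 2) * (X f ^+ 2 * L f ^+ 2))
     + (sg (f k) ^+ 2) ^+ 2 * L f ^+ 4
     + sg (f k) * (4 * X f ^+ 3 * L f
                   + 4 * (sg (f k) ^+ 2) * X f * L f ^+ 3) by ring.
  rewrite sg_sqr expr1n !mul1r mulr1.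
  over.
rewrite !avgD avgZ avg_indep ?card_bool//.
  by rewrite avg_sg mul0r addr0.
by move=> f b; rewrite hX hL.
Qed.

Lemma linear_upd (b : I -> R) s k f c : k \notin s ->
  \sum_(j <- s) b j * sg (upd f k c j) = \sum_(j <- s) b j * sg (f j).
Proof.
move=> ks; apply: eq_big_seq => j js; rewrite upd_neq//.
by apply: contra ks => /eqP <-.
Qed.

Lemma avg_pow2_linear (b : I -> R) s : uniq s ->
  avg (fun f => (\sum_(j <- s) b j * sg (f j)) ^+ 2) = \sum_(j <- s) b j ^+ 2.
Proof.
elim: s => [_|k s IH /= /andP[ks us]].
  under eq_avg do rewrite big_nil expr0n.
  by rewrite big_nil /= /avg big1// mul0r.
rewrite big_cons -(IH us).
under eq_avg => f.
  rewrite big_cons (_ : _ ^+ 2 = sg (f k) ^+ 2 * b k ^+ 2 + (\sum_(j <- s) b j * sg (f j)) ^+ 2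
    + sg (f k) * (2 * b k * \sum_(j <- s) b j * sg (f j))); last by ring.
  rewrite sg_sqr mul1r.
  over.
rewrite !avgD avg_indep ?card_bool//; last by move=> f c; rewrite linear_upd.
by rewrite avg_sg mul0r addr0 avg_cst// card_ffun card_bool expn_gt0.
Qed.

(** Khinchine's inequality, by induction on the signs: a new coefficient b adds
    6 b^2 V + b^4 to the fourth moment, V being the variance so far, which is at
    most what it adds to 3 V^2. *)
Lemma avg_pow4_linear (b : I -> R) s : uniq s ->
  avg (fun f => (\sum_(j <- s) b j * sg (f j)) ^+ 4) <=
  3 * (\sum_(j <- s) b j ^+ 2) ^+ 2.
Proof.
elim: s => [_|k s IH /= /andP[ks us]].
  under eq_avg do rewrite big_nil expr0n.
  by rewrite big_nil expr0n /= /avg big1// mul0r mulr0.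
have {}IH := IH us.
under eq_avg => f.
  rewrite big_cons (_ : _ + _ = \sum_(j <- s) b j * sg (f j) + sg (f k) * b k);
    last by ring.
  over.
rewrite avg_pow4_add_sign//; last by move=> f c; rewrite linear_upd.
rewrite avgZr big_cons avg_pow2_linear// avg_cst; last first.
  by rewrite card_ffun card_bool expn_gt0.
set X := avg _ in IH *; set V := \sum_(j <- s) b j ^+ 2 in IH *.
have -> : b k ^+ 4 = (b k ^+ 2) ^+ 2 by ring.
have := sqr_ge0 (b k ^+ 2).
by rewrite sqrrD; set q := b k ^+ 2; lra.
Qed.

Variable B : I -> I -> R.
Hypothesis Bsym : forall j k, B j k = B k j.
Hypothesis Bdiag : forall j, B j j = 0.

Let chaos s f := \sum_(j <- s) \sum_(k <- s) B j k * (sg (f j) * sg (f k)).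
Let lin s k f := \sum_(j <- s) (2 * B k j) * sg (f j).

Let chaos_cons k s f : chaos (k :: s) f = chaos s f + sg (f k) * lin s k f.
Proof.
rewrite /chaos big_cons [X in X + _]big_cons Bdiag mul0r add0r.
under [X in _ + X]eq_bigr do rewrite big_cons.
rewrite big_split /= addrA addrC; congr (_ + _).
rewrite -big_split mulr_sumr /=; apply: eq_bigr => j _.
by rewrite (Bsym j k); ring.
Qed.

Let var s := 2 * \sum_(j <- s) \sum_(k <- s) B j k ^+ 2.

Let var_cons k s : var (k :: s) = var s + \sum_(j <- s) (2 * B k j) ^+ 2.
Proof.
rewrite /var; under eq_bigr do rewrite big_cons.
rewrite big_cons Bdiag expr0n add0r.
rewrite big_split /= addrA addrC mulrDr; congr (_ + _).
rewrite -big_split mulr_sumr /=; apply: eq_bigr => j _.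
by rewrite (Bsym j k); ring.
Qed.

Let var_ge0 s : 0 <= var s.
Proof.
by rewrite mulr_ge0// sumr_ge0// => j _; rewrite sumr_ge0// => k _; rewrite sqr_ge0.
Qed.

Let chaos_pow4 s : uniq s ->
  avg (fun f => chaos s f ^+ 4) <= 81 * var s ^+ 2.
Proof.
elim: s => [_|k s IH /= /andP[ks us]].
  under eq_avg do rewrite /chaos big_nil expr0n.
  by rewrite /avg big1// mul0r mulr_ge0 ?sqr_ge0.
have {}IH := IH us.
under eq_avg do rewrite chaos_cons.
rewrite var_cons avg_pow4_add_sign; first last.
- by move=> f c; rewrite /lin linear_upd.
- move=> f c; apply: eq_big_seq => i si; apply: eq_big_seq => j sj.
  by rewrite !upd_neq//; apply: contra ks => /eqP <-.
have := avg_CauchySchwarz (fun f => chaos s f ^+ 2) (fun f => lin s k f ^+ 2).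
have L4 := avg_pow4_linear (fun j => 2 * B k j) us.
rewrite -/(lin s k) in L4.
under [in X in _ <= X -> _]eq_avg do rewrite -exprM.
under [in X in _ <= _ * X -> _]eq_avg do rewrite -exprM.
rewrite /= in L4 *.
set Z := avg _ => CS.
set X4 := avg (fun f => chaos s f ^+ 4) in IH CS *.
set Y4 := avg (fun f => lin s k f ^+ 4) in L4 CS *.
have V0 := var_ge0 s; set V := var s in IH V0 *.
have A0 : 0 <= \sum_(j <- s) (2 * B k j) ^+ 2 by rewrite sumr_ge0// => j _; rewrite sqr_ge0.
set A := \sum_(j <- s) _ in L4 A0 *.
have Z18 : Z <= 18 * (V * A).
  have VA0 : 0 <= 18 * (V * A) by rewrite mulr_ge0// mulr_ge0.
  rewrite -(ler_pXn2r (n := 2))//; last first.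
    by rewrite nnegrE avg_ge0// => f; rewrite mulr_ge0 ?sqr_ge0.
  apply: (le_trans CS); apply: (@le_trans _ _ (81 * V ^+ 2 * (3 * A ^+ 2))).
    by apply: ler_pM => //; rewrite avg_ge0// => f; rewrite -[4%N]/(2 * 2)%N exprM sqr_ge0.
  have -> : (18 * (V * A)) ^+ 2 = 324 * (V ^+ 2 * A ^+ 2) by ring.
  have : 0 <= V ^+ 2 * A ^+ 2 by rewrite mulr_ge0 ?sqr_ge0.
  have -> : 81 * V ^+ 2 * (3 * A ^+ 2) = 243 * (V ^+ 2 * A ^+ 2) by ring.
  lra.
have := mulr_ge0 V0 A0; have := sqr_ge0 A.
have -> : (V + A) ^+ 2 = V ^+ 2 + A ^+ 2 + 2 * (V * A) by ring.
move: Z18 IH L4; set VA := V * A; set VV := V ^+ 2; set AA := A ^+ 2.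
lra.
Qed.

(** Bonami's hypercontractive inequality for a Rademacher chaos of order two.
    A new sign multiplies a linear form whose variance A is added to the
    variance V of the chaos; its fourth moment is at most 3 A^2, and the cross
    term is at most 6 sqrt(81 V^2 * 3 A^2) <= 162 V A by Cauchy-Schwarz, so that
    81 (V + A)^2 is a bound again. *)
Lemma bonami_chaos2 :
  avg (fun f : {ffun I -> bool} =>
    (\sum_j \sum_k B j k * (sg (f j) * sg (f k))) ^+ 4) <=
  81 * (2 * \sum_j \sum_k B j k ^+ 2) ^+ 2.
Proof. exact: (chaos_pow4 (index_enum_uniq I)). Qed.

End bonami.

(** * Stein's method for sums of independent terms *)

Section stein_sum.
Variables (R : realType) (I E : finType).
Hypothesis E0 : (0 < #|E|)%N.
Variable T : I -> E -> R.
Hypothesis T0 : forall a, avg (T a) = 0.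
Variables (g g' : R -> R) (C : R).
Hypothesis C0 : 0 <= C.
Hypothesis dg : forall x : R, is_derive x 1 g (g' x).
Hypothesis g'_lip : forall x y, `|g' x - g' y| <= C * `|x - y|.

Let W (f : {ffun I -> E}) : R := \sum_a T a (f a).

Lemma taylor1 x t : `|g (x + t) - g x - t * g' x| <= C * t ^+ 2.
Proof.
have aux y z : y <= z -> exists c, [/\ y <= c, c <= z & g z - g y = g' c * (z - y)].
  by move=> yz; apply: MVT_closed.
have [c [ct e]] : exists c, `|c - x| <= `|t| /\ g (x + t) - g x = g' c * t.
  have [t0|/ltW t0] := leP 0 t.
    have [|c [xc cx ->]] := aux x (x + t); first by rewrite lerDl.
    exists c; split; last by rewrite addrC addKr.
    by rewrite !ger0_norm ?subr_ge0//; lra.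
  have [|c [xc cx e]] := aux (x + t) x; first by rewrite gerDl.
  exists c; split.
    by rewrite !ler0_norm ?subr_le0//; lra.
  by rewrite -opprB e; ring.
rewrite e (_ : _ - _ = (g' c - g' x) * t); last by ring.
rewrite normrM -(real_normK (num_real t)) expr2 mulrA ler_wpM2r//.
by rewrite (le_trans (g'_lip _ _))// ler_wpM2l.
Qed.

(** Stein's method with leave-one-out decoupling: W minus its a-th term is
    independent of that term, and Taylor's formula around it turns T_a g(W)
    into v_a g'(W) with an error of third order in T_a. The free parameter lam
    splits |T_a|^3 into second and fourth moments by the arithmetic-geometric
    inequality. *)
Lemma stein_sum_bound lam : 0 < lam ->
  `|avg (fun f => W f * g (W f))
    - (\sum_a avg (fun e => T a e ^+ 2)) * avg (fun f => g' (W f))| <=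
  C * (lam * (\sum_a avg (fun e => T a e ^+ 2))
       + lam^-1 * (\sum_a avg (fun e => T a e ^+ 4))).
Proof.
move=> lam0.
have W0 : (0 < #|{ffun I -> E}|)%N by rewrite card_ffun expn_gt0 E0.
pose Wa a f := W f - T a (f a).
have Wa_upd a f e : Wa a (upd f a e) = Wa a f.
  rewrite /Wa /W (bigD1 a)//= [in RHS](bigD1 a)//= updE.
  rewrite (eq_bigr (fun b => T b (f b))) => [|b ba]; last by rewrite upd_neq.
  by ring.
pose v a := avg (fun e => T a e ^+ 2).
have one a : `|avg (fun f : {ffun I -> E} => T a (f a) * g (W f)) - v a * avg (fun f => g' (W f))| <=
    C * (lam * v a + lam^-1 * avg (fun e => T a e ^+ 4)).
  have -> : avg (fun f : {ffun I -> E} => T a (f a) * g (W f)) - v a * avg (fun f => g' (W f)) =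
      avg (fun f : {ffun I -> E} => T a (f a) * (g (W f) - g (Wa a f) - T a (f a) * g' (Wa a f))
                    + v a * (g' (Wa a f) - g' (W f))).
    rewrite avgD avgZ avgB.
    under [in RHS]eq_avg => f.
      rewrite (_ : _ * _ = T a (f a) * g (W f) - T a (f a) * g (Wa a f)
        - T a (f a) ^+ 2 * g' (Wa a f)); last by ring.
      over.
    rewrite !avgB [X in _ - X - _]avg_indep//; last by move=> f e; rewrite Wa_upd.
    rewrite (@avg_indep _ _ _ a (fun e => T a e ^+ 2) (fun f => g' (Wa a f)))//;
      last by move=> f e; rewrite Wa_upd.
    by rewrite T0 mul0r /v; ring.
  apply: (le_trans (ler_norm_avg _)).
  have v0 : 0 <= v a by apply: avg_ge0 => e; exact: sqr_ge0.
  have amgm (t : R) : `|t| <= (lam + lam^-1 * t ^+ 2) / 2.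
    have -> : lam + lam^-1 * t ^+ 2 = lam^-1 * (lam - `|t|) ^+ 2 + 2 * `|t|.
      by rewrite -(real_normK (num_real t)); field; rewrite gt_eqF.
    rewrite ler_pdivlMr// mulrC lerDr mulr_ge0 ?sqr_ge0// invr_ge0 ltW//.
  apply: (@le_trans _ _ (avg (fun f : {ffun I -> E} => C * ((lam * T a (f a) ^+ 2 + lam^-1 * T a (f a) ^+ 4)
      + (v a * lam + lam^-1 * (v a * T a (f a) ^+ 2))) / 2))).
    apply: ler_avg => f; apply: (le_trans (ler_normD _ _)).
    set t := T a (f a).
    have Wt : W f = Wa a f + t by rewrite /Wa subrK.
    have h1 : `|t * (g (W f) - g (Wa a f) - t * g' (Wa a f))| <= C * (`|t| * t ^+ 2).
      by rewrite normrM mulrCA ler_wpM2l// Wt taylor1.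
    have h2 : `|v a * (g' (Wa a f) - g' (W f))| <= C * (v a * `|t|).
      rewrite normrM (ger0_norm v0) mulrCA ler_wpM2l// distrC (le_trans (g'_lip _ _))//.
      by rewrite Wt addrC addKr.
    apply: (le_trans (lerD h1 h2)); rewrite -mulrDr -mulrA ler_wpM2l//.
    have := ler_wpM2r (sqr_ge0 t) (amgm t); have := ler_wpM2l v0 (amgm t).
    have -> : (lam + lam^-1 * t ^+ 2) / 2 * t ^+ 2 = (lam * t ^+ 2 + lam^-1 * t ^+ 4) / 2.
      by ring.
    have -> : v a * ((lam + lam^-1 * t ^+ 2) / 2) = (v a * lam + lam^-1 * (v a * t ^+ 2)) / 2.
      by ring.
    lra.
  rewrite avgZr avgZ !avgD !avgZ avg_cst//.
  rewrite !(avg_marginal E0 a (fun e => T a e ^+ _)) -/(v a).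
  have v4 : v a * v a <= avg (fun e => T a e ^+ 4).
    have := avg_CauchySchwarz (fun e => T a e ^+ 2) (fun=> 1).
    under eq_avg do rewrite mulr1.
    rewrite expr1n avg_cst// mulr1 -/(v a) expr2.
    by under [in X in _ <= X -> _]eq_avg do rewrite -exprM.
  rewrite -mulrA ler_wpM2l//.
  have := ler_wpM2l (_ : 0 <= lam^-1) v4; rewrite invr_ge0 ltW// => /(_ isT).
  lra.
have -> : avg (fun f => W f * g (W f)) - (\sum_a v a) * avg (fun f => g' (W f)) =
    \sum_a (avg (fun f : {ffun I -> E} => T a (f a) * g (W f)) - v a * avg (fun f => g' (W f))).
  rewrite mulr_suml sumrB -avg_sum; congr (_ - _).
  by apply: eq_avg => f; rewrite -mulr_suml.
apply: (le_trans (ler_norm_sum _ _ _)).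
by rewrite !mulr_sumr -big_split /= mulr_sumr; apply: ler_sum => a _; exact: one.
Qed.

End stein_sum.

(** * Stein's method for quadratic forms of sign-symmetric columns *)

Section sketch.
(* K is the set of possible columns, with entries indexed by I, and J indexes
   the columns of the sketch. *)
Variables (R : realType) (I J K : finType) (r : K -> I -> R) (z : R).
Variable flip : {ffun I -> bool} -> K -> K.
Let mu : R := (#|I|%:R)^-1.
Hypothesis I0 : (0 < #|I|)%N.
Hypothesis K0 : (0 < #|K|)%N.
Hypothesis z0 : 0 < z.
Hypothesis r_norm : forall k, \sum_a r k a ^+ 2 = 1.
Hypothesis r_pow4 : forall k a, r k a ^+ 4 = r k a ^+ 2 / z.
Hypothesis r_avg : forall a, avg (fun k => r k a ^+ 2) = mu.
Hypothesis r_avg2 : forall a b, a != b ->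
  avg (fun k => r k a ^+ 2 * r k b ^+ 2) <= mu ^+ 2.
Hypothesis flip_bij : forall e, bijective (flip e).
Hypothesis flipE : forall e k a, r (flip e k) a = sg R (e a) * r k a.

Variable B : J -> J -> R.
Hypothesis Bsym : forall j k, B j k = B k j.
Hypothesis Bdiag : forall j, B j j = 0.

Let m : R := #|I|%:R.
Let s : R := Num.sqrt m.
Let b2 := 2 * \sum_j \sum_k B j k ^+ 2.
Let b4 := \sum_j \sum_k B j k ^+ 4.
Let c j := \sum_k B j k ^+ 2.
Let cc := \sum_j c j ^+ 2.

Let m0 : 0 < m. Proof. by rewrite ltr0n. Qed.
Let mu0 : 0 < mu. Proof. by rewrite invr_gt0. Qed.
Let mmu : m * mu = 1. Proof. by rewrite /mu mulfV// gt_eqF. Qed.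

(* Y is a quadratic form in the columns. T f a is the contribution of the row a
   after signs have been drawn for it, v f a is the variance of T f a over
   these signs, and rt is the centred square of an entry. *)
Let rho k a := r k a ^+ 2.
Let Y (f : {ffun J -> K}) : R :=
  s * \sum_j \sum_k B j k * \sum_a r (f j) a * r (f k) a.
Let T (f : {ffun J -> K}) a (e : {ffun J -> bool}) : R :=
  \sum_j \sum_k (s * B j k * (r (f j) a * r (f k) a)) * (sg R (e j) * sg R (e k)).
Let v (f : {ffun J -> K}) a : R := 2 * m * \sum_j \sum_k B j k ^+ 2 * (rho (f j) a * rho (f k) a).

(** Flipping the signs of all the entries at random preserves the law of the
    columns, and makes the rows independent given their squares. *)
Let avg_Y (h : R -> R) : avg (fun f => h (Y f)) =
  avg (fun f => avg (fun e : {ffun I -> {ffun J -> bool}} => h (\sum_a T f a (e a)))).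
Proof.
rewrite avg_exchange.
have E0 : (0 < #|{ffun I -> {ffun J -> bool}}|)%N.
  by rewrite card_ffun expn_gt0 card_ffun expn_gt0 card_bool.
rewrite -[LHS](avg_cst _ E0); apply: eq_avg => e.
pose phi (f : {ffun J -> K}) : {ffun J -> K} := [ffun j => flip [ffun a => e a j] (f j)].
have phib : bijective phi.
  have /choice[psi hpsi] : forall j, exists g, cancel (flip [ffun a => e a j]) g /\
      cancel g (flip [ffun a => e a j]).
    by move=> j; have [g h1 h2] := flip_bij [ffun a => e a j]; exists g.
  exists (fun f : {ffun J -> K} => [ffun j => psi j (f j)]) => f; apply/ffunP => j; rewrite !ffunE;
    by have [h1 h2] := hpsi j.
rewrite -(avg_bij _ phib); apply: eq_avg => f; congr h.
rewrite /Y /T mulr_sumr [RHS]exchange_big; apply: eq_bigr => j _ /=.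
rewrite mulr_sumr [RHS]exchange_big; apply: eq_bigr => k _ /=.
rewrite mulrA mulr_sumr; apply: eq_bigr => a _.
rewrite /phi !ffunE !flipE !ffunE.
by ring.
Qed.

Let bool0 : (0 < #|{: bool}|)%N. Proof. by rewrite card_bool. Qed.

Let T_mean f a : avg (T f a) = 0.
Proof.
rewrite /T avg_sum big1// => j _; rewrite avg_sum big1// => k _.
have [->|jk] := eqVneq j k.
  by under eq_avg do rewrite Bdiag mulr0 mul0r mul0r; rewrite /avg big1// mul0r.
rewrite avgZ (avg_marginal2 bool0 (fun x y => sg R x * sg R y) jk).
under eq_avg do rewrite avgZ avg_sg mulr0.
by rewrite /avg big1// mul0r mulr0.
Qed.

Let T_coef (f : {ffun J -> K}) a : 2 * \sum_j \sum_k (s * B j k * (r (f j) a * r (f k) a)) ^+ 2 = v f a.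
Proof.
rewrite /v -mulrA; congr (_ * _); rewrite mulr_sumr; apply: eq_bigr => j _.
rewrite mulr_sumr; apply: eq_bigr => k _.
by rewrite /rho !exprMn sqr_sqrtr ?ltW//; ring.
Qed.

Let T_var f a : avg (fun e => T f a e ^+ 2) = v f a.
Proof.
rewrite /T (@avg_sqr_quadratic R J bool bool0
   (fun j k => s * B j k * (r (f j) a * r (f k) a)) (fun x y => sg R x * sg R y)).
- rewrite T_coef.
  under [X in _ * X]eq_avg => x.
    under eq_avg => y do rewrite exprMn !sg_sqr mulr1.
    rewrite avg_cst//.
    over.
  by rewrite avg_cst// mulr1.
- by move=> j k; rewrite Bsym; ring.
- by move=> j; rewrite Bdiag mulr0 mul0r.
- by move=> x y; rewrite mulrC.
- by move=> x; rewrite avgZ avg_sg mulr0.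
Qed.

Let T_pow4 f a : avg (fun e => T f a e ^+ 4) <= 81 * v f a ^+ 2.
Proof.
have := @bonami_chaos2 R J (fun j k => s * B j k * (r (f j) a * r (f k) a)).
rewrite T_coef; apply.
- by move=> j k; rewrite Bsym; ring.
- by move=> j; rewrite Bdiag mulr0 mul0r.
Qed.

Let rt k a := rho k a - mu.
Let psi1 x y := \sum_a rt x a * rt y a.

Let sumI (x : R) : \sum_(a : I) x = m * x.
Proof. by rewrite sumr_const -mulr_natl. Qed.

Let rho_pow2 k a : rho k a ^+ 2 = rho k a / z.
Proof. by rewrite /rho -exprM r_pow4. Qed.

Let rt_avg a : avg (fun k => rt k a) = 0.
Proof. by rewrite /rt avgB avg_cst// r_avg subrr. Qed.

Let rt_var a : avg (fun k => rt k a ^+ 2) <= mu / z.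
Proof.
under eq_avg => k.
  rewrite (_ : _ ^+ 2 = z^-1 * rho k a - 2 * mu * rho k a + mu ^+ 2); last first.
    by rewrite /rt sqrrB rho_pow2; ring.
  over.
rewrite avgD avgB !avgZ avg_cst// r_avg.
have := sqr_ge0 mu; rewrite [mu / z]mulrC.
have -> : 2 * mu * mu = 2 * mu ^+ 2 by ring.
lra.
Qed.

Let psi1E x y : psi1 x y = \sum_a rho x a * rho y a - mu.
Proof.
rewrite /psi1 /rt.
under eq_bigr => a _.
  rewrite (_ : _ * _ = rho x a * rho y a - mu * rho x a - mu * rho y a + mu ^+ 2);
    last by ring.
  over.
rewrite !big_split /= !sumrN sumI -!mulr_sumr !r_norm mulr1.
by have -> : m * mu ^+ 2 = m * mu * mu; [ring|rewrite mmu; ring].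
Qed.

Let psi1_sym x y : psi1 x y = psi1 y x.
Proof. by apply: eq_bigr => a _; rewrite mulrC. Qed.

Let psi1_deg x : avg (psi1 x) = 0.
Proof. by rewrite avg_sum big1// => a _; rewrite avgZ rt_avg mulr0. Qed.

(** The kernel psi1 is the centred squared overlap of two columns. Its second
    moment is the sum over pairs of entries of the squared mean products
    of squares, minus mu^2: the diagonal contributes mu / z^2, and the
    off-diagonal at most mu^2 by negative correlation. *)
Let psi1_var : avg (fun x => avg (fun y => psi1 x y ^+ 2)) <= mu / z ^+ 2.
Proof.
pose q a b := avg (fun k => rho k a * rho k b).
have q0 a b : 0 <= q a b by apply: avg_ge0 => k; rewrite mulr_ge0 ?sqr_ge0.
have qd a : q a a = mu / z.
  by rewrite /q; under eq_avg do rewrite -expr2 rho_pow2; rewrite avgZr r_avg.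
pose N x y := \sum_a rho x a * rho y a.
have N1 : avg (fun x => avg (N x)) = mu.
  under eq_avg => x.
    rewrite avg_sum; under eq_bigr => a _ do rewrite avgZ r_avg.
    rewrite -mulr_suml r_norm mul1r.
    over.
  by rewrite avg_cst.
have N2 : avg (fun x => avg (fun y => N x y ^+ 2)) = \sum_a \sum_b q a b ^+ 2.
  under eq_avg => x.
    under eq_avg => y do rewrite expr2 mulr_suml.
    rewrite avg_sum; under eq_bigr => a _.
      under eq_avg => y do rewrite mulr_sumr.
      rewrite avg_sum; under eq_bigr => b _.
        under eq_avg => y do rewrite mulrACA.
        rewrite avgZ -/(q a b).
        over.
      over.
    over.
  rewrite avg_sum; apply: eq_bigr => a _; rewrite avg_sum; apply: eq_bigr => b _.
  by rewrite avgZr expr2.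
have -> : avg (fun x => avg (fun y => psi1 x y ^+ 2)) = \sum_a \sum_b q a b ^+ 2 - mu ^+ 2.
  rewrite -N2; transitivity (avg (fun x => avg (fun y => N x y ^+ 2) - 2 * mu * avg (N x) + mu ^+ 2)).
    apply: eq_avg => x; rewrite -avgZ -avgB -[X in _ = _ + X](avg_cst _ K0) -avgD.
    by apply: eq_avg => y; rewrite psi1E /N; ring.
  by rewrite avgD avgB avgZ N1 avg_cst//; ring.
rewrite lerBlDr.
have bd a b : q a b ^+ 2 <= mu ^+ 4 + (if a == b then (mu / z) ^+ 2 else 0).
  case: eqVneq => [<-|ab]; first by rewrite qd lerDr exprn_ge0// ltW.
  have -> : mu ^+ 4 = (mu ^+ 2) ^+ 2 by ring.
  by rewrite addr0 ler_pXn2r ?nnegrE ?sqr_ge0//; exact: r_avg2.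
apply: (@le_trans _ _ (\sum_(a : I) \sum_(b : I) (mu ^+ 4 + (if a == b then (mu / z) ^+ 2 else 0)))).
  by apply: ler_sum => a _; apply: ler_sum => b _; exact: bd.
under eq_bigr => a _.
  rewrite big_split /= sumI -big_mkcond /= (eq_bigl (pred1 a)) => [|b]; last first.
    by rewrite eq_sym.
  rewrite big_pred1_eq.
  over.
rewrite sumI mulrDr.
have -> : m * (m * mu ^+ 4) = (m * mu) ^+ 2 * mu ^+ 2 by ring.
have -> : m * (mu / z) ^+ 2 = (m * mu) * (mu / z ^+ 2) by rewrite exprMn -exprVn; ring.
by rewrite mmu expr1n !mul1r addrC.
Qed.

Let b4_ge0 : 0 <= b4.
Proof.
apply: sumr_ge0 => j _; apply: sumr_ge0 => k _.
by rewrite (_ : _ ^+ 4 = (B j k ^+ 2) ^+ 2) ?sqr_ge0// -exprM.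
Qed.

Let B2sym j k : B j k ^+ 2 = B k j ^+ 2. Proof. by rewrite Bsym. Qed.
Let B2diag j : B j j ^+ 2 = 0. Proof. by rewrite Bdiag expr0n. Qed.

Let b4E : \sum_j \sum_k (B j k ^+ 2) ^+ 2 = b4.
Proof. by apply: eq_bigr => j _; apply: eq_bigr => k _; rewrite -exprM. Qed.

(* the variance of Y given the squares, and its centred part *)
Let sigma2 (f : {ffun J -> K}) : R := \sum_a v f a.
Let dev (f : {ffun J -> K}) : R := \sum_j \sum_k B j k ^+ 2 * psi1 (f j) (f k).

Let sigma2E f : sigma2 f = b2 + 2 * m * dev f.
Proof.
rewrite /sigma2 /v -mulr_sumr exchange_big /=.
have -> : b2 = 2 * m * (mu * \sum_j \sum_k B j k ^+ 2).
  by rewrite /b2 -{1}[2]mulr1 -mmu; ring.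
rewrite -mulrDr; congr (_ * _); rewrite mulr_sumr -big_split; apply: eq_bigr => j _ /=.
rewrite exchange_big mulr_sumr -big_split /=; apply: eq_bigr => k _.
by rewrite -mulr_sumr psi1E; ring.
Qed.

Let avg_dev : avg dev = 0.
Proof.
rewrite avg_sum big1// => j _; rewrite avg_sum big1// => k _; rewrite avgZ.
have [->|jk] := eqVneq j k; first by rewrite B2diag mul0r.
rewrite (avg_marginal2 K0 psi1 jk); under eq_avg do rewrite psi1_deg.
by rewrite avg_cst// mulr0.
Qed.

Let KJ0 : (0 < #|{ffun J -> K}|)%N. Proof. by rewrite card_ffun expn_gt0 K0. Qed.

Let avg_sigma2 : avg sigma2 = b2.
Proof.
rewrite (eq_avg sigma2E).
by rewrite avgD avg_cst// avgZ avg_dev mulr0 addr0.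
Qed.

Let avg_sigma2_dev : avg (fun f : {ffun J -> K} => (1 - sigma2 f) ^+ 2) <=
  (1 - b2) ^+ 2 + 8 * (m / z ^+ 2) * b4.
Proof.
under eq_avg => f.
  rewrite (_ : _ ^+ 2 = (1 - b2) ^+ 2 - (4 * m * (1 - b2)) * dev f + 4 * m ^+ 2 * dev f ^+ 2);
    last by rewrite sigma2E; ring.
  over.
rewrite avgD avgB avg_cst// !avgZ avg_dev mulr0 subr0 lerD2l.
rewrite (avg_sqr_quadratic K0 B2sym B2diag psi1_sym psi1_deg) b4E.
set p := avg _.
have pb : p <= mu / z ^+ 2 := psi1_var.
have -> : 8 * (m / z ^+ 2) * b4 = 4 * m ^+ 2 * (2 * b4 * (mu / z ^+ 2)).
  have -> : 4 * m ^+ 2 * (2 * b4 * (mu / z ^+ 2)) = 8 * (m * (m * mu) / z ^+ 2) * b4 by ring.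
  by rewrite mmu mulr1.
by rewrite !ler_wpM2l// ?mulr_ge0// ?sqr_ge0.
Qed.

Let rt_lin a : avg (fun f : {ffun J -> K} => (\sum_j c j * rt (f j) a) ^+ 2) <= cc * (mu / z).
Proof.
rewrite (avg_sqr_linear K0 c (rt_avg a)) ler_wpM2l ?rt_var//.
by rewrite sumr_ge0// => j _; exact: sqr_ge0.
Qed.

Let rt_quad a : avg (fun f : {ffun J -> K} =>
   (\sum_j \sum_k B j k ^+ 2 * (rt (f j) a * rt (f k) a)) ^+ 2) <= 2 * b4 * (mu / z) ^+ 2.
Proof.
rewrite (@avg_sqr_quadratic _ _ _ K0 (fun j k => B j k ^+ 2)
  (fun x y => rt x a * rt y a))//.
- rewrite b4E ler_wpM2l ?mulr_ge0//.
  under eq_avg => x.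
    under eq_avg => y do rewrite exprMn.
    rewrite avgZ.
    over.
  rewrite avgZr -expr2 ler_pXn2r ?nnegrE ?rt_var// ?avg_ge0//.
  + by move=> x; exact: sqr_ge0.
  + by rewrite divr_ge0// ltW.
- by move=> x y; rewrite mulrC.
- by move=> x; rewrite avgZ rt_avg mulr0.
Qed.

(** The Hoeffding decomposition of the variance of a row: mean, linear part and
    degenerate quadratic part. *)
Let vE f a : v f a = b2 * mu + 4 * (\sum_j c j * rt (f j) a)
  + 2 * m * \sum_j \sum_k B j k ^+ 2 * (rt (f j) a * rt (f k) a).
Proof.
have e1 : \sum_j \sum_k B j k ^+ 2 * rt (f k) a = \sum_j c j * rt (f j) a.
  rewrite exchange_big; apply: eq_bigr => j _; rewrite /c mulr_suml.
  by apply: eq_bigr => k _; rewrite Bsym.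
have e2 : \sum_j \sum_k B j k ^+ 2 * rt (f j) a = \sum_j c j * rt (f j) a.
  by apply: eq_bigr => j _; rewrite /c mulr_suml.
have -> : v f a = 2 * m * (mu ^+ 2 * (\sum_j \sum_k B j k ^+ 2)
    + mu * (\sum_j \sum_k B j k ^+ 2 * rt (f j) a)
    + mu * (\sum_j \sum_k B j k ^+ 2 * rt (f k) a)
    + \sum_j \sum_k B j k ^+ 2 * (rt (f j) a * rt (f k) a)).
  rewrite /v; congr (_ * _); rewrite !mulr_sumr -!big_split; apply: eq_bigr => j _ /=.
  rewrite !mulr_sumr -!big_split; apply: eq_bigr => k _ /=.
  by rewrite /rt; ring.
rewrite e1 e2 /b2; set S := \sum_j _; set L := \sum_j c j * _; set Q := \sum_j _.
have -> : 2 * m * (mu ^+ 2 * S + mu * L + mu * L + Q) =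
   2 * (m * mu) * mu * S + 4 * (m * mu) * L + 2 * m * Q by ring.
by rewrite mmu; ring.
Qed.

Let avg_v2 : avg (fun f : {ffun J -> K} => \sum_a v f a ^+ 2) <=
  3 * b2 ^+ 2 / m + 48 * cc / z + 24 * (m / z ^+ 2) * b4.
Proof.
rewrite avg_sum.
apply: (@le_trans _ _ (\sum_(a : I) (3 * (b2 * mu) ^+ 2 + 48 * (cc * (mu / z))
    + 12 * m ^+ 2 * (2 * b4 * (mu / z) ^+ 2)))).
  apply: ler_sum => a _.
  apply: (@le_trans _ _ (avg (fun f : {ffun J -> K} => 3 * (b2 * mu) ^+ 2
     + 48 * (\sum_j c j * rt (f j) a) ^+ 2
     + 12 * m ^+ 2 * (\sum_j \sum_k B j k ^+ 2 * (rt (f j) a * rt (f k) a)) ^+ 2))).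
    apply: ler_avg => f; rewrite vE; set x := b2 * mu; set L := \sum_j c j * _; set Q := \sum_j _.
    have := sqr_ge0 (x - 4 * L); have := sqr_ge0 (x - 2 * m * Q).
    have := sqr_ge0 (4 * L - 2 * m * Q); rewrite -subr_ge0 => h1 h2 h3.
    have -> : 3 * x ^+ 2 + 48 * L ^+ 2 + 12 * m ^+ 2 * Q ^+ 2
       = (x + 4 * L + 2 * m * Q) ^+ 2 + (x - 4 * L) ^+ 2 + (x - 2 * m * Q) ^+ 2
       + (4 * L - 2 * m * Q) ^+ 2 by ring.
    lra.
  rewrite !avgD !avgZ avg_cst// !lerD// ler_wpM2l//.
  by rewrite mulr_ge0 ?sqr_ge0.
rewrite sumI.
have muE : mu = m^-1 by [].
rewrite le_eqVlt; apply/orP; left; apply/eqP.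
by rewrite muE; field; rewrite !gt_eqF.
Qed.

(** Given the squares of the entries, Y is a sum of independent centred rows, to
    which stein_sum_bound applies. What remains is the mean of
    |1 - sigma2| and of the sum of the v^2, since by Bonami's inequality the
    fourth moments of the rows are at most 81 v^2. *)
Lemma stein_sketch g g' (C : R) : 0 <= C ->
  (forall x : R, is_derive x 1 g (g' x)) -> (forall x, `|g' x| <= C) ->
  (forall x y, `|g' x - g' y| <= C * `|x - y|) ->
  forall lam, 0 < lam ->
  `|avg (fun f => g' (Y f) - Y f * g (Y f))| <=
  C * (lam * (1 + b2) + lam^-1 * ((1 - b2) ^+ 2 + 243 * b2 ^+ 2 / m
     + 3888 * cc / z + 1952 * (m / z ^+ 2) * b4)).
Proof.
move=> C0 dg g'C g'lip lam lam0.
rewrite (avg_Y (fun y => g' y - y * g y)).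
have E0 : (0 < #|{ffun J -> bool}|)%N by rewrite card_ffun expn_gt0 card_bool.
have D0 : (0 < #|{ffun I -> {ffun J -> bool}}|)%N by rewrite card_ffun expn_gt0 E0.
have il0 : 0 < lam^-1 by rewrite invr_gt0.
apply: (le_trans (ler_norm_avg _)).
apply: (@le_trans _ _ (avg (fun f : {ffun J -> K} => C * ((lam + lam^-1 * (1 - sigma2 f) ^+ 2) / 2
   + (lam * sigma2 f + lam^-1 * (81 * \sum_a v f a ^+ 2)))))).
  apply: ler_avg => f.
  pose W (e : {ffun I -> {ffun J -> bool}}) : R := \sum_a T f a (e a).
  have := @stein_sum_bound R I _ E0 (T f) (T_mean f) g g' C C0 dg g'lip lam lam0.
  have -> : \sum_a avg (fun e => T f a e ^+ 2) = sigma2 f.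
    by apply: eq_bigr => a _; exact: T_var.
  have S4 : \sum_a avg (fun e => T f a e ^+ 4) <= 81 * \sum_a v f a ^+ 2.
    by rewrite mulr_sumr; apply: ler_sum => a _; exact: T_pow4.
  rewrite avgB -/W.
  set G := avg (fun e => g' (W e)); set P := avg (fun e => W e * g (W e)) => hP.
  have GC : `|G| <= C.
    apply: (le_trans (ler_norm_avg _)); rewrite -[leRHS](avg_cst C D0).
    by apply: ler_avg => e; exact: g'C.
  have h1 : `|(1 - sigma2 f) * G| <= C * ((lam + lam^-1 * (1 - sigma2 f) ^+ 2) / 2).
    rewrite normrM mulrC ler_pM//.
    set t := 1 - _.
    have -> : lam + lam^-1 * t ^+ 2 = lam^-1 * (lam - `|t|) ^+ 2 + 2 * `|t|.
      by rewrite -(real_normK (num_real t)); field; rewrite gt_eqF.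
    by rewrite ler_pdivlMr// mulrC lerDr mulr_ge0 ?sqr_ge0// ltW.
  have -> : G - P = (1 - sigma2 f) * G + - (P - sigma2 f * G) by ring.
  apply: (le_trans (ler_normD _ _)); rewrite normrN mulrDr lerD//.
  by apply: (le_trans hP); rewrite ler_wpM2l// lerD2l ler_wpM2l// ltW.
rewrite avgZ avgD avgZr avgD avg_cst// [avg (fun f => lam^-1 * (1 - _) ^+ 2)]avgZ.
rewrite avgD [avg (fun f => lam * _)]avgZ avg_sigma2.
rewrite [avg (fun f => lam^-1 * (81 * _))]avgZ [avg (fun f => 81 * _)]avgZ ler_wpM2l//.
have := ler_wpM2l (ltW il0) avg_sigma2_dev; have := ler_wpM2l (ltW il0) avg_v2.
set D2 := avg _; set D3 := avg _ => h3 h2.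
have : 0 <= lam^-1 * (1 - b2) ^+ 2 by rewrite mulr_ge0 ?sqr_ge0// ltW.
have : 0 <= lam^-1 * (8 * (m / z ^+ 2) * b4).
  by rewrite !mulr_ge0 ?(ltW il0) ?invr_ge0 ?sqr_ge0// ltW.
have -> : lam * (1 + b2) + lam^-1 * ((1 - b2) ^+ 2 + 243 * b2 ^+ 2 / m
     + 3888 * cc / z + 1952 * (m / z ^+ 2) * b4) = lam * (1 + b2)
  + lam^-1 * ((1 - b2) ^+ 2 + 8 * (m / z ^+ 2) * b4)
  + 81 * (lam^-1 * (3 * b2 ^+ 2 / m + 48 * cc / z + 24 * (m / z ^+ 2) * b4)) by ring.
rewrite [lam^-1 * (81 * _)]mulrCA.
rewrite [lam^-1 * ((1 - b2) ^+ 2 + _)]mulrDr in h2 *.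
lra.
Qed.

End sketch.

(** * Sparse sign vectors *)

Section sparse_signs.
Variables (R : realType) (m z : nat).
Hypothesis z_gt0 : (0 < z)%N.
Local Notation signs := (sparse_signs R m z).

Lemma sparse_signs_finite : finite_set signs.
Proof.
apply: finite_image.
pose h (g : {ffun 'I_m -> 'I_3}) : 'cV[R]_m := \col_k nth 0 [:: 1; -1; 0] (g k).
apply: (@sub_finite_set _ _ (range h)); last exact/finite_image/finite_finset.
move=> f /= [f3 _]; exists [ffun k => inord (index (f k 0) [:: 1; -1; 0])] => //.
apply/colP => k; rewrite mxE ffunE inordK ?nth_index//.
by rewrite -[X in (_ < X)%N]/(size [:: 1; -1; 0 : R]) index_mem.
Qed.

Definition sparse_col : Type := fset_set signs.
HB.instance Definition _ := Finite.on sparse_col.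

Lemma sparse_colP (k : sparse_col) : signs (val k).
Proof. by have := valP k; rewrite in_fset_set ?inE//; exact: sparse_signs_finite. Qed.

Definition to_col (x : 'cV[R]_m) (hx : signs x) : sparse_col.
Proof.
exists x; rewrite in_fset_set ?inE//; exact: sparse_signs_finite.
Defined.

Definition entry (k : sparse_col) (a : 'I_m) : R := val k a 0.

Let zR : 0 < z%:R :> R. Proof. by rewrite ltr0n. Qed.

Lemma entry_sqr k a : entry k a ^+ 2 = 0 \/ entry k a ^+ 2 = z%:R^-1.
Proof.
rewrite /entry; have [f [f3 _] <-] := sparse_colP k.
rewrite mxE exprMn exprVn sqr_sqrtr ?ltW//.
have := f3 a; rewrite !inE => /or3P[/eqP->|/eqP->|/eqP->].
- by right; rewrite expr1n mulr1.
- by right; rewrite sqrrN expr1n mulr1.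
- by left; rewrite expr0n mulr0.
Qed.

Lemma entry_norm k : \sum_a entry k a ^+ 2 = 1.
Proof.
have [f [_ fz] fk] := sparse_colP k.
under eq_bigr do rewrite /entry -fk mxE exprMn exprVn sqr_sqrtr ?(ltW zR)//.
by rewrite -mulr_sumr fz mulVf// gt_eqF.
Qed.

Lemma entry_pow4 k a : entry k a ^+ 4 = entry k a ^+ 2 / z%:R.
Proof.
have -> : entry k a ^+ 4 = entry k a ^+ 2 * entry k a ^+ 2 by rewrite -exprD.
by case: (entry_sqr k a) => ->; rewrite ?mulr0 ?mul0r.
Qed.

Let flip_signs (e : {ffun 'I_m -> bool}) x :
  signs x -> signs (\col_a (sg R (e a) * x a 0)).
Proof.
move=> [f [f3 fz] <-]; exists (\col_a (sg R (e a) * f a 0)); last first.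
  by apply/colP => a; rewrite !mxE mulrCA.
split=> [k|].
  rewrite mxE /sg; have := f3 k; rewrite !inE.
  case: (e k); rewrite ?expr0 ?expr1 ?mul1r// mulN1r.
  by move=> /or3P[/eqP->|/eqP->|/eqP->]; rewrite ?opprK ?oppr0 eqxx ?orbT.
by rewrite -fz; apply: eq_bigr => k _; rewrite mxE exprMn sg_sqr mul1r.
Qed.

(** Sign flips and transpositions of the entries permute the set of columns;
    the moments of the entries come from these symmetries. *)
Definition flip (e : {ffun 'I_m -> bool}) (k : sparse_col) : sparse_col :=
  to_col (flip_signs e (sparse_colP k)).

Lemma flipE e k a : entry (flip e k) a = sg R (e a) * entry k a.
Proof. by rewrite /entry /= mxE. Qed.

Lemma entry_inj k k' : entry k =1 entry k' -> k = k'.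
Proof. by move=> h; apply/val_inj/colP => a; exact: h. Qed.

Lemma flip_bij e : bijective (flip e).
Proof.
by apply: inv_bij => k; apply: entry_inj => a; rewrite !flipE mulrA -expr2 sg_sqr mul1r.
Qed.

Let swap_signs (a b : 'I_m) x : signs x -> signs (row_perm (tperm a b) x).
Proof.
move=> [f [f3 fz] <-]; exists (row_perm (tperm a b) f); last first.
  by apply/colP => k; rewrite !mxE.
split=> [k|]; first by rewrite mxE.
rewrite -fz [RHS](reindex_inj (@perm_inj _ (tperm a b))) /=.
by apply: eq_bigr => k _; rewrite mxE.
Qed.

Let swap a b (k : sparse_col) : sparse_col := to_col (swap_signs a b (sparse_colP k)).

Let swapE a b k c : entry (swap a b k) c = entry k (tperm a b c).
Proof. by rewrite /entry /= mxE. Qed.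

Let swap_bij a b : bijective (swap a b).
Proof.
by apply: inv_bij => k; apply: entry_inj => c; rewrite !swapE tpermK.
Qed.

Section averages.
Hypothesis signs0 : signs !=set0.

Lemma sparse_col_gt0 : (0 < #|{: sparse_col}|)%N.
Proof. by have [x hx] := signs0; apply/card_gt0P; exists (to_col hx). Qed.

Lemma sparse_le : (z <= m)%N.
Proof.
have [x [f [f3 fz] _]] := signs0.
rewrite -(ler_nat R) -fz -[m in leRHS]card_ord -sum1_card natr_sum.
apply: ler_sum => k _; have := f3 k; rewrite !inE.
by move=> /or3P[/eqP->|/eqP->|/eqP->]; rewrite ?sqrrN ?expr1n ?expr0n.
Qed.

(** All entries have the same second moment, by transposition, and the sum of
    the squares is 1. *)
Lemma avg_entry_sqr a : avg (fun k => entry k a ^+ 2) = (#|'I_m|%:R)^-1.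
Proof.
have e b : avg (fun k => entry k b ^+ 2) = avg (fun k => entry k a ^+ 2).
  rewrite -(avg_bij _ (swap_bij a b)); apply: eq_avg => k.
  by rewrite swapE tpermR.
have : \sum_b avg (fun k => entry k b ^+ 2) = 1.
  rewrite -avg_sum; under eq_avg do rewrite entry_norm.
  by rewrite avg_cst// sparse_col_gt0.
under eq_bigr do rewrite e.
rewrite sumr_const -[_ *+ _]mulr_natl => h.
have m0 : #|'I_m|%:R != 0 :> R by apply: contra_eq_neq h => ->; rewrite mul0r eq_sym oner_neq0.
by apply: (mulfI m0); rewrite h mulfV.
Qed.

(** Fixing the sum of the squares makes them negatively correlated: summing
    over b gives m - 1 equal terms of total (1 - 1/z) / m. *)
Lemma avg_entry_sqr2 a b : a != b ->
  avg (fun k => entry k a ^+ 2 * entry k b ^+ 2) <= (#|'I_m|%:R)^-1 ^+ 2.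
Proof.
move=> ab; set q := avg _.
have e c : c != a -> avg (fun k => entry k a ^+ 2 * entry k c ^+ 2) = q.
  move=> ca; rewrite -(avg_bij _ (swap_bij b c)); apply: eq_avg => k.
  by rewrite !swapE tpermR tpermD// eq_sym.
have : \sum_(c | c != a) avg (fun k => entry k a ^+ 2 * entry k c ^+ 2) =
    (#|'I_m|%:R)^-1 * (1 - z%:R^-1).
  rewrite -avg_sum -(avg_entry_sqr a) -avgZr; apply: eq_avg => k.
  have -> : entry k a ^+ 2 * (1 - z%:R^-1) = entry k a ^+ 2 * (1 - entry k a ^+ 2).
    by rewrite !mulrBr !mulr1 -exprD entry_pow4.
  rewrite -mulr_sumr; congr (_ * _).
  by have := entry_norm k; rewrite (bigD1 a)//= => <-; rewrite addrC addrK.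
under eq_bigr => c ca do rewrite e//.
rewrite sumr_const cardC1 -[q *+ _]mulr_natl card_ord => h.
have m1 : (1 < m)%N.
  rewrite ltnNge; apply: contra ab => m1.
  have c0 (c : 'I_m) : (c : nat) = 0%N.
    by apply/eqP; rewrite -leqn0 -ltnS (leq_trans (ltn_ord c)).
  by rewrite -val_eqE /= !c0.
have mR : 0 < m%:R :> R by rewrite ltr0n (ltn_trans _ m1).
have m1R : 0 < m.-1%:R :> R by rewrite ltr0n; move: m1; case: (m) => [|[]].
rewrite -(ler_pM2l m1R) h.
have -> : m.-1%:R = m%:R - 1 :> R by rewrite -subn1 natrB// ltnW.
have -> : (m%:R - 1) * m%:R^-1 ^+ 2 = m%:R^-1 * (1 - m%:R^-1) :> R.
  by field; rewrite gt_eqF.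
rewrite ler_pM2l ?invr_gt0// lerD2l lerN2 lef_pV2 ?posrE//.
by rewrite ler_nat sparse_le.
Qed.

(** Flipping the sign of a single entry changes the sign of the product. *)
Lemma avg_entryM a b : a != b -> avg (fun k => entry k a * entry k b) = 0.
Proof.
move=> ab; set q := avg _.
have : q = - q.
  rewrite {1}/q -(avg_bij _ (flip_bij [ffun c => c == a])) /q -avgN.
  apply: eq_avg => k; rewrite !flipE !ffunE eqxx eq_sym (negbTE ab) /sg.
  by rewrite expr1 expr0 mul1r mulN1r mulNr.
lra.
Qed.

Lemma avg_entry a : avg (fun k => entry k a) = 0.
Proof.
set q := avg _.
have : q = - q.
  rewrite {1}/q -(avg_bij _ (flip_bij [ffun c => true])) /q -avgN.
  by apply: eq_avg => k; rewrite !flipE !ffunE /sg expr1 mulN1r.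
lra.
Qed.

End averages.
End sparse_signs.

(** * The law of a sparse sign embedding *)

Section embedding.
Variables (R : realType) (d : measure_display) (T : measurableType d).
Variables (P : probability T R) (m n z : nat) (S : T -> 'M[R]_(m, n)).
Hypothesis z_gt0 : (0 < z)%N.
Hypothesis n_gt0 : (0 < n)%N.
Hypothesis hS : sparse_sign_embedding P z S.
Local Notation K := (sparse_col R m z).

Definition sketch_mx (f : {ffun 'I_n -> K}) : 'M[R]_(m, n) :=
  \matrix_(a, j) entry (f j) a.

Lemma sparse_signs_neq0 : sparse_signs R m z !=set0.
Proof.
have [hcol _ _ _] := hS.
have [w _] : [set: T] !=set0.
  apply/set0P/eqP => T0; have := @probability_setT _ _ _ P.
  by rewrite T0 measure0 => /eqP; rewrite eq_sym onee_eq0.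
by exists (col (Ordinal n_gt0) (S w)).
Qed.

(* the events that S takes a given value; they partition the space and are
   equally likely *)
Let ev f : set T := [set w | S w = sketch_mx f].

Let evE f : ev f = [set w | forall j, [set val (f j)] (col j (S w))].
Proof.
apply/seteqP; split=> w /= h.
  by move=> j; rewrite h; apply/colP => a; rewrite !mxE.
by apply/matrixP => a j; have := congr1 (fun x : 'cV_m => x a 0) (h j); rewrite !mxE.
Qed.

Let ev_measurable f : measurable (ev f).
Proof.
rewrite evE (_ : [set w | _] = \bigcap_(j in [set: 'I_n]) [set w | col j (S w) = val (f j)]).
  have [_ mcol _ _] := hS.
  by apply: fin_bigcap_measurable => // j _; exact: mcol.
by apply/seteqP; split=> w /= h j => [_|]; exact: h.
Qed.

Let P_ev f : P (ev f) = ((#|{ffun 'I_n -> K}|%:R)^-1)%:E.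
Proof.
have [_ _ Pcol Pind] := hS.
rewrite evE (Pind (fun j => [set val (f j)])).
under eq_bigr => j _.
  rewrite (Pcol j (val (f j)) (sparse_colP (f j))) cardfE.
  over.
rewrite prodEFin; congr EFin.
by rewrite prodr_const card_ord card_ffun card_ord natrX exprVn.
Qed.

Let cover w : exists f, S w = sketch_mx f.
Proof.
have [hcol _ _ _] := hS.
exists [ffun j => to_col (hcol w j)].
by apply/matrixP => a j; rewrite mxE ffunE /entry /= mxE.
Qed.

Let ev_triv (D : set {ffun 'I_n -> K}) : trivIset D ev.
Proof.
move=> f g _ _ [w [/= hf hg]]; apply/ffunP => j; apply: entry_inj => a.
have := congr1 (fun A : 'M[R]_(m, n) => A a j) (etrans (esym hf) hg).
by rewrite !mxE.
Qed.

Let cupE (Q : pred 'M[R]_(m, n)) : [set w | Q (S w)] =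
  \bigcup_(f in [set f | Q (sketch_mx f)]) ev f.
Proof.
apply/seteqP; split=> w /=; last by move=> [f /= Qf ->].
by have [f Sf] := cover w; rewrite Sf => Qf; exists f.
Qed.

Lemma embedding_measurable (Q : pred 'M[R]_(m, n)) : measurable [set w | Q (S w)].
Proof. by rewrite cupE; apply: fin_bigcup_measurable => //; exact: finite_finset. Qed.

Lemma embedding_measurable_fun (F : 'M[R]_(m, n) -> R) :
  measurable_fun [set: T] (fun w => F (S w)).
Proof.
move=> _ Y _; rewrite setTI (_ : _ @^-1` Y = [set w | (fun A => `[< Y (F A) >]) (S w)]).
  exact: (embedding_measurable (fun A => `[< Y (F A) >])).
by apply/seteqP; split=> w /= /asboolP.
Qed.

Lemma embedding_prob (Q : pred 'M[R]_(m, n)) :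
  P [set w | Q (S w)] =
  (avg (fun f : {ffun 'I_n -> K} => (Q (sketch_mx f))%:R : R))%:E.
Proof.
rewrite cupE measure_fin_bigcup//; last exact: finite_finset.
rewrite (_ : [set f | _] = [set` [seq f <- enum {ffun 'I_n -> K} | Q (sketch_mx f)]]); last first.
  by apply/seteqP; split=> f /=; rewrite mem_filter mem_enum andbT.
rewrite -fsbig_seq; last exact/filter_uniq/enum_uniq.
transitivity (\sum_(f <- [seq f <- enum {ffun 'I_n -> K} | Q (sketch_mx f)])
    ((#|{ffun 'I_n -> K}|%:R : R)^-1)%:E)%E; first by apply: eq_bigr => f _; exact: P_ev.
rewrite sumEFin big_filter big_enum_cond big_mkcond /avg mulr_suml; congr EFin.
apply: eq_bigr => f _ /=.
by case: ifP => _; rewrite ?mul1r ?mul0r.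
Qed.

End embedding.

(** * From Stein's operator to distribution functions *)

Section portmanteau.
Variable R : realType.

Lemma gcdf_le (x y : R) : x <= y -> gcdf x <= gcdf y.
Proof.
move=> xy; rewrite -subr_ge0.
have [c [_ _ ->]] := MVT_closed xy (fun z _ => is_derive_gcdf z).
by rewrite mulr_ge0 ?subr_ge0// ltW// gpdf_gt0.
Qed.

Lemma gcdf_lipschitz (x y : R) : x <= y ->
  gcdf y - gcdf x <= normal_peak 1 * (y - x).
Proof.
move=> xy; have [c [_ _ ->]] := MVT_closed xy (fun z _ => is_derive_gcdf z).
by rewrite ler_wpM2r ?subr_ge0//; exact/normal_pdf_ub/oner_neq0.
Qed.

(** By the mean value theorem, as gcdf is the nondecreasing derivative of
    gcall. *)
Lemma gcall_slope (a h : R) : 0 < h ->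
  gcdf a <= (gcall (a + h) - gcall a) / h <= gcdf (a + h).
Proof.
move=> h0; have ah : a <= a + h by rewrite lerDl ltW.
have [c [ac ch ->]] := MVT_closed ah (fun z _ => is_derive_gcall z).
by rewrite addrAC subrr add0r mulfK ?gt_eqF// !gcdf_le.
Qed.

(** This ramp is how the indicator of a half-line, for which Stein's equation has
    no smooth solution, is reached from the test functions of stein_solution. *)
Lemma ramp_bounds (y a h : R) : 0 < h ->
  (y <= a)%R%:R <= (Num.max (a + h - y) 0 - Num.max (a - y) 0) / h
  <= ((y <= a + h)%R%:R : R).
Proof.
move=> h0; rewrite ler_pdivlMr// ler_pdivrMr//.
have [ya|ay] := leP y a.
  have -> : y <= a + h by lra.
  have -> : Num.max (a - y) 0 = a - y by rewrite max_l// subr_ge0.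
  have -> : Num.max (a + h - y) 0 = a + h - y by rewrite max_l//; lra.
  by rewrite mul1r; lra.
have -> : Num.max (a - y) 0 = 0 by rewrite max_r//; lra.
have [yh|hy] := leP y (a + h).
  have -> : Num.max (a + h - y) 0 = a + h - y by rewrite max_l//; lra.
  by rewrite mul0r mul1r; lra.
have -> : Num.max (a + h - y) 0 = 0 by rewrite max_r//; lra.
by rewrite !mul0r; lra.
Qed.

(** The distribution function of Z at x lies between the means of two ramps of
    Y on either side of x, up to the probability that |Z - Y| > h. The means of
    the ramps converge to slopes of gcall, which are close to gcdf x as gcdf is
    Lipschitz. *)
Lemma cdf_cvg_of_call (W : nat -> finType) (Y Z : forall n, W n -> R) :
  (forall t, avg (fun w => Num.max (t - Y n w) 0) @[n --> \oo] --> gcall t) ->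
  (forall e, 0 < e ->
     avg (fun w => (e < `|Z n w - Y n w|)%R%:R : R) @[n --> \oo] --> (0 : R)) ->
  forall x, avg (fun w => (Z n w <= x)%R%:R : R) @[n --> \oo] --> gcdf x.
Proof.
move=> hY hZ x; apply/cvgrPdist_le => e e0.
pose k := normal_peak (1 : R).
have k0 : 0 < k by rewrite normal_peak_gt0// oner_neq0.
pose h := e / (8 * k).
have h0 : 0 < h by rewrite divr_gt0// mulr_gt0.
have hk : k * (2 * h) = e / 4 by rewrite /h; field; rewrite gt_eqF.
pose ramp a n := avg (fun w => (Num.max (a + h - Y n w) 0 - Num.max (a - Y n w) 0) / h).
have rampE a n : ramp a n =
    (avg (fun w => Num.max (a + h - Y n w) 0) - avg (fun w => Num.max (a - Y n w) 0)) / h.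
  by rewrite /ramp avgZr avgB.
have ramp_cvg a : ramp a n @[n --> \oo] --> (gcall (a + h) - gcall a) / h.
  rewrite (_ : ramp a = fun n => (avg (fun w => Num.max (a + h - Y n w) 0) - avg (fun w => Num.max (a - Y n w) 0)) / h); last exact: boolp.funext (rampE a).
  by apply: cvgM; [apply: cvgB; exact: hY|exact: cvg_cst].
near=> n.
have bad : avg (fun w => (h < `|Z n w - Y n w|)%R%:R : R) <= e / 4.
  have : `|0 - avg (fun w => (h < `|Z n w - Y n w|)%R%:R : R)| <= e / 4.
    near: n; apply: (cvgrPdist_le _ _).1; last by rewrite divr_gt0.
    exact: hZ.
  by rewrite sub0r normrN ger0_norm// avg_ge0.
have upper : `|(gcall (x + h + h) - gcall (x + h)) / h - ramp (x + h) n| <= e / 4.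
  by near: n; apply: (cvgrPdist_le _ _).1; [exact: ramp_cvg|rewrite divr_gt0].
have lower : `|(gcall (x - h - h + h) - gcall (x - h - h)) / h - ramp (x - h - h) n| <= e / 4.
  by near: n; apply: (cvgrPdist_le _ _).1; [exact: ramp_cvg|rewrite divr_gt0].
have /andP[_ su] := gcall_slope (x + h) h0.
have /andP[sl _] := gcall_slope (x - h - h) h0.
have lu : gcdf (x + h + h) - gcdf x <= e / 4.
  by rewrite -hk (le_trans (gcdf_lipschitz _))//; [lra|rewrite ler_pM2l//; lra].
have ll : gcdf x - gcdf (x - h - h) <= e / 4.
  by rewrite -hk (le_trans (gcdf_lipschitz _))//; [lra|rewrite ler_pM2l//; lra].
have Zu : avg (fun w => (Z n w <= x)%R%:R : R) <=
    ramp (x + h) n + avg (fun w => (h < `|Z n w - Y n w|)%R%:R : R).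
  rewrite -avgD; apply: ler_avg => w.
  have /andP[r1 r2] := ramp_bounds (Y n w) (x + h) h0.
  have [hb|hb] := ltP h `|Z n w - Y n w|.
    have : (Z n w <= x)%R%:R <= 1 :> R by rewrite lern1 leq_b1.
    have : 0 <= (Y n w <= x + h)%R%:R :> R by exact: ler0n.
    rewrite /= mulr1n; lra.
  rewrite addr0 (le_trans _ r1)// ler_nat.
  have [Zx|//] := boolP (Z n w <= x).
  have -> // : Y n w <= x + h.
  by move: hb; rewrite ler_norml => /andP[]; lra.
have Zl : ramp (x - h - h) n <= avg (fun w => (Z n w <= x)%R%:R : R)
    + avg (fun w => (h < `|Z n w - Y n w|)%R%:R : R).
  rewrite -avgD; apply: ler_avg => w.
  have /andP[r1 r2] := ramp_bounds (Y n w) (x - h - h) h0.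
  have [hb|hb] := ltP h `|Z n w - Y n w|.
    have : (Y n w <= x - h - h + h)%R%:R <= 1 :> R by rewrite lern1 leq_b1.
    have : 0 <= (Z n w <= x)%R%:R :> R by exact: ler0n.
    rewrite /= mulr1n; lra.
  rewrite addr0 (le_trans r2)// ler_nat.
  have [Zx|//] := boolP (Y n w <= _).
  have -> // : Z n w <= x.
  by move: hb; rewrite ler_norml => /andP[]; lra.
move: upper lower; rewrite !ler_norml => /andP[u1 u2] /andP[l1 l2].
by apply/andP; split; lra.
Unshelve. all: by end_near. Qed.

End portmanteau.

Section stein_limit.
Variable R : realType.

(** By stein_solution the mean of the test function differs from its Gaussian
    value by the mean of Stein's operator. The bound on the latter is small when
    lam is chosen small first and n large afterwards. *)
Lemma call_cvg_of_stein (W : nat -> finType) (Y : forall n, W n -> R)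
    (b err : nat -> R) :
  (\forall n \near \oo, (0 < #|W n|)%N) ->
  (\forall n \near \oo, 0 <= b n <= 1) ->
  (\forall n \near \oo, forall g g' (C : R), 0 <= C ->
    (forall x : R, is_derive x 1 g (g' x)) -> (forall x, `|g' x| <= C) ->
    (forall x y, `|g' x - g' y| <= C * `|x - y|) ->
    forall lam, 0 < lam ->
    `|avg (fun w => g' (Y n w) - Y n w * g (Y n w))| <=
    C * (lam * (1 + b n) + lam^-1 * err n)) ->
  err n @[n --> \oo] --> (0 : R) ->
  forall t, avg (fun w => Num.max (t - Y n w) 0) @[n --> \oo] --> gcall t.
Proof.
move=> hW hb hst herr t; have [g [g' [C [C0 dg g'C g'L gE]]]] := stein_solution t.
apply/cvgrPdist_le => e e0.
pose C1 := C + 1; have C10 : 0 < C1 by rewrite ltr_wpDl.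
pose lam := e / (4 * C1).
have lam0 : 0 < lam by rewrite divr_gt0// mulr_gt0.
pose eta := lam * (e / (2 * C1)).
have eta0 : 0 < eta by rewrite mulr_gt0// divr_gt0// mulr_gt0.
near=> n.
have W0 : (0 < #|W n|)%N by near: n.
have /andP[b0 b1] : 0 <= b n <= 1 by near: n.
have err_le : err n <= eta.
  have : `|0 - err n| <= eta by near: n; exact: (cvgrPdist_le _ _).1 herr _ eta0.
  by rewrite sub0r normrN; apply: le_trans; exact: ler_norm.
have -> : gcall t = avg (fun _ : W n => gcall t) by rewrite avg_cst.
rewrite distrC -avgB.
rewrite (_ : avg _ = avg (fun w => g' (Y n w) - Y n w * g (Y n w))); last first.
  by apply: eq_avg => w; rewrite gE.
have st : forall g g' (C : R), 0 <= C ->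
    (forall x : R, is_derive x 1 g (g' x)) -> (forall x, `|g' x| <= C) ->
    (forall x y, `|g' x - g' y| <= C * `|x - y|) ->
    forall lam, 0 < lam ->
    `|avg (fun w => g' (Y n w) - Y n w * g (Y n w))| <=
    C * (lam * (1 + b n) + lam^-1 * err n) by near: n.
apply: (le_trans (st g g' C C0 dg g'C g'L lam lam0)).
have il0 : 0 < lam^-1 by rewrite invr_gt0.
apply: (@le_trans _ _ (C1 * (lam * 2 + lam^-1 * eta))).
  apply: (@le_trans _ _ (C * (lam * 2 + lam^-1 * eta))).
    rewrite ler_wpM2l// lerD// ler_wpM2l ?(ltW il0) ?(ltW lam0)//; lra.
  have h1 : 0 <= lam^-1 * eta by rewrite ltW// mulr_gt0.
  by rewrite ler_wpM2r ?lerDl//; lra.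
have -> : lam^-1 * eta = e / (2 * C1) by rewrite /eta /lam; field; rewrite !gt_eqF.
rewrite le_eqVlt; apply/orP; left; apply/eqP.
by rewrite /lam; field; rewrite gt_eqF.
Unshelve. all: by end_near. Qed.

End stein_limit.

(** * Off-diagonal quadratic forms *)

Section coefficients.
Variables (R : realFieldType) (J : finType) (u w : J -> R).

(** Symmetrised so that avg_sqr_quadratic and bonami_chaos2 apply. *)
Definition offdiag j k : R := if j == k then 0 else (u j * w k + u k * w j) / 2.

Lemma offdiag_sym j k : offdiag j k = offdiag k j.
Proof. by rewrite /offdiag eq_sym addrC. Qed.

Lemma offdiag_diag j : offdiag j j = 0.
Proof. by rewrite /offdiag eqxx. Qed.

Let uu := \sum_j u j ^+ 2.
Let ww := \sum_j w j ^+ 2.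
Let uw := \sum_j u j * w j.
Let u4 := \sum_j u j ^+ 4.
Let w4 := \sum_j w j ^+ 4.

Lemma offdiag_sum (N : J -> J -> R) : (forall j k, N j k = N k j) ->
  (forall j, N j j = 1) ->
  \sum_j \sum_k offdiag j k * N j k = \sum_j \sum_k u j * w k * N j k - uw.
Proof.
move=> Nsym N1.
have -> : \sum_j \sum_k u j * w k * N j k =
    \sum_j \sum_k (u j * w k + u k * w j) / 2 * N j k.
  transitivity ((\sum_j \sum_k u j * w k * N j k + \sum_j \sum_k u j * w k * N j k) / 2).
    by field.
  rewrite [X in _ + X]exchange_big -big_split mulr_suml; apply: eq_bigr => j _ /=.
  rewrite -big_split mulr_suml; apply: eq_bigr => k _ /=.
  by rewrite (Nsym k j); field.
rewrite /uw -sumrB; apply: eq_bigr => j _.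
rewrite [RHS]addrC [X in _ + X](bigD1 j)//= N1 mulr1 (bigD1 j)//= offdiag_diag mul0r add0r.
rewrite (eq_bigr (fun k => (u j * w k + u k * w j) / 2 * N j k)) => [|k kj]; last first.
  by rewrite /offdiag eq_sym (negbTE kj).
by field.
Qed.

Lemma offdiag_sqr :
  2 * \sum_j \sum_k offdiag j k ^+ 2 = uu * ww + uw ^+ 2 - 2 * \sum_j (u j * w j) ^+ 2.
Proof.
have -> : uu * ww + uw ^+ 2 = 2 * \sum_j \sum_k ((u j * w k + u k * w j) / 2) ^+ 2.
  have e1 : uu * ww = \sum_j \sum_k u j ^+ 2 * w k ^+ 2.
    by rewrite mulr_suml; apply: eq_bigr => j _; rewrite mulr_sumr.
  have e2 : uu * ww = \sum_j \sum_k u k ^+ 2 * w j ^+ 2 by rewrite exchange_big e1.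
  have e3 : uw ^+ 2 = \sum_j \sum_k (u j * w j) * (u k * w k).
    by rewrite expr2 mulr_suml; apply: eq_bigr => j _; rewrite mulr_sumr.
  have -> : uu * ww + uw ^+ 2 = (uu * ww + uu * ww + 2 * uw ^+ 2) / 2 by field.
  rewrite {1}e1 e2 e3 mulr_sumr -!big_split mulr_suml mulr_sumr.
  apply: eq_bigr => j _ /=.
  rewrite !mulr_sumr -!big_split mulr_suml.
  by apply: eq_bigr => k _ /=; field.
rewrite -mulrBr; congr (_ * _); rewrite -sumrB; apply: eq_bigr => j _.
rewrite [RHS]addrC [X in _ + X](bigD1 j)//= (bigD1 j)//= offdiag_diag expr0n add0r.
rewrite (eq_bigr (fun k => ((u j * w k + u k * w j) / 2) ^+ 2)) => [|k kj]; last first.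
  by rewrite /offdiag eq_sym (negbTE kj).
by field.
Qed.

Lemma offdiag_sqr_le : 2 * \sum_j \sum_k offdiag j k ^+ 2 <= uu * ww + uw ^+ 2.
Proof.
by rewrite offdiag_sqr gerBl mulr_ge0// sumr_ge0// => j _; exact: sqr_ge0.
Qed.

(** The diagonal that is left out has mass 2 (u_j w_j)^2 <= u_j^4 + w_j^4, so
    delocalized factors lose little variance. *)
Lemma offdiag_sqr_defect :
  0 <= uu * ww + uw ^+ 2 - 2 * \sum_j \sum_k offdiag j k ^+ 2 <= u4 + w4.
Proof.
rewrite offdiag_sqr opprB addrC subrK mulr_ge0 ?sumr_ge0//=; last first.
  by move=> j _; exact: sqr_ge0.
rewrite -big_split mulr_sumr; apply: ler_sum => j _ /=.
have := sqr_ge0 (u j ^+ 2 - w j ^+ 2).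
rewrite (_ : (_ - _) ^+ 2 = u j ^+ 4 + w j ^+ 4 - 2 * (u j * w j) ^+ 2); last by ring.
by rewrite subr_ge0.
Qed.

Let offdiag_pow2 j k : offdiag j k ^+ 2 <= (u j ^+ 2 * w k ^+ 2 + w j ^+ 2 * u k ^+ 2) / 2.
Proof.
rewrite /offdiag; case: eqVneq => _.
  by rewrite expr0n divr_ge0// addr_ge0// mulr_ge0// sqr_ge0.
have := sqr_ge0 (u j * w k - u k * w j).
have -> : (u j * w k - u k * w j) ^+ 2 = u j ^+ 2 * w k ^+ 2 + w j ^+ 2 * u k ^+ 2
  - 2 * (u j * w k * (u k * w j)) by ring.
have -> : ((u j * w k + u k * w j) / 2) ^+ 2 = (u j ^+ 2 * w k ^+ 2 + w j ^+ 2 * u k ^+ 2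
  + 2 * (u j * w k * (u k * w j))) / 4 by field.
lra.
Qed.

Lemma offdiag_pow4 : \sum_j \sum_k offdiag j k ^+ 4 <= u4 * w4.
Proof.
have -> : u4 * w4 = \sum_j \sum_k (u j ^+ 4 * w k ^+ 4 + w j ^+ 4 * u k ^+ 4) / 2.
  have e1 : u4 * w4 = \sum_j \sum_k u j ^+ 4 * w k ^+ 4.
    by rewrite mulr_suml; apply: eq_bigr => j _; rewrite mulr_sumr.
  have e2 : u4 * w4 = \sum_j \sum_k w j ^+ 4 * u k ^+ 4.
    by rewrite exchange_big e1; apply: eq_bigr => j _; apply: eq_bigr => k _; rewrite mulrC.
  have -> : u4 * w4 = (u4 * w4 + u4 * w4) / 2 by field.
  rewrite {1}e1 e2 -!big_split mulr_suml; apply: eq_bigr => j _ /=.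
  by rewrite -!big_split mulr_suml.
apply: ler_sum => j _; apply: ler_sum => k _.
have -> : offdiag j k ^+ 4 = (offdiag j k ^+ 2) ^+ 2 by rewrite -exprM.
apply: (@le_trans _ _ (((u j ^+ 2 * w k ^+ 2 + w j ^+ 2 * u k ^+ 2) / 2) ^+ 2)).
  rewrite ler_pXn2r ?nnegrE ?sqr_ge0 ?offdiag_pow2//.
  by rewrite divr_ge0// addr_ge0// mulr_ge0// sqr_ge0.
have := sqr_ge0 (u j ^+ 2 * w k ^+ 2 - w j ^+ 2 * u k ^+ 2).
rewrite -subr_ge0 => h.
have -> : (u j ^+ 4 * w k ^+ 4 + w j ^+ 4 * u k ^+ 4) / 2 =
  ((u j ^+ 2 * w k ^+ 2 + w j ^+ 2 * u k ^+ 2) / 2) ^+ 2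
  + (u j ^+ 2 * w k ^+ 2 - w j ^+ 2 * u k ^+ 2) ^+ 2 / 4 by field.
lra.
Qed.

Lemma offdiag_rows : \sum_j (\sum_k offdiag j k ^+ 2) ^+ 2 <= (u4 * ww ^+ 2 + w4 * uu ^+ 2) / 2.
Proof.
have uu0 : 0 <= uu by rewrite sumr_ge0// => j _; exact: sqr_ge0.
have ww0 : 0 <= ww by rewrite sumr_ge0// => j _; exact: sqr_ge0.
rewrite !mulr_suml -big_split mulr_suml; apply: ler_sum => j _ /=.
apply: (@le_trans _ _ (((u j ^+ 2 * ww + w j ^+ 2 * uu) / 2) ^+ 2)).
  have h1 : 0 <= \sum_k offdiag j k ^+ 2 by rewrite sumr_ge0// => k _; exact: sqr_ge0.
  have h2 : 0 <= (u j ^+ 2 * ww + w j ^+ 2 * uu) / 2.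
    by rewrite divr_ge0// addr_ge0// mulr_ge0// sqr_ge0.
  rewrite ler_pXn2r ?nnegrE// !mulr_sumr -big_split mulr_suml.
  by apply: ler_sum => k _; exact: offdiag_pow2.
have := sqr_ge0 (u j ^+ 2 * ww - w j ^+ 2 * uu).
rewrite -subr_ge0 => h.
have -> : (u j ^+ 4 * ww ^+ 2 + w j ^+ 4 * uu ^+ 2) / 2 =
  ((u j ^+ 2 * ww + w j ^+ 2 * uu) / 2) ^+ 2 + (u j ^+ 2 * ww - w j ^+ 2 * uu) ^+ 2 / 4 by field.
lra.
Qed.

End coefficients.

(** * The sketching error *)

Definition frob2 (R : realType) (q : nat) (A : 'M[R]_q) : R :=
  \sum_x \sum_y A x y ^+ 2.

Section sketched_form.
Variables (R : realType) (m n z q : nat) (U : 'M[R]_(n, q)).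
Hypothesis UU : U^T *m U = 1%:M.
Local Notation K := (sparse_col R m z).

Definition sketch_err (S : 'M[R]_(m, n)) : 'M[R]_q := U^T *m S^T *m S *m U - 1%:M.

Let vec (x : 'cV[R]_q) (j : 'I_n) : R := (U *m x) j 0.

Lemma vec_dot (x y : 'cV[R]_q) : \sum_j vec x j * vec y j = dot x y.
Proof.
rewrite /dot -[x^T]mulmx1 -UU mulmxA -trmx_mul -mulmxA mxE.
by apply: eq_bigr => j _; rewrite [in RHS]mxE.
Qed.

(** The columns of the sketch have unit norm, so that the diagonal terms are
    cancelled exactly by the subtraction of the identity. *)
Lemma sketch_err_offdiag (x y : 'cV[R]_q) (f : {ffun 'I_n -> K}) : (0 < z)%N ->
  dot x (sketch_err (sketch_mx f) *m y) =
  \sum_j \sum_k offdiag (vec x) (vec y) j k * \sum_a entry (f j) a * entry (f k) a.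
Proof.
move=> z0; rewrite offdiag_sum; first last.
- by move=> j; rewrite -[RHS](entry_norm z0 (f j)).
- by move=> j k; apply: eq_bigr => a _; rewrite mulrC.
rewrite vec_dot /dot /sketch_err mulmxBl mul1mx mulmxBr mxE [X in _ + X]mxE; congr (_ - _).
set S := sketch_mx f.
have -> : x^T *m (U^T *m S^T *m S *m U *m y) = (S *m (U *m x))^T *m (S *m (U *m y)).
  by rewrite !trmx_mul !mulmxA.
rewrite mxE.
under eq_bigr => a _.
  rewrite mxE [X in X * _]mxE [X in _ * X]mxE mulr_suml.
  under eq_bigr => j _ do rewrite mulr_sumr.
  over.
rewrite exchange_big; apply: eq_bigr => j _ /=.
rewrite exchange_big; apply: eq_bigr => k _ /=.
rewrite mulr_sumr; apply: eq_bigr => a _.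
by rewrite /S /vec [sketch_mx f a j]mxE [sketch_mx f a k]mxE; ring.
Qed.

Hypothesis z0 : (0 < z)%N.
Hypothesis signs0 : sparse_signs R m z !=set0.

Let K0 : (0 < #|{: K}|)%N. Proof. exact: sparse_col_gt0. Qed.
Let I0 : (0 < #|'I_m|)%N.
Proof. by rewrite card_ord; exact: leq_trans z0 (sparse_le signs0). Qed.

Lemma avg_inner_sqr :
  avg (fun x : K => avg (fun y : K => (\sum_a entry x a * entry y a) ^+ 2)) = m%:R^-1.
Proof.
pose q2 a b := avg (fun x : K => entry x a * entry x b).
transitivity (\sum_a \sum_b q2 a b ^+ 2).
  under eq_avg => x.
    under eq_avg => y do rewrite expr2 mulr_suml.
    rewrite avg_sum; under eq_bigr => a _.
      under eq_avg => y do rewrite mulr_sumr.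
      rewrite avg_sum; under eq_bigr => b _.
        under eq_avg => y do rewrite mulrACA.
        rewrite avgZ -/(q2 a b).
        over.
      over.
    over.
  rewrite avg_sum; apply: eq_bigr => a _; rewrite avg_sum; apply: eq_bigr => b _.
  by rewrite avgZr expr2.
have qE a : \sum_b q2 a b ^+ 2 = m%:R^-1 ^+ 2.
  rewrite (bigD1 a)//= big1 => [|b ba]; last by rewrite /q2 avg_entryM ?expr0n// eq_sym.
  rewrite addr0 /q2; congr (_ ^+ 2).
  under eq_avg do rewrite -expr2.
  by rewrite avg_entry_sqr// card_ord.
under eq_bigr => a _ do rewrite qE.
rewrite sumr_const -[_ *+ #|_|]mulr_natl card_ord expr2 mulrA mulfV ?mul1r//.
by rewrite pnatr_eq0 -lt0n -[m]card_ord.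
Qed.

Let delta_dot (x : 'I_q) (M : 'M[R]_q) y :
  dot (delta_mx x 0) (M *m delta_mx y 0) = M x y.
Proof.
by rewrite /dot trmx_delta -colE -rowE !mxE.
Qed.

(** Each entry is a degenerate quadratic form in independent columns, whose
    kernel has second moment 1/m by avg_inner_sqr. *)
Lemma sketch_err_second_moment :
  avg (fun f : {ffun 'I_n -> K} => frob2 (sketch_err (sketch_mx f))) <=
  2 * q%:R ^+ 2 / m%:R.
Proof.
rewrite avg_sum; apply: (@le_trans _ _ (\sum_(x < q) \sum_(y < q) 2 / m%:R)); last first.
  rewrite !sumr_const -mulrnA -[_ *+ _]mulr_natr card_ord natrM.
  by rewrite le_eqVlt; apply/orP; left; apply/eqP; ring.
apply: ler_sum => x _; rewrite avg_sum; apply: ler_sum => y _.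
under eq_avg => f do rewrite -delta_dot sketch_err_offdiag//.
have sym (k l : K) : \sum_a entry k a * entry l a = \sum_a entry l a * entry k a.
  by apply: eq_bigr => a _; rewrite mulrC.
have deg (k : K) : avg (fun l : K => \sum_a entry k a * entry l a) = 0.
  by rewrite avg_sum big1// => a _; rewrite avgZ avg_entry ?mulr0.
rewrite (avg_sqr_quadratic K0 (@offdiag_sym _ _ _ _) (@offdiag_diag _ _ _ _) sym deg).
rewrite avg_inner_sqr ler_wpM2r ?invr_ge0//.
apply: (le_trans (offdiag_sqr_le _ _)).
have e (t : 'I_q) : dot (delta_mx t 0) (delta_mx t 0) = 1 :> R.
  by rewrite -[X in dot _ X]mul1mx delta_dot mxE eqxx.
have -> : \sum_j vec (delta_mx x 0) j ^+ 2 = 1.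
  by under eq_bigr do rewrite expr2; rewrite vec_dot e.
have -> : \sum_j vec (delta_mx y 0) j ^+ 2 = 1.
  by under eq_bigr do rewrite expr2; rewrite vec_dot e.
rewrite vec_dot -[X in dot _ X]mul1mx delta_dot mxE.
by case: eqP => _; rewrite ?mulr0n ?mulr1n ?expr0n ?expr1n /=; lra.
Qed.

End sketched_form.

(** * Central limit theorem for the sketching error *)

Section sketched_clt.
Variable R : realType.

Lemma sum_CauchySchwarz (I : finType) (F G : I -> R) :
  (\sum_i F i * G i) ^+ 2 <= (\sum_i F i ^+ 2) * (\sum_i G i ^+ 2).
Proof.
have [I0|I0] := posnP #|I|.
  by rewrite !big1 ?mul0r ?expr0n// => i; have := max_card (pred1 i); rewrite I0 card1.
have := avg_CauchySchwarz F G; rewrite /avg exprMn.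
set c := #|I|%:R^-1; have c0 : 0 < c by rewrite invr_gt0 ltr0n.
by rewrite [leRHS]mulrACA -expr2 ler_pM2r ?exprn_gt0.
Qed.

(** Each entry of U x is at most the norm of that row of U; this is where
    the delocalization hypothesis enters. *)
Lemma vec_pow4 (n q : nat) (U : 'M[R]_(n, q)) (x : 'cV[R]_q) : dot x x <= 1 ->
  \sum_j (U *m x) j 0 ^+ 4 <= q%:R * \sum_k \sum_j U k j ^+ 4.
Proof.
move=> x1; rewrite mulr_sumr; apply: ler_sum => k _.
have xx : dot x x = \sum_j x j 0 ^+ 2.
  by rewrite /dot mxE; apply: eq_bigr => j _; rewrite mxE expr2.
have U0 : 0 <= \sum_j U k j ^+ 2 by rewrite sumr_ge0// => j _; exact: sqr_ge0.
have h1 : (U *m x) k 0 ^+ 2 <= \sum_j U k j ^+ 2.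
  rewrite mxE (le_trans (sum_CauchySchwarz _ _))//.
  by rewrite -xx ler_piMr.
have -> : (U *m x) k 0 ^+ 4 = ((U *m x) k 0 ^+ 2) ^+ 2 by rewrite -exprM.
apply: (@le_trans _ _ ((\sum_j U k j ^+ 2) ^+ 2)).
  by rewrite ler_pXn2r ?nnegrE ?sqr_ge0.
have := sum_CauchySchwarz (fun j => U k j ^+ 2) (fun=> 1).
under eq_bigr do rewrite mulr1.
under [X in _ <= _ * X -> _]eq_bigr do rewrite expr1n.
rewrite sumr_const card_ord mulrC => h; apply: (le_trans h).
by rewrite ler_wpM2l// ?ler0n//; apply: ler_sum => j _; rewrite -exprM.
Qed.

Variables (q : nat) (m zeta : nat -> nat) (U : forall n, 'M[R]_(n, q)).
Variables (x y : nat -> 'cV[R]_q).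
Hypothesis hzeta : forall k, (0 < zeta k)%N.
Hypothesis hUU : \forall n \near \oo, (U n)^T *m U n = 1%:M.
Hypothesis hS : \forall n \near \oo, sparse_signs R (m n) (zeta (m n)) !=set0.
Hypothesis hxx : \forall n \near \oo, dot (x n) (x n) = 1.
Hypothesis hyy : \forall n \near \oo, dot (y n) (y n) + dot (x n) (y n) ^+ 2 = 1.
Hypothesis hm : m @ \oo --> \oo.
Hypothesis hsparse : (zeta (m n))%:R ^+ 2 / (m n)%:R @[n --> \oo] --> (0 : R).
Hypothesis hU : Num.sqrt (m n)%:R / (zeta (m n))%:R
        * (\sum_(k < n) \sum_(j < q) U n k j ^+ 4) @[n --> \oo] --> (0 : R).

(* the error in stein_sketch is a polynomial in the quantities ta and ya, which
   are assumed to vanish, and in 1/m *)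
Let ta n : R := Num.sqrt (m n)%:R / (zeta (m n))%:R
        * (\sum_(k < n) \sum_(j < q) U n k j ^+ 4).
Let ya n : R := (zeta (m n))%:R ^+ 2 / (m n)%:R.
Let err n : R := 4 * q%:R ^+ 2 * (ta n ^+ 2 * ya n) + 243 * ((m n)%:R)^-1
  + 3888 * q%:R * ta n + 1952 * q%:R ^+ 2 * ta n ^+ 2.

Let m_gt0 : \forall n \near \oo, (0 < m n)%N.
Proof.
have : \forall k \near \oo, (0 < k)%N by exists 1%N.
by move=> /hm.
Qed.

Lemma cvg_inv_m : ((m n)%:R)^-1 @[n --> \oo] --> (0 : R).
Proof.
apply/gtr0_cvgV0; last exact/cvgrnyP.
by near=> n; rewrite ltr0n; near: n.
Unshelve. all: by end_near. Qed.

Let err0 : err n @[n --> \oo] --> (0 : R).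
Proof.
rewrite (_ : 0 = 4 * q%:R ^+ 2 * (0 * 0 * 0) + 243 * 0 + 3888 * q%:R * 0 + 1952 * q%:R ^+ 2 * (0 * 0)); last by ring.
have t2 : ta n ^+ 2 @[n --> \oo] --> (0 * 0 : R) by apply: cvgM hU hU.
apply: cvgD; last by apply: cvgM; [exact: cvg_cst|exact: t2].
apply: cvgD; last by apply: cvgM; [exact: cvg_cst|exact: hU].
apply: cvgD; last by apply: cvgM; [exact: cvg_cst|exact: cvg_inv_m].
apply: cvgM; first exact: cvg_cst.
by apply: cvgM; [exact: t2|exact: hsparse].
Qed.

Let Y n (f : {ffun 'I_n -> sparse_col R (m n) (zeta (m n))}) : R :=
  Num.sqrt (m n)%:R * dot (x n) (sketch_err (U n) (sketch_mx f) *m y n).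

(** The hypothesis on y is the normalization of the variance: in the limit,
    sqrt m x^T E y has variance |x|^2 |y|^2 + (x . y)^2. *)
Lemma sketch_call_cvg t :
  avg (fun f => Num.max (t - Y (n:=n) f) 0) @[n --> \oo] --> gcall t.
Proof.
pose B n := offdiag (fun j => (U n *m x n) j 0) (fun j => (U n *m y n) j 0).
pose b n := 2 * \sum_j \sum_k B n j k ^+ 2.
have ub n : (U n)^T *m U n = 1%:M -> dot (x n) (x n) = 1 ->
    dot (y n) (y n) + dot (x n) (y n) ^+ 2 = 1 ->
    let u4 := \sum_j (U n *m x n) j 0 ^+ 4 in
    let w4 := \sum_j (U n *m y n) j 0 ^+ 4 in
    [/\ 0 <= 1 - b n, 1 - b n <= u4 + w4, \sum_j \sum_k B n j k ^+ 4 <= u4 * w4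
      & \sum_j (\sum_k B n j k ^+ 2) ^+ 2 <= (u4 + w4) / 2].
  move=> UU xx yy u4 w4.
  have y1 : dot (y n) (y n) <= 1 by rewrite -yy lerDl sqr_ge0.
  have y0 : 0 <= dot (y n) (y n).
    by rewrite /dot mxE sumr_ge0// => j _; rewrite mxE -expr2 sqr_ge0.
  have uu : \sum_j (U n *m x n) j 0 ^+ 2 = 1.
    by rewrite -xx -(vec_dot UU); apply: eq_bigr => j _; rewrite expr2.
  have ww : \sum_j (U n *m y n) j 0 ^+ 2 = dot (y n) (y n).
    by rewrite -(vec_dot UU); apply: eq_bigr => j _; rewrite expr2.
  have := offdiag_sqr_defect (fun j => (U n *m x n) j 0) (fun j => (U n *m y n) j 0).
  rewrite -/(B n) -/(b n) uu ww mul1r (vec_dot UU) yy => /andP[-> ->]; split => //.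
    exact: offdiag_pow4.
  apply: (le_trans (offdiag_rows _ _)); rewrite uu ww expr1n mulr1.
  rewrite ler_pM2r ?invr_gt0// lerD2r ler_piMr ?expr_le1//.
  by rewrite sumr_ge0// => j _; rewrite (_ : 4 = 2 * 2)%N// exprM sqr_ge0.
apply: (@call_cvg_of_stein R _ Y b err _ _ _ err0).
- near=> n; rewrite card_ffun expn_gt0; apply/orP; left; apply: sparse_col_gt0; near: n.
  exact: hS.
- near=> n; rewrite /b mulr_ge0 ?sumr_ge0//=; last first.
    by move=> j _; rewrite sumr_ge0// => k _; exact: sqr_ge0.
  have [] := ub n; do ?[by near: n].
  by rewrite subr_ge0.
- near=> n => g g' C C0 dg g'C g'L lam lam0.
  have m0 : (0 < m n)%N by near: n.
  have mR : 0 < (m n)%:R :> R by rewrite ltr0n.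
  have zR : 0 < (zeta (m n))%:R :> R by rewrite ltr0n.
  have S0 : sparse_signs R (m n) (zeta (m n)) !=set0 by near: n; exact: hS.
  have UU : (U n)^T *m U n = 1%:M by near: n.
  have xx : dot (x n) (x n) = 1 by near: n.
  have yy : dot (y n) (y n) + dot (x n) (y n) ^+ 2 = 1 by near: n.
  have I0 : (0 < #|'I_(m n)|)%N by rewrite card_ord.
  have st := @stein_sketch R 'I_(m n) 'I_n (sparse_col R (m n) (zeta (m n)))
    (@entry R (m n) (zeta (m n))) (zeta (m n))%:R (@flip R (m n) (zeta (m n)))
    I0 (sparse_col_gt0 S0) zR (entry_norm (hzeta _)) (entry_pow4 (hzeta _))
    (avg_entry_sqr (hzeta _) S0) (@avg_entry_sqr2 _ _ _ (hzeta _) S0) (@flip_bij _ _ _)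
    (@flipE _ _ _) (B n) (@offdiag_sym _ _ _ _) (@offdiag_diag _ _ _ _)
    g g' C C0 dg g'C g'L lam lam0.
  rewrite (_ : avg _ = avg (fun f : {ffun 'I_n -> sparse_col R (m n) (zeta (m n))} =>
     g' (Num.sqrt #|'I_(m n)|%:R * \sum_j \sum_k B n j k * \sum_a entry (f j) a * entry (f k) a) -
     (Num.sqrt #|'I_(m n)|%:R * \sum_j \sum_k B n j k * \sum_a entry (f j) a * entry (f k) a) *
     g (Num.sqrt #|'I_(m n)|%:R * \sum_j \sum_k B n j k * \sum_a entry (f j) a * entry (f k) a)));
    last by apply: eq_avg => f; rewrite /Y sketch_err_offdiag// card_ord.
  apply: (le_trans st); rewrite ler_wpM2l// lerD2l ler_wpM2l ?invr_ge0 ?(ltW lam0)//.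
  rewrite card_ord -/(b n).
  have [h0 h1 h4 hc] := ub n UU xx yy.
  have y1 : dot (y n) (y n) <= 1 by rewrite -yy lerDl sqr_ge0.
  have hu4 := vec_pow4 (U n) (_ : dot (x n) (x n) <= 1); rewrite {1}xx in hu4.
  have {}hu4 := hu4 (lexx _); have hw4 := vec_pow4 (U n) y1.
  have sum4_ge0 (F : 'I_n -> R) : 0 <= \sum_j F j ^+ 4.
    by rewrite sumr_ge0// => j _; rewrite (_ : 4 = 2 * 2)%N// exprM sqr_ge0.
  have u40 := sum4_ge0 (fun j => (U n *m x n) j 0).
  have w40 := sum4_ge0 (fun j => (U n *m y n) j 0).
  move: h1 h4 hc hu4 hw4 u40 w40.
  rewrite /err; set kap := \sum_(k < n) \sum_(j < q) U n k j ^+ 4.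
  set u4 := \sum_j (U n *m x n) j 0 ^+ 4; set w4 := \sum_j (U n *m y n) j 0 ^+ 4.
  set B4 := \sum_j \sum_k B n j k ^+ 4; set cc := \sum_j (\sum_k B n j k ^+ 2) ^+ 2.
  move=> h1 h4 hc hu4 hw4 u40 w40.
  have [s [sm sm2 sm1 tE]] : exists s : R, [/\ 0 < s, s ^+ 2 = (m n)%:R, 1 <= s
      & ta n = s / (zeta (m n))%:R * kap].
    exists (Num.sqrt (m n)%:R); split => //.
    - by rewrite sqrtr_gt0.
    - by rewrite sqr_sqrtr// ltW.
    - by rewrite -[leLHS]sqrtr1 ler_sqrt ?ler0n// ler1n.
  (* abstract names keep the simplifier from unfolding the unary numerals *)
  have gen (k : nat) : exists2 c : R, c = k%:R & 0 <= c by exists k%:R.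
  have [c2 <- c20] := gen 243; have [c3 <- c30] := gen 3888; have [c4 <- c40] := gen 1952.
  have qk0 : 0 <= q%:R * kap by exact: le_trans hu4.
  have b1 : 0 <= b n <= 1.
    have -> : b n <= 1 by rewrite -subr_ge0.
    rewrite andbT /b mulr_ge0 ?sumr_ge0// => j _.
    by rewrite sumr_ge0// => k _; exact: sqr_ge0.
  have e1 : (1 - b n) ^+ 2 <= 4 * q%:R ^+ 2 * (ta n ^+ 2 * ya n).
    have -> : 4 * q%:R ^+ 2 * (ta n ^+ 2 * ya n) = (2 * (q%:R * kap)) ^+ 2.
      by rewrite tE /ya -sm2; field; rewrite !gt_eqF.
    have b2 : 1 - b n <= 2 * (q%:R * kap).
      by apply: (le_trans h1); rewrite mulr_natl mulr2n lerD.
    by rewrite ler_pXn2r ?nnegrE// (le_trans h0).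
  have e2 : c2 * b n ^+ 2 / (m n)%:R <= c2 * ((m n)%:R)^-1.
    rewrite -mulrA ler_wpM2l// ler_piMl ?invr_ge0 ?ler0n//.
    by case/andP: b1 => b0 b1; rewrite expr_le1.
  have e3 : c3 * cc / (zeta (m n))%:R <= c3 * q%:R * ta n.
    have -> : c3 * q%:R * ta n = c3 * (s * (q%:R * kap)) / (zeta (m n))%:R.
      by rewrite tE; field; rewrite gt_eqF.
    rewrite ler_pM2r ?invr_gt0// ler_wpM2l//.
    apply: (@le_trans _ _ (q%:R * kap)); first by lra.
    by rewrite ler_peMl.
  have e4 : c4 * ((m n)%:R / (zeta (m n))%:R ^+ 2) * B4 <= c4 * q%:R ^+ 2 * ta n ^+ 2.
    have -> : c4 * q%:R ^+ 2 * ta n ^+ 2 =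
        c4 * ((m n)%:R / (zeta (m n))%:R ^+ 2) * ((q%:R * kap) * (q%:R * kap)).
      by rewrite tE -sm2; field; rewrite gt_eqF.
    rewrite ler_wpM2l ?mulr_ge0 ?divr_ge0 ?sqr_ge0 ?ler0n//.
    by apply: (le_trans h4); rewrite ler_pM.
  by lra.
Unshelve. all: by end_near.
Qed.

End sketched_clt.

(** * Localization of the eigenvalues *)

Section spectrum.
Variables (R : realType) (q : nat).

(** D (1 + E) D with D = diag(l): multiplicative perturbations keep the bounds
    relative to the size of each eigenvalue. *)
Definition scaled (l : 'rV[R]_q) (E : 'M[R]_q) : 'M[R]_q :=
  diag_mx l *m (1%:M + E) *m diag_mx l.

Lemma scaledE l E j k : scaled l E j k = (l 0 j * (j == k)%:R + l 0 j * E j k) * l 0 k.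
Proof.
rewrite /scaled mul_mx_diag mxE mul_diag_mx !mxE mulrDr.
by [].
Qed.

(** The determinant of x - D (1 + t E) D is a polynomial in t without roots in
    [0, 1], and therefore has the same sign at t = 0 and at t = 1: at the
    coordinate where a null vector is largest, the term x - l_k^2 dominates the
    whole contribution of E. *)
Lemma det_scaled_sign (l : 'rV[R]_q) (E : 'M[R]_q) (x K tau delta : R) :
  (forall k, 0 < l 0 k) -> (forall j k, l 0 j <= K * l 0 k) ->
  (forall j k, `|E j k| <= delta) -> 0 <= K ->
  (forall k, tau * l 0 k ^+ 2 <= `|x - l 0 k ^+ 2|) ->
  delta * K * q%:R < tau ->
  0 < \det (x%:M - scaled l E) * \prod_k (x - l 0 k ^+ 2).
Proof.
move=> l0 lK Ed K0 xl dK.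
pose A t := x%:M - scaled l (t *: E).
have AE t j k : A t j k = x *+ (j == k)
    - (l 0 j * (j == k)%:R + l 0 j * (t * E j k)) * l 0 k.
  rewrite /A; have := scaledE l (t *: E) j k; rewrite [(t *: E) j k]mxE.
  by move: (scaled l (t *: E)) => B e; rewrite !mxE e.
have An t : 0 <= t <= 1 -> \det (A t) != 0.
  move=> /andP[t0 t1]; apply/det0P => -[v v0 vA].
  have [j0 vj0] : exists j, v 0 j != 0 by exact/rV0Pn.
  have [k _ kmax] := @arg_maxP _ R 'I_q j0 xpredT (fun j => `|v 0 j|) isT.
  have vk0 : 0 < `|v 0 k| by apply: lt_le_trans (kmax j0 isT); rewrite normr_gt0.
  have e : v 0 k * (x - l 0 k ^+ 2) = \sum_j v 0 j * (l 0 j * (t * E j k) * l 0 k).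
    have := congr1 (fun M : 'rV[R]_q => M 0 k) vA; rewrite mxE [RHS]mxE.
    under eq_bigr => j _.
      rewrite AE.
      rewrite (_ : v 0 j * _ = v 0 j * (x *+ (j == k) - l 0 j * (j == k)%:R * l 0 k)
        - v 0 j * (l 0 j * (t * E j k) * l 0 k)); last by ring.
      over.
    rewrite big_split /= sumrN => /eqP; rewrite subr_eq0 => /eqP <-.
    rewrite (bigD1 k)//= eqxx big1 => [|j jk]; last first.
      by rewrite (negbTE jk) mulr0n mulr0 mul0r subr0 mulr0.
    by rewrite addr0 /= !mulr1n; ring.
  have d0 : 0 <= delta by exact: le_trans (normr_ge0 _) (Ed k k).
  have : `|v 0 k| * (tau * l 0 k ^+ 2) <= \sum_(j < q) `|v 0 k| * (delta * K * l 0 k ^+ 2).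
    apply: (@le_trans _ _ `|v 0 k * (x - l 0 k ^+ 2)|).
      by rewrite normrM ler_wpM2l.
    rewrite e (le_trans (ler_norm_sum _ _ _))//; apply: ler_sum => j _.
    rewrite normrM ler_pM ?normr_ge0//; first exact: kmax.
    rewrite !normrM (gtr0_norm (l0 j)) (gtr0_norm (l0 k)) (ger0_norm t0).
    have -> : delta * K * l 0 k ^+ 2 = K * l 0 k * (1 * delta) * l 0 k by ring.
    have l0k := ltW (l0 k); have l0j := ltW (l0 j).
    by rewrite ler_wpM2r// ler_pM ?mulr_ge0 ?normr_ge0// ler_pM ?normr_ge0.
  rewrite sumr_const card_ord -[_ *+ q]mulr_natr.
  have -> : `|v 0 k| * (delta * K * l 0 k ^+ 2) * q%:R =
    `|v 0 k| * l 0 k ^+ 2 * (delta * K * q%:R) by ring.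
  have -> : `|v 0 k| * (tau * l 0 k ^+ 2) = `|v 0 k| * l 0 k ^+ 2 * tau by ring.
  rewrite ler_pM2l ?mulr_gt0 ?exprn_gt0//.
  by rewrite leNgt dK.
pose M : 'M[{poly R}]_q := \matrix_(j, k)
  ((x *+ (j == k) - l 0 j * (j == k)%:R * l 0 k)%:P - 'X * (l 0 j * E j k * l 0 k)%:P).
have ME t : (\det M).[t] = \det (A t).
  rewrite -horner_evalE -det_map_mx; congr (\det _); apply/matrixP => j k.
  rewrite AE mxE /M mxE /= horner_evalE hornerD hornerN hornerM hornerX !hornerC.
  by case: eqVneq => _ /=; rewrite ?mulr1n ?mulr0n; ring.
have P0 : (\det M).[0] = \prod_k (x - l 0 k ^+ 2).
  rewrite ME (_ : A 0 = diag_mx (\row_k (x - l 0 k ^+ 2))) ?det_diag.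
    by apply: eq_bigr => k _; rewrite mxE.
  apply/matrixP => j k; rewrite AE !mxE.
  by case: eqVneq => [->|_]; rewrite ?mulr1n ?mulr0n; ring.
have P1 : (\det M).[1] = \det (x%:M - scaled l E) by rewrite ME /A scale1r.
rewrite -P1 -P0; rewrite ltNge; apply/negP => P10.
have [t t01 /rootP rt] : exists2 t, 0 <= t <= 1 & root (\det M) t.
  have [h|h] := leP (\det M).[0] 0.
    have : (\det M).[0] != 0 by rewrite ME An// lexx ler01.
    move=> n0; have h' : (\det M).[0] < 0 by rewrite lt_neqAle n0.
    by apply: (poly_ivt ler01); rewrite h; move: P10; rewrite nmulr_lle0.
  have hN : (- \det M).[0] <= 0 <= (- \det M).[1].
    by rewrite !hornerN oppr_le0 (ltW h) oppr_ge0; move: P10; rewrite pmulr_lle0.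
  have [t t01 rt] := poly_ivt ler01 hN.
  by exists t => //; rewrite -rootN.
by have := An t t01; rewrite -ME rt eqxx.
Qed.

Lemma horner_char_poly (A : 'M[R]_q) x : (char_poly A).[x] = \det (x%:M - A).
Proof.
rewrite /char_poly -horner_evalE -det_map_mx; congr (\det _); apply/matrixP => j k.
rewrite mxE /= horner_evalE /char_poly_mx !mxE hornerD hornerN hornerC.
by case: eqVneq => _ /=; rewrite ?mulr1n ?mulr0n ?hornerX ?hornerC.
Qed.

Let seq_of (l : 'rV[R]_q) := [seq l 0 i | i <- enum 'I_q].

Let prod_seq_of (l : 'rV[R]_q) :
  \prod_(i < q) ('X - (l 0 i)%:P) = \prod_(x <- seq_of l) ('X - x%:P).
Proof. by rewrite big_map big_enum. Qed.

Let sorted_seq_of (l : 'rV[R]_q) : (forall i j : 'I_q, (i <= j)%N -> l 0 j <= l 0 i) ->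
  sorted >=%R (seq_of l).
Proof.
move=> h; rewrite sorted_map.
apply: (@sub_sorted _ (relpre val leq)) => [i j /=|]; first exact: h.
by rewrite -sorted_map val_enum_ord iota_sorted.
Qed.

(** Turns a list of roots into the vector eigvals, which is specified by the
    factorization of the characteristic polynomial. *)
Lemma eigvals_eq (A : 'M[R]_q) (l : 'rV[R]_q) :
  (forall i j : 'I_q, (i < j)%N -> l 0 j < l 0 i) ->
  (forall i, root (char_poly A) (l 0 i)) -> eigvals A = l.
Proof.
move=> ldec lroot.
have lnon (i j : 'I_q) : (i <= j)%N -> l 0 j <= l 0 i.
  by rewrite leq_eqVlt => /predU1P[/val_inj->//|/ldec/ltW].
have linj : injective (fun i => l 0 i).
  move=> i j e; apply/val_inj/eqP; case: ltngtP => // ij; have := ldec _ _ ij;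
    by rewrite e ltxx.
have charE : char_poly A = \prod_(i < q) ('X - (l 0 i)%:P).
  rewrite prod_seq_of (@all_roots_prod_XsubC _ (char_poly A) (seq_of l)).
  - by rewrite (monicP (char_poly_monic A)) scale1r.
  - by rewrite size_char_poly size_map size_enum_ord.
  - by apply/allP => _ /mapP[i _ ->].
  - by rewrite uniq_rootsE map_inj_uniq ?enum_uniq.
have [h1 h2] : [set l : 'rV[R]_q | (forall i j : 'I_q, (i <= j)%N -> l 0 j <= l 0 i) /\
    char_poly A = \prod_(i < q) ('X - (l 0 i)%:P)] (eigvals A).
  by apply: xgetPex; exists l.
have : seq_of (eigvals A) = seq_of l.
  apply: (@sorted_eq _ (>=%R : rel R)).
  - by move=> x y z; exact: ge_trans.
  - by move=> x y /andP[xy yx]; apply: le_anti; apply/andP; split.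
  - exact: sorted_seq_of.
  - exact: sorted_seq_of.
  - by apply: prod_XsubC_eq; rewrite -!prod_seq_of -h2.
move=> /eq_in_map e; apply/rowP => i; apply: e.
by rewrite mem_enum.
Qed.

(** The intervals (1 - tau, 1 + tau) l_i^2 are disjoint, and by det_scaled_sign
    the characteristic polynomial has at their ends the signs that it has for
    E = 0; so each of them contains a root. *)
Lemma eigvals_scaled_near (A : 'M[R]_q) (l : 'rV[R]_q) (E : 'M[R]_q) (K g tau delta : R) :
  (forall k, 0 < l 0 k) -> (forall j k, l 0 j <= K * l 0 k) -> 0 <= K ->
  0 <= g -> (forall j k : 'I_q, (j < k)%N -> g * l 0 k <= l 0 j) ->
  (forall j k, `|E j k| <= delta) ->
  0 < tau < 1 -> 1 + tau < g ^+ 2 * (1 - tau) -> delta * K * q%:R < tau ->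
  char_poly A = char_poly (scaled l E) ->
  forall i, `|eigval A i - l 0 i ^+ 2| < tau * l 0 i ^+ 2.
Proof.
move=> l0 lK K0 g0 lg Ed /andP[tau0 tau1] gtau dK charA.
have l20 k : 0 < l 0 k ^+ 2 by rewrite exprn_gt0.
have lg2 (j k : 'I_q) : (j < k)%N -> g ^+ 2 * l 0 k ^+ 2 <= l 0 j ^+ 2.
  move=> jk; rewrite -exprMn ler_pXn2r ?nnegrE ?(ltW (l0 _)) ?lg//.
  by rewrite mulr_ge0// ltW.
have sep (j k : 'I_q) : (j < k)%N -> (1 + tau) * l 0 k ^+ 2 < (1 - tau) * l 0 j ^+ 2.
  move=> jk; apply: (@lt_le_trans _ _ (g ^+ 2 * (1 - tau) * l 0 k ^+ 2)).
    by rewrite ltr_pM2r.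
  have -> : g ^+ 2 * (1 - tau) * l 0 k ^+ 2 = (1 - tau) * (g ^+ 2 * l 0 k ^+ 2) by ring.
  by rewrite ler_pM2l ?lg2// subr_gt0.
(* both ends of the i-th interval are on the same side of the other l_k^2 *)
have away i k (s : R) : s = 1 + tau \/ s = 1 - tau -> k != i ->
    tau * l 0 k ^+ 2 <= `|s * l 0 i ^+ 2 - l 0 k ^+ 2| /\
    0 < (s * l 0 i ^+ 2 - l 0 k ^+ 2) * (l 0 i ^+ 2 - l 0 k ^+ 2).
  move=> hs ki; have [s1 s2] : 1 - tau <= s /\ s <= 1 + tau by case: hs => ->; lra.
  have hs1 := ler_wpM2r (ltW (l20 i)) s1; have hs2 := ler_wpM2r (ltW (l20 i)) s2.
  have pi := mulr_gt0 tau0 (l20 i); have pk := mulr_gt0 tau0 (l20 k).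
  have [ik|ik|/val_inj e] := ltngtP i k; last by rewrite e eqxx in ki.
  - have h := sep i k ik; rewrite mulrDl mulrBl !mul1r in h hs1 hs2.
    have p1 : 0 < s * l 0 i ^+ 2 - l 0 k ^+ 2 by lra.
    split; first by rewrite (gtr0_norm p1); lra.
    by rewrite mulr_gt0//; lra.
  - have h := sep k i ik; rewrite mulrDl mulrBl !mul1r in h hs1 hs2.
    have p1 : s * l 0 i ^+ 2 - l 0 k ^+ 2 < 0 by lra.
    split; first by rewrite (ltr0_norm p1); lra.
    by rewrite nmulr_rgt0//; lra.
have sgn i (s : R) : s = 1 + tau \/ s = 1 - tau ->
    0 < (char_poly A).[s * l 0 i ^+ 2] * \prod_k (s * l 0 i ^+ 2 - l 0 k ^+ 2).
  move=> hs; rewrite charA horner_char_poly.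
  apply: (det_scaled_sign l0 lK Ed K0 _ dK) => k.
  have [->|ki] := eqVneq k i; last by have [] := away i k s hs ki.
  have -> : s * l 0 i ^+ 2 - l 0 i ^+ 2 = (s - 1) * l 0 i ^+ 2 by ring.
  rewrite normrM (gtr0_norm (l20 i)) ler_pM2r//.
  case: hs => ->; [have -> : 1 + tau - 1 = tau by ring|have -> : 1 - tau - 1 = - tau by ring];
    by rewrite ?normrN ger0_norm// ltW.
have /choice[mu hmu] : forall i, exists x, root (char_poly A) x /\
    `|x - l 0 i ^+ 2| < tau * l 0 i ^+ 2.
  move=> i; set a := (1 - tau) * l 0 i ^+ 2; set b := (1 + tau) * l 0 i ^+ 2.
  have ab : a <= b by rewrite ler_pM2r//; lra.
  have sa := sgn i (1 - tau) (or_intror erefl); rewrite -/a in sa.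
  have sb := sgn i (1 + tau) (or_introl erefl); rewrite -/b in sb.
  have prodneg : (\prod_k (a - l 0 k ^+ 2)) * (\prod_k (b - l 0 k ^+ 2)) < 0.
    rewrite -big_split (bigD1 i)//= pmulr_llt0.
      have -> : a - l 0 i ^+ 2 = - (tau * l 0 i ^+ 2) by rewrite /a; ring.
      have -> : b - l 0 i ^+ 2 = tau * l 0 i ^+ 2 by rewrite /b; ring.
      by rewrite mulNr oppr_lt0 -expr2 exprn_gt0// mulr_gt0.
    apply: prodr_gt0 => k ki.
    have [_ h1] := away i k (1 - tau) (or_intror erefl) ki.
    have [_ h2] := away i k (1 + tau) (or_introl erefl) ki.
    have := mulr_gt0 h1 h2; rewrite -/a -/b mulrACA -expr2.
    have n0 : l 0 i ^+ 2 - l 0 k ^+ 2 != 0.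
      by apply: contraTneq h1 => ->; rewrite mulr0 ltxx.
    by rewrite pmulr_lgt0// exprn_even_gt0.
  have cneg : (char_poly A).[a] * (char_poly A).[b] < 0.
    have := mulr_gt0 sa sb; rewrite mulrACA.
    by rewrite nmulr_lgt0.
  have [x /andP[ax xb] rx] : exists2 x, a <= x <= b & root (char_poly A) x.
    have [h|h] := leP (char_poly A).[a] 0.
      have h' : (char_poly A).[a] < 0.
        by rewrite lt_neqAle h andbT; apply: contraTneq cneg => ->; rewrite mul0r ltxx.
      by apply: (poly_ivt ab); rewrite h; move: cneg; rewrite nmulr_rlt0// => /ltW.
    have hN : (- char_poly A).[a] <= 0 <= (- char_poly A).[b].
      by rewrite !hornerN oppr_le0 (ltW h) oppr_ge0; move: cneg; rewrite pmulr_rlt0// => /ltW.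
    have [x xab rx] := poly_ivt ab hN.
    by exists x => //; rewrite -rootN.
  exists x; split => //.
  have xa : x != a by apply: contraTneq cneg => <-; rewrite (rootP rx) mul0r ltxx.
  have xb' : x != b by apply: contraTneq cneg => <-; rewrite (rootP rx) mulr0 ltxx.
  have {}ax : a < x by rewrite lt_neqAle eq_sym xa.
  have {}xb : x < b by rewrite lt_neqAle xb'.
  rewrite /a mulrBl mul1r in ax; rewrite /b mulrDl mul1r in xb.
  by rewrite ltr_norml; apply/andP; split; lra.
move=> i; rewrite /eigval (@eigvals_eq A (\row_k mu k)).
- by rewrite mxE; have [] := hmu i.
- move=> j k jk; rewrite !mxE.
  have [_ h1] := hmu j; have [_ h2] := hmu k; have := sep j k jk.
  rewrite mulrDl mulrBl !mul1r.
  move: h1 h2; rewrite !ltr_norml => /andP[h1 _] /andP[_ h2].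
  by lra.
- by move=> k; rewrite mxE; have [] := hmu k.
Qed.

End spectrum.

(** * Expansion of eigenvectors *)

Section eigenvector.
Variable R : realType.

(** Here r_k is l_k / l_i, mu the i-th sample eigenvalue over l_i^2, and y the
    coordinates of its eigenvector; the hypothesis that relates them is the
    eigenvector equation. Off i, the factor mu - r_k^2 stays away from 0, which
    makes y_k of order delta; then the normalization makes 1 - y_i of order
    delta^2, and feeding both back into the equation gives the expansions. *)
Lemma eigvec_expansion (q : nat) (K gam : R) : 1 <= K -> 0 < gam ->
  exists C d0 : R, [/\ 0 <= C, 0 < d0 &
  forall (r y : 'I_q -> R) (E : 'I_q -> 'I_q -> R) (mu delta : R) (i : 'I_q),
  0 <= delta -> delta <= d0 -> (forall k, 0 < r k <= K) -> r i = 1 ->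
  (forall k, k != i -> gam <= `|1 - r k ^+ 2|) ->
  (forall j k, `|E j k| <= delta) ->
  \sum_k y k ^+ 2 = 1 -> 0 <= y i -> `|mu - 1| <= gam / 2 ->
  (forall k, (mu - r k ^+ 2) * y k = r k * \sum_j E k j * r j * y j) ->
  [/\ forall k, k != i -> `|y k| <= C * delta,
      `|y i - 1| <= C * delta ^+ 2,
      `|mu - 1| <= C * delta,
      `|mu - 1 - E i i| <= C * delta ^+ 2
    & forall k, k != i -> `|y k - r k / (1 - r k ^+ 2) * E k i| <= C * delta ^+ 2]].
Proof.
move=> K1 gam0; have K0 : 0 < K by lra.
have qn0 : 0 <= q%:R :> R by exact: ler0n.
pose A : R := q%:R * K ^+ 2; have A0 : 0 <= A by rewrite mulr_ge0// sqr_ge0.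
pose c1 := 2 * A / gam; have c10 : 0 <= c1 by rewrite divr_ge0 ?(ltW gam0)// mulr_ge0.
pose c0 := q%:R * c1 ^+ 2; have c00 : 0 <= c0 by rewrite mulr_ge0// sqr_ge0.
pose c2 := 2 * (q%:R * K * c1).
have c20 : 0 <= c2.
  by apply: mulr_ge0 => //; apply: mulr_ge0 => //; apply: mulr_ge0 => //; exact: ltW.
pose c3 := (K * c0 + q%:R * K ^+ 2 * c1 + (1 + c2) * c1) / gam.
have c30 : 0 <= c3.
  have p1 : 0 <= K * c0 by apply: mulr_ge0 => //; exact: ltW.
  have p2 : 0 <= q%:R * K ^+ 2 * c1 by apply: mulr_ge0 => //; apply: mulr_ge0 => //; exact: sqr_ge0.
  have p3 : 0 <= (1 + c2) * c1 by apply: mulr_ge0 => //; lra.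
  by apply: divr_ge0; [lra|exact: ltW].
pose C := c1 + c0 + (1 + c2) + c3.
exists C, (1 + 2 * c0)^-1; split; first by rewrite /C; lra.
  by rewrite invr_gt0; lra.
move=> r y E mu delta i d0 dd rK ri rgam Ed yy yi0 mug eq.
have D0 : 0 < 1 + 2 * c0 by lra.
have dc : delta * (1 + 2 * c0) <= 1 by rewrite -ler_pdivlMr// mul1r.
have dc0 : 0 <= delta * (2 * c0) by rewrite mulr_ge0// mulr_ge0//.
have d1 : delta <= 1 by move: dc; rewrite mulrDr mulr1; lra.
have dd2 : delta ^+ 2 <= delta by rewrite expr2 ler_piMl.
have d20 : 0 <= delta ^+ 2 by exact: sqr_ge0.
have c0d : c0 * delta ^+ 2 <= 1 / 2.
  have := ler_wpM2l c00 dd2; move: dc; rewrite mulrDr mulr1 (mulrC delta (2 * c0)) -mulrA; lra.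
have wk (c x : R) : c <= C -> 0 <= x -> c * x <= C * x by move=> cC x0; rewrite ler_wpM2r.
have y1 j : `|y j| <= 1.
  rewrite -(@ler_pXn2r _ 2)// ?nnegrE// expr1n real_normK ?num_real//.
  by rewrite -yy (bigD1 j)//= lerDl sumr_ge0// => k _; exact: sqr_ge0.
have rK' k : `|r k| <= K by have /andP[r0 ?] := rK k; rewrite gtr0_norm.
have row (P : pred 'I_q) k (b : R) : 0 <= b -> (forall j, P j -> `|y j| <= b) ->
    `|\sum_(j | P j) E k j * r j * y j| <= q%:R * (delta * K * b).
  move=> b0 yb; apply: (le_trans (ler_norm_sum _ _ _)).
  apply: (@le_trans _ _ (\sum_(j < q) delta * K * b)); last first.
    by rewrite sumr_const card_ord -[_ *+ q]mulr_natl.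
  rewrite big_mkcond; apply: ler_sum => j _; case: ifP => Pj.
    by rewrite !normrM ler_pM ?mulr_ge0 ?normr_ge0 ?yb// ler_pM ?normr_ge0.
  by rewrite !mulr_ge0// ltW.
have yk k : k != i -> `|y k| <= c1 * delta.
  move=> ki.
  have h1 : `|(mu - r k ^+ 2) * y k| <= A * delta.
    rewrite eq normrM; apply: (@le_trans _ _ (K * (q%:R * (delta * K * 1)))).
      by rewrite ler_pM ?normr_ge0// row.
    by rewrite /A le_eqVlt; apply/orP; left; apply/eqP; ring.
  have h2 : gam / 2 <= `|mu - r k ^+ 2|.
    have := rgam k ki.
    have -> : 1 - r k ^+ 2 = (mu - r k ^+ 2) - (mu - 1) by ring.
    by move/le_trans => /(_ _ (ler_normB _ _)); lra.
  have -> : c1 * delta = (A * delta) / (gam / 2) by rewrite /c1; field; rewrite gt_eqF.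
  rewrite ler_pdivlMr ?divr_gt0//; apply: le_trans h1.
  by rewrite normrM mulrC ler_wpM2r.
have yi : `|y i - 1| <= c0 * delta ^+ 2.
  have yi1 : y i <= 1 by apply: le_trans (y1 i); exact: ler_norm.
  rewrite distrC ger0_norm ?subr_ge0//.
  apply: (@le_trans _ _ (1 - y i ^+ 2)); first by rewrite lerD2l lerN2 expr2 ler_piMl.
  have -> : 1 - y i ^+ 2 = \sum_(k | k != i) y k ^+ 2.
    by rewrite -yy (bigD1 i)//= addrC addrK.
  apply: (@le_trans _ _ (\sum_(k < q) (c1 * delta) ^+ 2)).
    rewrite [leLHS]big_mkcond; apply: ler_sum => k _; case: ifP => ki; last exact: sqr_ge0.
    have c1d : 0 <= c1 * delta by exact: mulr_ge0.
    by rewrite -(real_normK (num_real (y k))) ler_pXn2r ?nnegrE//; exact: yk.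
  rewrite sumr_const card_ord -[_ *+ q]mulr_natl /c0.
  by rewrite le_eqVlt; apply/orP; left; apply/eqP; ring.
have yhalf : 1 / 2 <= y i by move: yi; rewrite ler_norml => /andP[]; lra.
have muE : `|mu - 1 - E i i| <= c2 * delta ^+ 2.
  have e : (mu - 1 - E i i) * y i = \sum_(j | j != i) E i j * r j * y j.
    have := eq i; rewrite ri expr1n mul1r (bigD1 i)//= ri mulr1 => h.
    by rewrite mulrBl h; ring.
  have h : `|\sum_(j | j != i) E i j * r j * y j| <= q%:R * (delta * K * (c1 * delta)).
    by apply: row => //; rewrite mulr_ge0.
  rewrite -e normrM in h.
  have h2 : `|mu - 1 - E i i| * (1 / 2) <= `|mu - 1 - E i i| * `|y i|.
    by rewrite ler_wpM2l// ger0_norm.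
  have -> : c2 * delta ^+ 2 = 2 * (q%:R * (delta * K * (c1 * delta))) by rewrite /c2; ring.
  lra.
have mu1 : `|mu - 1| <= (1 + c2) * delta.
  have -> : mu - 1 = (mu - 1 - E i i) + E i i by ring.
  apply: (le_trans (ler_normD _ _)); have := Ed i i; have := ler_wpM2l c20 dd2.
  by rewrite mulrDl mul1r; lra.
split.
- by move=> k ki; apply: (le_trans (yk k ki)); apply: wk => //; rewrite /C; lra.
- by apply: (le_trans yi); apply: wk => //; rewrite /C; lra.
- by apply: (le_trans mu1); apply: wk => //; rewrite /C; lra.
- by apply: (le_trans muE); apply: wk => //; rewrite /C; lra.
- move=> k ki; apply: (@le_trans _ _ (c3 * delta ^+ 2)); last by apply: wk => //; rewrite /C; lra.
  have g := rgam k ki; set den := 1 - r k ^+ 2 in g *.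
  have den0 : den != 0 by rewrite -normr_gt0 (lt_le_trans gam0).
  have -> : y k - r k / den * E k i = (r k * E k i * (y i - 1)
     + r k * (\sum_(j | j != i) E k j * r j * y j) - (mu - 1) * y k) / den.
    have := eq k; rewrite (bigD1 i)//= ri mulr1.
    set s := \sum_(j | _) _ => h.
    have -> : (mu - 1) * y k = r k * (E k i * y i + s) - den * y k by rewrite -h /den; ring.
    by field.
  rewrite normrM normfV ler_pdivrMr ?normr_gt0//.
  apply: (@le_trans _ _ (c3 * delta ^+ 2 * gam)); last first.
    by rewrite ler_wpM2l// mulr_ge0.
  have -> : c3 * delta ^+ 2 * gam = K * delta * (c0 * delta ^+ 1) + K * (q%:R * (delta * K * (c1 * delta)))
     + (1 + c2) * delta * (c1 * delta) by rewrite /c3; field; rewrite gt_eqF.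
  apply: (le_trans (ler_normB _ _)); apply: lerD; last first.
    by rewrite normrM ler_pM ?normr_ge0 ?yk.
  apply: (le_trans (ler_normD _ _)); apply: lerD; rewrite normrM.
    rewrite normrM ler_pM ?mulr_ge0 ?normr_ge0//; first by rewrite ler_pM ?normr_ge0.
    by rewrite (le_trans yi)// ler_wpM2l// expr1.
  by rewrite ler_pM ?normr_ge0// row// mulr_ge0.
Qed.

(** Brings the localization of the eigenvalues of D (1 + E) D to the Gram
    matrix itself. *)
Lemma char_poly_orth (q : nat) (V B : 'M[R]_q) : V^T *m V = 1%:M ->
  char_poly (V *m B *m V^T) = char_poly B.
Proof.
move=> VV; have VV' : V *m V^T = 1%:M by exact: mulmx1C.
pose W := map_mx polyC V.
have WW : W *m W^T = 1%:M by rewrite /W map_trmx -map_mxM VV' map_mx1.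
have e : char_poly_mx (V *m B *m V^T) = W *m char_poly_mx B *m W^T.
  rewrite /char_poly_mx mulmxBr mulmxBl; congr (_ - _).
    by rewrite mul_mx_scalar -scalemxAl WW scalemx1.
  by rewrite /W map_trmx !map_mxM.
rewrite /char_poly e !det_mulmx mulrAC -det_mulmx WW det1 mul1r.
by [].
Qed.

End eigenvector.

Section sample.
Variable R : realType.

Lemma dot_sum (q : nat) (u v : 'cV[R]_q) : dot u v = \sum_k u k 0 * v k 0.
Proof. by rewrite /dot mxE; apply: eq_bigr => k _; rewrite mxE. Qed.

Definition separated (q : nat) (K g : R) (l : 'rV[R]_q) : Prop :=
  [/\ forall k, 0 < l 0 k, forall j k, l 0 j <= K * l 0 k
    & forall j k : 'I_q, (j < k)%N -> g * l 0 k <= l 0 j].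

(** The denominators of the expansions stay away from 0. *)
Lemma ratio_gap (q : nat) (K g : R) (l : 'rV[R]_q) i k : 1 < g -> separated K g l ->
  k != i -> 1 - (g ^+ 2)^-1 <= `|1 - (l 0 k / l 0 i) ^+ 2|.
Proof.
move=> g1 [l0 lK lg] ki; have g2 : 1 < g ^+ 2 by rewrite exprn_egt1.
have g20 : 0 < g ^+ 2 by lra.
have h' : (g ^+ 2)^-1 <= 1 by rewrite invf_le1// ltW.
have [ik|ik|/val_inj e] := ltngtP i k; last by rewrite e eqxx in ki.
- have h : (l 0 k / l 0 i) ^+ 2 <= (g ^+ 2)^-1.
    rewrite -exprVn ler_pXn2r ?nnegrE ?invr_ge0 ?divr_ge0 ?(ltW (l0 _))//; try lra.
    by rewrite ler_pdivrMr// ler_pdivlMl ?lg//; lra.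
  by rewrite ger0_norm; lra.
- have h : g ^+ 2 <= (l 0 k / l 0 i) ^+ 2.
    rewrite ler_pXn2r ?nnegrE ?divr_ge0 ?(ltW (l0 _))//; try lra.
    by rewrite ler_pdivlMr// lg.
  have h'' : 2 <= g ^+ 2 + (g ^+ 2)^-1.
    rewrite -subr_ge0; have -> : g ^+ 2 + (g ^+ 2)^-1 - 2 = (g ^+ 2 - 1) ^+ 2 / g ^+ 2.
      by field; rewrite gt_eqF//; lra.
    by rewrite divr_ge0 ?sqr_ge0// ltW.
  by rewrite ler0_norm; lra.
Qed.

(** The bounds of eigvec_expansion for the matrix V D (1 + E) D V^T, whose
    eigenvalues eigvals_scaled_near localizes. The width tau of the intervals is
    chosen so that they are disjoint and the ratios stay separated. *)
Lemma sample_eigen (q : nat) (K g : R) : 1 <= K -> 1 < g ->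
  exists C d0 : R, [/\ 0 <= C, 0 < d0 &
  forall (l : 'rV[R]_q) (V E A : 'M[R]_q) (delta : R),
  V^T *m V = 1%:M -> A = V *m scaled l E *m V^T -> 0 <= delta -> delta <= d0 ->
  separated K g l -> (forall j k, `|E j k| <= delta) ->
  forall (i : 'I_q) (w : 'cV[R]_q), A *m w = eigval A i *: w -> dot w w = 1 ->
  0 <= (V^T *m w) i 0 ->
  let y k := (V^T *m w) k 0 in
  let mu := eigval A i / l 0 i ^+ 2 in
  let r k := l 0 k / l 0 i in
  [/\ forall k, k != i -> `|y k| <= C * delta,
      `|y i - 1| <= C * delta ^+ 2,
      `|mu - 1| <= C * delta,
      `|mu - 1 - E i i| <= C * delta ^+ 2
    & forall k, k != i -> `|y k - r k / (1 - r k ^+ 2) * E k i| <= C * delta ^+ 2]].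
Proof.
move=> K1 g1; have K0 : 0 < K by lra.
have g2 : 1 < g ^+ 2 by rewrite exprn_egt1.
pose gam := 1 - (g ^+ 2)^-1.
have gam0 : 0 < gam by rewrite subr_gt0 invf_lt1//; lra.
pose tau := (g ^+ 2 - 1) / (2 * (g ^+ 2 + 1)).
have den0 : 0 < 2 * (g ^+ 2 + 1) by lra.
have tau0 : 0 < tau by rewrite divr_gt0//; lra.
have tau1 : tau < 1 by rewrite ltr_pdivrMr//; lra.
have taug : 1 + tau < g ^+ 2 * (1 - tau).
  rewrite -subr_gt0; have -> : g ^+ 2 * (1 - tau) - (1 + tau) = (g ^+ 2 - 1) / 2.
    by rewrite /tau; field; rewrite gt_eqF//; lra.
  by rewrite divr_gt0//; lra.
have taugam : tau <= gam / 2.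
  rewrite /tau /gam -subr_ge0.
  have -> : (1 - (g ^+ 2)^-1) / 2 - (g ^+ 2 - 1) / (2 * (g ^+ 2 + 1)) =
    (g ^+ 2 - 1) / (2 * g ^+ 2 * (g ^+ 2 + 1)).
    by field; rewrite !gt_eqF//; lra.
  by rewrite divr_ge0//; [lra|rewrite !mulr_ge0//; lra].
have [C [d1 [C0 d10 exp]]] := @eigvec_expansion R q K gam K1 gam0.
pose d2 := tau / (K * q%:R + 1).
have Kq0 : 0 <= K * q%:R by rewrite mulr_ge0 ?ler0n// ltW.
have d20 : 0 < d2 by rewrite divr_gt0//; lra.
exists C, (Num.min d1 d2); split => //; first by rewrite lt_min d10.
move=> l V E A delta VV AE de0; rewrite le_min => /andP[dd1 dd2] sep Ed i w Aw ww yi0 y mu r.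
have [l0 lK lg] := sep.
have VV' : V *m V^T = 1%:M by exact: mulmx1C.
have l20 k : 0 < l 0 k ^+ 2 by rewrite exprn_gt0.
have li0 := l0 i.
have dKq : delta * K * q%:R < tau.
  move: dd2; rewrite /d2 ler_pdivlMr; last lra.
  rewrite mulrDr mulr1 mulrA => h.
  have [d00|d00] := eqVneq delta 0; first by rewrite d00 !mul0r.
  by apply: lt_le_trans h; rewrite ltrDl lt_neqAle eq_sym d00.
have near := eigvals_scaled_near l0 lK (ltW K0) (ltW (lt_trans ltr01 g1)) lg Ed
  (introT andP (conj tau0 tau1)) taug dKq (_ : char_poly A = _) i.
have mu_tau : `|mu - 1| <= tau.
  have {}near := near (etrans (congr1 char_poly AE) (char_poly_orth _ VV)).
  have -> : mu - 1 = (eigval A i - l 0 i ^+ 2) / l 0 i ^+ 2.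
    by rewrite /mu; field; rewrite gt_eqF.
  by rewrite normrM normfV (gtr0_norm (l20 i)) ler_pdivrMr// ltW.
apply: (exp r y E mu delta i) => //.
- by move=> k; rewrite divr_gt0//= ler_pdivrMr.
- by rewrite /r divff// gt_eqF.
- by move=> k ki; exact: ratio_gap g1 sep ki.
- have : dot (V^T *m w) (V^T *m w) = 1.
    by rewrite /dot trmx_mul trmxK mulmxA -(mulmxA w^T) VV' mulmx1.
  by rewrite dot_sum => <-; apply: eq_bigr => k _; rewrite expr2.
- by lra.
- move=> k.
  have hy : scaled l E *m (V^T *m w) = eigval A i *: (V^T *m w).
    rewrite scalemxAr -Aw AE !mulmxA VV mul1mx.
    by [].
  have := congr1 (fun M : 'cV[R]_q => M k 0) hy; rewrite mxE [RHS]mxE.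
  under eq_bigr do rewrite scaledE.
  rewrite -/(y k).
  rewrite (_ : \sum_j _ = l 0 k ^+ 2 * y k + l 0 k * \sum_j E k j * l 0 j * y j); last first.
    rewrite mulr_sumr (bigD1 k)//= [X in _ = _ + X](bigD1 k)//= eqxx addrA; congr (_ + _).
      by rewrite -/(y k) /= mulr1n; ring.
    by apply: eq_bigr => j jk; rewrite eq_sym (negbTE jk) -/(y j) /= mulr0n; ring.
  have -> : \sum_j E k j * r j * y j = (\sum_j E k j * l 0 j * y j) / l 0 i.
    by rewrite mulr_suml; apply: eq_bigr => j _; rewrite /r; ring.
  set s := \sum_j _ => h.
  have -> : (mu - r k ^+ 2) * y k = (eigval A i * y k - l 0 k ^+ 2 * y k) / l 0 i ^+ 2.
    by rewrite /mu /r; field; rewrite gt_eqF.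
  by rewrite -h /r; field; rewrite gt_eqF.
Qed.

End sample.

(** * The delta method *)

Section linearization.
Variables (R : realType) (q : nat) (m zeta : nat -> nat).
Variable U : forall n, 'M[R]_(n, q).
Variables (d : nat -> measure_display) (T : forall n, measurableType (d n)).
Variables (P : forall n, probability (T n) R) (S : forall n, T n -> 'M[R]_(m n, n)).
Hypothesis hzeta : forall k, (0 < zeta k)%N.
Hypothesis hUU : \forall n \near \oo, (U n)^T *m U n = 1%:M.
Hypothesis hS : \forall n \near \oo, sparse_sign_embedding (P n) (zeta (m n)) (@S n).
Hypothesis hm : m @ \oo --> \oo.
Hypothesis hsparse : (zeta (m n))%:R ^+ 2 / (m n)%:R @[n --> \oo] --> (0 : R).
Hypothesis hU : Num.sqrt (m n)%:R / (zeta (m n))%:R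
        * (\sum_(k < n) \sum_(j < q) U n k j ^+ 4) @[n --> \oo] --> (0 : R).

(** The remainder can exceed e only if the squared norm of the sketching error
    exceeds th, which by Markov's inequality and sketch_err_second_moment has
    probability O(1 / (m th)). The threshold depends on n, which leaves room for
    statistics that are linearized only on a shrinking neighbourhood. *)
Lemma cvg_of_linearization (Z : forall n, 'M[R]_(m n, n) -> R) (x y : nat -> 'cV[R]_q) :
  (\forall n \near \oo, dot (x n) (x n) = 1) ->
  (\forall n \near \oo, dot (y n) (y n) + dot (x n) (y n) ^+ 2 = 1) ->
  (forall e, 0 < e -> exists th : nat -> R,
    [/\ \forall n \near \oo, 0 < th n,
        ((m n)%:R * th n)^-1 @[n --> \oo] --> (0 : R)
      & \forall n \near \oo, forall A : 'M[R]_(m n, n),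
         e < `|Z n A - Num.sqrt (m n)%:R * dot (x n) (sketch_err (U n) A *m y n)| ->
         th n <= frob2 (sketch_err (U n) A)]) ->
  cvg_in_distribution P (fun n w => Z n (S w)) (normal_prob 0 1).
Proof.
move=> hxx hyy hlin.
have hn : \forall n \near \oo, (0 < n)%N by exists 1%N.
split.
  near=> n; apply: (@embedding_measurable_fun _ _ _ (P n) _ _ (zeta (m n))).
  by near: n; exact: hS.
have hsigns : \forall n \near \oo, sparse_signs R (m n) (zeta (m n)) !=set0.
  near=> n; apply: (@sparse_signs_neq0 _ _ _ (P n) _ n _ (@S n)).
  - by near: n.
  - by near: n; exact: hS.
move=> t _.
pose W n : finType := {ffun 'I_n -> sparse_col R (m n) (zeta (m n))}.
pose Y n (f : W n) : R := Num.sqrt (m n)%:R * dot (x n) (sketch_err (U n) (sketch_mx f) *m y n).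
have hcdf : avg (fun f : W n => (Z n (sketch_mx f) <= t)%R%:R : R) @[n --> \oo] --> gcdf t.
  apply: (@cdf_cvg_of_call R W Y (fun n f => Z n (sketch_mx f))).
    by move=> s; exact: sketch_call_cvg.
  move=> e e0; have [th [th0 thm hth]] := hlin e e0.
  apply: (@squeeze_cvgr _ _ _ _ (fun=> 0) (fun n => 2 * q%:R ^+ 2 * ((m n)%:R * th n)^-1)).
  - near=> n; rewrite avg_ge0//=.
    have th0n : 0 < th n by near: n.
    have signs0 : sparse_signs R (m n) (zeta (m n)) !=set0 by near: n; exact: hsigns.
    have UU : (U n)^T *m U n = 1%:M by near: n; exact: hUU.
    have hthn : forall A : 'M[R]_(m n, n),
      e < `|Z n A - Num.sqrt (m n)%:R * dot (x n) (sketch_err (U n) A *m y n)| ->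
      th n <= frob2 (sketch_err (U n) A) by near: n.
    have := sketch_err_second_moment UU (hzeta (m n)) signs0.
    have -> : 2 * q%:R ^+ 2 * ((m n)%:R * th n)^-1 = (th n)^-1 * (2 * q%:R ^+ 2 / (m n)%:R).
      by rewrite invfM; ring.
    have ith0 : 0 <= (th n)^-1 by rewrite invr_ge0 ltW.
    move=> /(ler_wpM2l ith0); apply: le_trans; rewrite -avgZ; apply: ler_avg => f.
    have e20 : 0 <= frob2 (sketch_err (U n) (sketch_mx f)).
      by rewrite sumr_ge0// => a _; rewrite sumr_ge0// => b _; exact: sqr_ge0.
    case: ltP => [/hthn h|_] /=; last by rewrite mulr_ge0.
    by rewrite -ler_pdivrMl ?invr_gt0// invrK mulr1.
  - exact: cvg_cst.
  - rewrite -[X in _ --> X](mulr0 (2 * q%:R ^+ 2)); apply: cvgM; first exact: cvg_cst.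
    exact: thm.
rewrite [X in _ --> X](_ : _ = (gcdf t)%:E); last first.
  by rewrite /gcdf fineK// fin_num_measure.
apply/fine_cvgP; split.
  near=> n; rewrite fin_num_measure//.
  apply: (@embedding_measurable _ _ _ (P n) _ _ (zeta (m n)) (@S n) _ (fun A => Z n A <= t)).
  by near: n; exact: hS.
apply: cvg_trans hcdf; apply: near_eq_cvg; near=> n => /=.
rewrite (@embedding_prob _ _ _ (P n) _ _ (zeta (m n)) (@S n) _ (fun A => Z n A <= t))//.
by near: n; exact: hS.
Unshelve. all: by end_near. Qed.

End linearization.

(** * Studentization *)

Section numeric.
Variable R : realType.

(** With a, b the i-th and k-th sample eigenvalues over their population values
    and r = l_k / l_i, the fraction is the weight of the k-th term of the
    squared standard error, and its value at a = b = 1 is the squared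
    coefficient of E_ki in sample_eigen. *)
Lemma se_weight (K gam : R) : 0 < K -> 0 < gam -> exists C d0 : R, [/\ 0 <= C, 0 < d0 &
  forall r a b eta : R, 0 < r <= K -> gam <= `|1 - r ^+ 2| -> 0 <= eta -> eta <= d0 ->
   `|a - 1| <= eta -> `|b - 1| <= eta ->
   a - b * r ^+ 2 != 0 /\
   `|a * b * r ^+ 2 / (a - b * r ^+ 2) ^+ 2 - (r / (1 - r ^+ 2)) ^+ 2| <= C * eta].
Proof.
move=> K0 gam0; pose k2 := 1 + K ^+ 2.
have K20 : 0 <= K ^+ 2 by exact: sqr_ge0.
have k20 : 0 < k2 by rewrite /k2; lra.
pose C := (3 * K ^+ 2) * (4 / gam ^+ 2) + K ^+ 2 * (3 * k2 ^+ 2) * (4 / gam ^+ 4).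
have g2 : 0 < gam ^+ 2 by rewrite exprn_gt0.
have g4 : 0 < gam ^+ 4 by rewrite exprn_gt0.
exists C, (Num.min 1 (gam / (2 * k2))); split.
- by rewrite /C addr_ge0// !mulr_ge0// ?invr_ge0 ?sqr_ge0// ltW.
- by rewrite lt_min ltr01 divr_gt0// mulr_gt0.
move=> r a b eta /andP[r0 rK] rg e0; rewrite le_min => /andP[e1 e2] ha hb.
have r2 : 0 <= r ^+ 2 <= K ^+ 2.
  by rewrite sqr_ge0 ler_pXn2r ?nnegrE// ltW.
have /andP[r20 r2K] := r2.
have ek : eta * k2 <= gam / 2.
  by move: e2; rewrite ler_pdivlMr ?mulr_gt0//; lra.
set D := a - b * r ^+ 2; set D0 := 1 - r ^+ 2 in rg *.
have DD0 : `|D - D0| <= eta * k2.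
  have -> : D - D0 = (a - 1) - (b - 1) * r ^+ 2 by rewrite /D /D0; ring.
  apply: (le_trans (ler_normB _ _)); rewrite normrM (ger0_norm r20) /k2 mulrDr mulr1.
  by rewrite lerD// ler_pM.
have Dg : gam / 2 <= `|D|.
  have : `|D0| <= `|D| + `|D - D0|.
    by rewrite -[D0 in leLHS](subKr D) ; exact: ler_normB.
  lra.
have Dn0 : D != 0 by rewrite -normr_gt0 (lt_le_trans _ Dg)// divr_gt0.
have D0n0 : D0 != 0 by rewrite -normr_gt0 (lt_le_trans gam0).
split => //.
have N1 : `|a * b * r ^+ 2 - r ^+ 2| <= 3 * K ^+ 2 * eta.
  have -> : a * b * r ^+ 2 - r ^+ 2 = ((a - 1) * (b - 1) + (a - 1) + (b - 1)) * r ^+ 2 by ring.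
  rewrite normrM (ger0_norm r20).
  have -> : 3 * K ^+ 2 * eta = (eta * 1 + eta + eta) * K ^+ 2 by ring.
  rewrite ler_pM// (le_trans (ler_normD _ _))// lerD// (le_trans (ler_normD _ _))// lerD//.
  by rewrite normrM ler_pM// (le_trans hb).
have iD : `|D ^- 2| <= 4 / gam ^+ 2.
  rewrite normfV normrX -[4 / _]invrK lef_pV2 ?posrE ?invr_gt0 ?divr_gt0 ?exprn_gt0 ?normr_gt0//.
  have -> : (4 / gam ^+ 2)^-1 = (gam / 2) ^+ 2 by field; rewrite gt_eqF.
  by rewrite ler_pXn2r ?nnegrE//; lra.
have iD0 : `|D0 ^- 2| <= 1 / gam ^+ 2.
  rewrite normfV normrX div1r lef_pV2 ?posrE ?exprn_gt0 ?normr_gt0//.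
  by rewrite ler_pXn2r ?nnegrE//; lra.
have -> : a * b * r ^+ 2 / D ^+ 2 - (r / D0) ^+ 2 =
  (a * b * r ^+ 2 - r ^+ 2) * D ^- 2 + r ^+ 2 * ((D0 - D) * (D0 + D)) * (D ^- 2 * D0 ^- 2).
  by field; rewrite D0n0 Dn0.
have S1 : `|D0 + D| <= 3 * k2.
  have -> : D0 + D = 2 * D0 + (D - D0) by ring.
  apply: (le_trans (ler_normD _ _)).
  have h1 : `|2 * D0| <= 2 * k2.
    rewrite normrM ger0_norm// ler_pM2l// /D0 (le_trans (ler_normB _ _))// normr1.
    by rewrite (ger0_norm r20) /k2; lra.
  have h2 : eta * k2 <= k2 by rewrite ler_piMl// ltW.
  lra.
have -> : C * eta = (3 * K ^+ 2 * eta) * (4 / gam ^+ 2)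
    + K ^+ 2 * ((eta * k2) * (3 * k2)) * ((4 / gam ^+ 2) * (1 / gam ^+ 2)).
  by rewrite /C; field; rewrite gt_eqF.
apply: (le_trans (ler_normD _ _)); apply: lerD.
  by rewrite normrM ler_pM.
rewrite normrM ler_pM//; last by rewrite normrM ler_pM.
rewrite normrM (ger0_norm r20) ler_pM// normrM ler_pM//.
by rewrite distrC.
Qed.

Lemma inv_sqrt_diff (kap x y : R) : 0 < kap -> kap <= x -> kap <= y ->
  `|(Num.sqrt x)^-1 - (Num.sqrt y)^-1| <= `|x - y| / (2 * Num.sqrt kap ^+ 3).
Proof.
move=> k0 kx ky.
have sk0 : 0 < Num.sqrt kap by rewrite sqrtr_gt0.
have x0 : 0 < x by lra. have y0 : 0 < y by lra.
have sx : Num.sqrt kap <= Num.sqrt x by exact: ler_wsqrtr.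
have sy : Num.sqrt kap <= Num.sqrt y by exact: ler_wsqrtr.
have [ex ey] : Num.sqrt x ^+ 2 = x /\ Num.sqrt y ^+ 2 = y by split; rewrite sqr_sqrtr// ltW.
rewrite -[in leRHS]ex -[in leRHS]ey.
move: sx sy sk0; set a := Num.sqrt x; set b := Num.sqrt y; set k := Num.sqrt kap => sx sy sk0.
have a0 : 0 < a by lra. have b0 : 0 < b by lra.
have -> : a^-1 - b^-1 = - (a ^+ 2 - b ^+ 2) / (a * b * (a + b)).
  by field; rewrite !gt_eqF//; lra.
rewrite normrM normrN ler_wpM2l// normfV gtr0_norm; last by rewrite !mulr_gt0//; lra.
rewrite lef_pV2 ?posrE; last 2 first.
- by rewrite !mulr_gt0//; lra.
- by rewrite mulr_gt0// exprn_gt0.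
have -> : 2 * k ^+ 3 = k * k * (k + k) by ring.
by rewrite ler_pM ?mulr_ge0 ?addr_ge0 ?(ltW sk0)// ?ler_pM ?(ltW sk0)//; lra.
Qed.

End numeric.

(** * Linearization of the eigenvalues *)

Section gram.
Variable R : realType.

Lemma gram_svd (m n q : nat) (X U : 'M[R]_(n, q)) l V (S : 'M[R]_(m, n)) :
  X = U *m diag_mx l *m V^T ->
  X^T *m S^T *m S *m X = V *m scaled l (sketch_err U S) *m V^T.
Proof.
move=> ->; rewrite /scaled /sketch_err addrC subrK !trmx_mul trmxK tr_diag_mx.
by rewrite !mulmxA.
Qed.

Lemma gram_svd0 (n q : nat) (X U : 'M[R]_(n, q)) l V :
  X = U *m diag_mx l *m V^T -> U^T *m U = 1%:M ->
  X^T *m X = V *m scaled l 0 *m V^T.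
Proof.
move=> -> UU; rewrite /scaled addr0 mulmx1 !trmx_mul trmxK tr_diag_mx.
by rewrite -!mulmxA (mulmxA U^T) UU mul1mx !mulmxA.
Qed.

Lemma sketch_err_sym (m n q : nat) (U : 'M[R]_(n, q)) (S : 'M[R]_(m, n)) j k :
  sketch_err U S j k = sketch_err U S k j.
Proof.
have : (sketch_err U S)^T = sketch_err U S.
  by rewrite /sketch_err linearB /= !trmx_mul !trmxK trmx1 !mulmxA.
by move=> /(congr1 (fun A : 'M[R]_q => A k j)); rewrite mxE.
Qed.

Lemma frob2_entry (q : nat) (A : 'M[R]_q) j k : `|A j k| <= Num.sqrt (frob2 A).
Proof.
rewrite -sqrtr_sqr ler_wsqrtr// /frob2 (bigD1 j)//= (bigD1 k)//= -addrA lerDl.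
by rewrite addr_ge0// sumr_ge0// => a _; rewrite ?sumr_ge0// => *; exact: sqr_ge0.
Qed.

Lemma frob2_ge0 (q : nat) (A : 'M[R]_q) : 0 <= frob2 A.
Proof. by rewrite sumr_ge0// => a _; rewrite sumr_ge0// => b _; exact: sqr_ge0. Qed.

Lemma dot_deltal (q : nat) i (y : 'cV[R]_q) : dot (delta_mx i 0) y = y i 0.
Proof. by rewrite /dot trmx_delta -rowE !mxE. Qed.

Lemma dotZr (q : nat) (x y : 'cV[R]_q) (c : R) : dot x (c *: y) = c * dot x y.
Proof. by rewrite /dot -scalemxAr mxE. Qed.

Lemma dotZl (q : nat) (x y : 'cV[R]_q) (c : R) : dot (c *: x) y = c * dot x y.
Proof. by rewrite /dot linearZ /= -scalemxAl mxE. Qed.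

Lemma dot_orth (q : nat) (V : 'M[R]_q) (x y : 'cV[R]_q) : V^T *m V = 1%:M ->
  dot (V^T *m x) (V^T *m y) = dot x y.
Proof.
by move=> /mulmx1C VV; rewrite /dot trmx_mul trmxK mulmxA -(mulmxA x^T) VV mulmx1.
Qed.

Variables (q : nat) (v : 'M[R]_q -> 'I_q -> 'cV[R]_q).
Hypothesis hv : eigvec_choice v.

(** The sign rule in eigvec_choice is unrelated to the basis V in which
    sample_eigen reads coordinates; a sign s reconciles the two. *)
Lemma eigvec_oriented (A V : 'M[R]_q) i : A^T = A ->
  exists s : R, [/\ s ^+ 2 = 1, A *m (s *: v A i) = eigval A i *: (s *: v A i),
    dot (s *: v A i) (s *: v A i) = 1 & 0 <= (V^T *m (s *: v A i)) i 0].
Proof.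
move=> As; have [Av vv _] := hv i As.
have flip (s : R) : s ^+ 2 = 1 -> 0 <= (V^T *m (s *: v A i)) i 0 ->
    exists s : R, [/\ s ^+ 2 = 1, A *m (s *: v A i) = eigval A i *: (s *: v A i),
      dot (s *: v A i) (s *: v A i) = 1 & 0 <= (V^T *m (s *: v A i)) i 0].
  move=> s2 si; exists s; split => //.
    by rewrite -scalemxAr Av !scalerA mulrC.
  by rewrite dotZl dotZr mulrA -expr2 s2 mul1r.
have [h|h] := leP 0 ((V^T *m v A i) i 0).
  by apply: (flip 1); rewrite ?expr1n// scale1r.
apply: (flip (-1)); first by rewrite sqrrN expr1n.
by rewrite -scalemxAr mxE mulN1r oppr_ge0 ltW.
Qed.

Lemma gram_sym (m n : nat) (X : 'M[R]_(n, q)) (S : 'M[R]_(m, n)) :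
  (X^T *m S^T *m S *m X)^T = X^T *m S^T *m S *m X.
Proof. by rewrite !trmx_mul !trmxK !mulmxA. Qed.

Lemma gram0_sym (n : nat) (X : 'M[R]_(n, q)) : (X^T *m X)^T = X^T *m X.
Proof. by rewrite trmx_mul trmxK. Qed.

(** This is sample_eigen with E = 0 and delta = 0. *)
Lemma gram_eigen (n : nat) (X U : 'M[R]_(n, q)) l V (K g : R) i : 1 <= K -> 1 < g ->
  is_svd X U l V -> separated K g l ->
  eigval (X^T *m X) i = l 0 i ^+ 2 /\
  exists2 s : R, s ^+ 2 = 1 & V^T *m v (X^T *m X) i = s *: delta_mx i 0.
Proof.
move=> K1 g1 [XE UU VV _ _] sep; have [l0 lK lg] := sep.
have [C [d0 [C0 d00 exp]]] := sample_eigen q K1 g1.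
have [s [s2 Av vv yi]] := @eigvec_oriented _ V i (gram0_sym X).
have E0 (j k : 'I_q) : `|(0 : 'M[R]_q) j k| <= 0 by rewrite mxE normr0.
have [y1 y2 y3 _ _] := exp l V 0 _ 0 VV (gram_svd0 XE UU) (lexx _) (ltW d00) sep E0
  i _ Av vv yi.
rewrite expr0n mulr0 in y2; rewrite mulr0 in y3.
have l20 : 0 < l 0 i ^+ 2 by rewrite exprn_gt0.
split.
  move: y3; rewrite normr_le0 subr_eq0 => /eqP h.
  by rewrite -[LHS](divfK (_ : l 0 i ^+ 2 != 0)) ?gt_eqF// h mul1r.
exists s => //.
have -> : V^T *m v (X^T *m X) i = s *: (V^T *m (s *: v (X^T *m X) i)).
  by rewrite -scalemxAr scalerA -expr2 s2 scale1r.
congr (_ *: _); apply/colP => k; rewrite [RHS]mxE eqxx andbT.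
have [->|ki] := eqVneq k i.
  by move: y2; rewrite normr_le0 subr_eq0 => /eqP.
by have := y1 k ki; rewrite mulr0 normr_le0 => /eqP.
Qed.

(** By sample_eigen, lh / l_i^2 is 1 + E_ii up to second order; dividing by lh
    instead of l_i^2 is another second-order change. *)
Lemma eigval_linearized (K g : R) : 1 <= K -> 1 < g ->
  exists C d1 : R, [/\ 0 <= C, 0 < d1 &
  forall (m n : nat) (X U : 'M[R]_(n, q)) l V (S : 'M[R]_(m, n)) i,
  is_svd X U l V -> separated K g l -> frob2 (sketch_err U S) <= d1 ->
  forall lh, lh = eigval (X^T *m S^T *m S *m X) i ->
  `|Num.sqrt (m%:R / 2) * lh^-1 * (lh - eigval (X^T *m X) i)
    - Num.sqrt m%:R * dot (delta_mx i 0)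
        (sketch_err U S *m ((Num.sqrt 2)^-1 *: delta_mx i 0))|
  <= C * Num.sqrt m%:R * frob2 (sketch_err U S)].
Proof.
move=> K1 g1; have [C [d0 [C0 d00 exp]]] := sample_eigen q K1 g1.
pose d := Num.min d0 (1 / (2 * C + 1)).
have dp : 0 < d by rewrite lt_min d00 divr_gt0//; lra.
exists (4 * C), (d ^+ 2); split; [by rewrite mulr_ge0|by rewrite exprn_gt0|].
move=> m n X U l V S i svd sep fd lh lhdef.
have [XE UU VV _ _] := svd; have [l0 lK lg] := sep.
set E := sketch_err U S; set de := Num.sqrt (frob2 E).
have de2 : de ^+ 2 = frob2 E by rewrite sqr_sqrtr// frob2_ge0.
have de0 : 0 <= de by exact: sqrtr_ge0.
have ded : de <= d by rewrite -[leRHS](ger0_norm (ltW dp)) -sqrtr_sqr ler_wsqrtr.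
have [ded0 dedC] : de <= d0 /\ de <= 1 / (2 * C + 1) by move: ded; rewrite le_min => /andP.
have [s [s2 Av vv yi]] := @eigvec_oriented _ V i (gram_sym X S).
have [_ _ mu1 mu2 _] := exp l V E _ de VV (gram_svd S XE) de0 ded0 sep (@frob2_entry _ E)
  i _ Av vv yi.
have [-> _] := gram_eigen i K1 g1 svd sep.
rewrite -lhdef in mu1 mu2; set mu := lh / l 0 i ^+ 2 in mu1 mu2.
have l20 : 0 < l 0 i ^+ 2 by rewrite exprn_gt0.
have Cde : C * de <= 1 / 2.
  move: dedC; rewrite ler_pdivlMr; last lra.
  by rewrite mulrDr mulr1 (_ : de * (2 * C) = 2 * (C * de)); [lra|ring].
have muh : 1 / 2 <= mu by move: mu1; rewrite ler_norml => /andP[]; lra.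
have lhE : lh = mu * l 0 i ^+ 2 by rewrite /mu divfK// gt_eqF.
have lh0 : lh != 0 by rewrite lhE mulf_neq0 ?gt_eqF//; lra.
have -> : Num.sqrt (m%:R / 2) = Num.sqrt m%:R * (Num.sqrt 2)^-1 :> R.
  by rewrite sqrtrM ?ler0n// sqrtrV.
rewrite dot_deltal -scalemxAr mxE -colE mxE.
have -> : Num.sqrt m%:R / Num.sqrt 2 * lh^-1 * (lh - l 0 i ^+ 2)
   - Num.sqrt m%:R * ((Num.sqrt 2)^-1 * E i i) =
   Num.sqrt m%:R * ((Num.sqrt 2)^-1 * (((mu - 1 - E i i) - E i i * (mu - 1)) / mu)).
  rewrite lhE; have s20 : Num.sqrt 2 != 0 :> R by rewrite gt_eqF// sqrtr_gt0.
  by field; rewrite s20 !gt_eqF//; lra.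
rewrite normrM ger0_norm ?sqrtr_ge0// [leRHS]mulrAC [leRHS]mulrC ler_wpM2l ?sqrtr_ge0//.
have is2 : `|(Num.sqrt 2)^-1| <= 1 :> R.
  rewrite normfV ger0_norm ?sqrtr_ge0// invf_le1 ?sqrtr_gt0//.
  by rewrite -[leLHS]sqrtr1 ler_wsqrtr// ler1n.
rewrite normrM -[leRHS]mul1r ler_pM// normrM normfV ler_pdivrMr; last first.
  by rewrite normr_gt0 gt_eqF//; lra.
rewrite -de2; apply: (@le_trans _ _ (2 * C * de ^+ 2)); last first.
  have -> : 2 * C * de ^+ 2 = 4 * C * de ^+ 2 * (1 / 2) by field.
  rewrite ler_wpM2l ?mulr_ge0 ?sqr_ge0//.
  by rewrite ger0_norm; lra.
apply: (le_trans (ler_normB _ _)).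
have -> : 2 * C * de ^+ 2 = C * de ^+ 2 + de * (C * de) by ring.
by rewrite lerD// normrM ler_pM// frob2_entry.
Qed.

End gram.

(** * Linearization of the eigenvectors *)

Section eigenvector_statistic.
Variables (R : realType) (q : nat) (v : 'M[R]_q -> 'I_q -> 'cV[R]_q).
Hypothesis hv : eigvec_choice v.

Lemma align_spec (u w : 'cV[R]_q) : 0 <= dot u (align u w) /\
  (align u w = w \/ align u w = - w).
Proof.
rewrite /align; have [h|h] := leP 0 (dot u w); first by split; [|left].
split; last by right.
by rewrite -scaleN1r dotZr mulN1r oppr_ge0 ltW.
Qed.

Lemma mul_le_of_le_div (a e x : R) : 0 <= a -> 0 <= x -> x <= e / (a + 1) ->
  a * x <= e.
Proof.
move=> a0 x0; rewrite ler_pdivlMr ?ltr_wpDl// mulrDr mulr1 mulrC => h.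
by rewrite (le_trans _ h)// lerDl.
Qed.

(** In the basis V the i-th eigenvector moves by w0_k E_ki along the k-th axis,
    with w0_k = r_k / (1 - r_k^2), so that c^T diff is a linear form in the
    column E_i with coefficients a_k = c'_k w0_k. Its squared norm P is the
    limit of the squared standard error, and the bound eta on the component of
    c off the i-th eigenvector keeps it away from 0; so y is the normalised
    vector of coefficients. The bound on the coordinates of diff serves to
    compare align with the sign rule of eigvec_choice. *)
Lemma eigvec_linearized (K g eta : R) : 1 <= K -> 1 < g -> 0 < eta ->
  exists C d1 : R, [/\ 0 <= C, 0 < d1 &
  forall (n : nat) (X U : 'M[R]_(n, q)) l V i c,
  is_svd X U l V -> separated K g l -> dot c c = 1 ->
  eta <= 1 - dot c (v (X^T *m X) i) ^+ 2 ->
  exists y : 'cV[R]_q, [/\ dot y y = 1, dot (delta_mx i 0) y = 0 &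
  forall m (S : 'M[R]_(m, n)), frob2 (sketch_err U S) <= d1 ->
  forall Gh : 'M[R]_q, Gh = X^T *m S^T *m S *m X ->
  forall diff : 'cV[R]_q, diff = align (v (X^T *m X) i) (v Gh i) - v (X^T *m X) i ->
  `|Num.sqrt m%:R * (Num.sqrt (\sum_(k < q | k != i)
      eigval Gh i * eigval Gh k / (eigval Gh i - eigval Gh k) ^+ 2
      * dot c (v Gh k) ^+ 2))^-1 * dot c diff
    - Num.sqrt m%:R * dot (delta_mx i 0) (sketch_err U S *m y)|
  <= C * Num.sqrt m%:R * frob2 (sketch_err U S) /\
  forall k, `|diff k 0| <= C * Num.sqrt (frob2 (sketch_err U S))]].
Proof.
move=> K1 g1 eta0; have K0 : 0 < K by lra.
have g2 : 1 < g ^+ 2 by rewrite exprn_egt1.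
pose gam := 1 - (g ^+ 2)^-1.
have gam0 : 0 < gam by rewrite subr_gt0 invf_lt1//; lra.
have [C [d0 [C0 d00 exp]]] := sample_eigen q K1 g1.
have [C1 [e0 [C10 e00 wt]]] := se_weight K0 gam0.
have q0 : 0 <= q%:R :> R by exact: ler0n.
have K20 : 0 <= K ^+ 2 by exact: sqr_ge0.
pose low := (K * (1 + K ^+ 2))^-1.
have low0 : 0 < low by rewrite invr_gt0 mulr_gt0//; lra.
pose kap0 := eta * low ^+ 2.
have kap00 : 0 < kap0 by rewrite mulr_gt0// exprn_gt0.
pose kap := kap0 / 2.
have kapp : 0 < kap by rewrite divr_gt0.
have sk0 : 0 < Num.sqrt kap by rewrite sqrtr_gt0.
have sk3 : 0 < 2 * Num.sqrt kap ^+ 3 by rewrite mulr_gt0// exprn_gt0.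
pose Kg := K / gam.
have Kg0 : 0 <= Kg by apply: divr_ge0; exact: ltW.
pose C2 := q%:R * (C1 * C + Kg ^+ 2 * (2 * (q%:R * C))).
have qC0 : 0 <= q%:R * C by exact: mulr_ge0.
have inner0 : 0 <= C1 * C + Kg ^+ 2 * (2 * (q%:R * C)).
  have h1 : 0 <= C1 * C by exact: mulr_ge0.
  have h2 : 0 <= Kg ^+ 2 * (2 * (q%:R * C)).
    by apply: mulr_ge0; [exact: sqr_ge0|exact: mulr_ge0].
  lra.
have C20 : 0 <= C2 by exact: mulr_ge0.
pose CA := (Num.sqrt kap)^-1 * (q%:R * C) + C2 / (2 * Num.sqrt kap ^+ 3) * (q%:R * Kg).
have CA0 : 0 <= CA.
  have h1 : 0 <= (Num.sqrt kap)^-1 * (q%:R * C) by rewrite mulr_ge0// invr_ge0 ltW.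
  have h2 : 0 <= C2 / (2 * Num.sqrt kap ^+ 3) by apply: divr_ge0 => //; exact: ltW.
  have h3 : 0 <= q%:R * Kg by exact: mulr_ge0.
  by have := mulr_ge0 h2 h3; rewrite /CA; lra.
pose d := Num.min (Num.min d0 1) (Num.min (e0 / (C + 1)) (kap / (C2 + 1))).
have dp : 0 < d by rewrite !lt_min d00 ltr01 !divr_gt0//; lra.
exists (CA + q%:R * C), (d ^+ 2); split; [exact: addr_ge0|exact: exprn_gt0|].
move=> n X U l V i c svd sep cc etac.
have [XE UU VV _ _] := svd; have [l0 lK lg] := sep.
have VV' : V *m V^T = 1%:M by exact: mulmx1C.
have [Li [s s2 Vvi]] := gram_eigen hv i K1 g1 svd sep.
set vi := v (X^T *m X) i in etac Vvi *.
pose c' := V^T *m c.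
have cc' : dot c' c' = 1 by rewrite /c' dot_orth.
have csum : \sum_k c' k 0 ^+ 2 = 1.
  by rewrite -cc' dot_sum; apply: eq_bigr => k _; rewrite expr2.
have c1 k : `|c' k 0| <= 1.
  rewrite -(@ler_pXn2r _ 2)// ?nnegrE// expr1n real_normK ?num_real//.
  by rewrite -csum (bigD1 k)//= lerDl sumr_ge0// => j _; exact: sqr_ge0.
pose r k := l 0 k / l 0 i.
have r0 k : 0 < r k by rewrite divr_gt0.
have rK k : r k <= K by rewrite ler_pdivrMr.
have rg k : k != i -> gam <= `|1 - r k ^+ 2| by exact: ratio_gap g1 sep.
pose w0 k := r k / (1 - r k ^+ 2).
have w0up k : k != i -> `|w0 k| <= Kg.
  move=> ki; have h := rg k ki; rewrite /w0 normrM normfV (gtr0_norm (r0 k)).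
  by rewrite ler_pM ?invr_ge0 ?(ltW (r0 k))// lef_pV2 ?posrE//; lra.
have w0low k : k != i -> low <= `|w0 k|.
  move=> ki; have h := rg k ki; rewrite /w0 normrM normfV (gtr0_norm (r0 k)) /low invfM.
  have rinv : K^-1 <= r k.
    by rewrite -[r k]invrK lef_pV2 ?posrE ?invr_gt0// /r invf_div ler_pdivrMr.
  rewrite ler_pM ?invr_ge0 ?(ltW K0) ?addr_ge0//.
  rewrite lef_pV2 ?posrE ?(lt_le_trans gam0 h) ?ltr_pwDl//.
  rewrite (le_trans (ler_normB _ _))// normr1 ger0_norm ?sqr_ge0// lerD2l.
  by rewrite ler_pXn2r ?nnegrE ?(ltW (r0 k)) ?(ltW K0).
pose a k := if k == i then 0 else c' k 0 * w0 k.
have aKg k : `|a k| <= Kg.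
  rewrite /a; case: eqVneq => [_|ki]; first by rewrite normr0.
  by rewrite normrM -[leRHS]mul1r ler_pM// w0up.
pose P := \sum_k a k ^+ 2.
have Pe : P = \sum_(k | k != i) c' k 0 ^+ 2 * w0 k ^+ 2.
  rewrite /P (bigD1 i)//= {1}/a eqxx expr0n add0r; apply: eq_bigr => k ki.
  by rewrite /a (negbTE ki) exprMn.
have dci : dot c vi = s * c' i 0.
  by rewrite -(dot_orth _ _ VV) Vvi dotZr /dot -colE !mxE.
have Pk : kap0 <= P.
  have e : 1 - dot c vi ^+ 2 = \sum_(k | k != i) c' k 0 ^+ 2.
    by rewrite dci exprMn s2 mul1r -csum (bigD1 i)//= addrC addrK.
  rewrite e in etac; rewrite Pe /kap0.
  apply: (@le_trans _ _ ((\sum_(k | k != i) c' k 0 ^+ 2) * low ^+ 2)).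
    by rewrite ler_wpM2r ?sqr_ge0.
  rewrite mulr_suml; apply: ler_sum => k ki; rewrite ler_wpM2l ?sqr_ge0//.
  rewrite -[leRHS](real_normK (num_real _)) ler_pXn2r ?nnegrE ?(ltW low0)//.
  exact: w0low.
have P0 : 0 < P by lra.
have sP0 : 0 < Num.sqrt P by rewrite sqrtr_gt0.
exists ((s / Num.sqrt P) *: \col_k a k); split.
- rewrite dotZr dotZl mulrA -expr2 exprMn s2 mul1r exprVn sqr_sqrtr ?(ltW P0)//.
  rewrite dot_sum (eq_bigr (fun k => a k ^+ 2)) => [|k _]; last by rewrite mxE expr2.
  by rewrite -/P mulVf// gt_eqF.
- by rewrite dotZr dot_deltal mxE /a eqxx mulr0.
move=> m S fd Gh Ghdef diff diffdef.
set E := sketch_err U S in fd *; set de := Num.sqrt (frob2 E).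
have de2 : de ^+ 2 = frob2 E by rewrite sqr_sqrtr// frob2_ge0.
have de0 : 0 <= de by exact: sqrtr_ge0.
have ded : de <= d by rewrite -[leRHS](ger0_norm (ltW dp)) -sqrtr_sqr ler_wsqrtr.
have [ded0 ded1 dee dek] : [/\ de <= d0, de <= 1, C * de <= e0 & C2 * de <= kap].
  move: ded; rewrite /d !le_min => /andP[/andP[h1 h2] /andP[h3 h4]]; split => //.
    exact: mul_le_of_le_div.
  exact: mul_le_of_le_div.
have de21 : de ^+ 2 <= de by rewrite expr2 ler_piMl.
have GhV : Gh = V *m scaled l E *m V^T by rewrite Ghdef; exact: gram_svd.
have Ghs : Gh^T = Gh by rewrite Ghdef; exact: gram_sym.
(* coordinates of an oriented unit eigenvector in the basis V *)
have expk k (w : 'cV[R]_q) := exp l V E Gh de VV GhV de0 ded0 sep (@frob2_entry _ _ E) k w.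
have Esym j k : E j k = E k j by exact: sketch_err_sym.
pose va := align vi (v Gh i).
have [va0 vaE] := align_spec vi (v Gh i); rewrite -/va in va0 vaE.
have [Av vv _] := hv i Ghs.
have [Ava vava] : Gh *m va = eigval Gh i *: va /\ dot va va = 1.
  case: vaE => ->; first by [].
  by rewrite -scaleN1r -scalemxAr Av dotZl dotZr mulrA mulrNN mulr1 mul1r scalerA mulrC -scalerA.
pose w := s *: va.
have Aw : Gh *m w = eigval Gh i *: w by rewrite -scalemxAr Ava !scalerA mulrC.
have ww : dot w w = 1 by rewrite dotZl dotZr mulrA -expr2 s2 mul1r.
have wi0 : 0 <= (V^T *m w) i 0.
  move: va0; rewrite -(dot_orth vi va VV) Vvi dotZl dot_deltal => h.
  by rewrite /w -scalemxAr [X in 0 <= X]mxE.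
have [y1 y2 mu1 _ y5] := expk i w Aw ww wi0.
pose yv k := (V^T *m w) k 0 - (k == i)%:R.
have Vdiff : V^T *m diff = s *: \col_k yv k.
  have -> : V^T *m diff = s *: (V^T *m w) - s *: delta_mx i 0.
    by rewrite diffdef mulmxBr Vvi -scalemxAr scalerA -expr2 s2 scale1r.
  rewrite -scalerBr; congr (_ *: _); apply/colP => k; rewrite [RHS]mxE [LHS]mxE /yv.
  by congr (_ + _); rewrite !mxE eqxx andbT.
have yvC k : `|yv k| <= C * de.
  rewrite /yv; have [->|ki] := eqVneq k i; last by rewrite subr0 y1.
  by apply: (le_trans y2); rewrite ler_wpM2l.
have ns : `|s| = 1 by apply/eqP; rewrite -(@eqrXn2 _ 2)// real_normK ?num_real// s2 expr1n.
pose N0 := s * \sum_k a k * E k i.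
have numN0 : `|dot c diff - N0| <= q%:R * C * de ^+ 2.
  rewrite -(dot_orth _ _ VV) Vdiff dotZr /N0 -mulrBr normrM ns mul1r dot_sum -sumrB.
  apply: (le_trans (ler_norm_sum _ _ _)).
  apply: (@le_trans _ _ (\sum_(k < q) C * de ^+ 2)); last first.
    by rewrite sumr_const card_ord -[_ *+ q]mulr_natl mulrA.
  apply: ler_sum => k _; rewrite -/c' [(\col_j yv j) k 0]mxE /a /yv.
  have [->|ki] := eqVneq k i.
    by rewrite /= mulr1n mul0r subr0 normrM -[leRHS]mul1r ler_pM// c1.
  rewrite /= mulr0n subr0 -mulrA -mulrBr normrM -[leRHS]mul1r ler_pM//.
  exact: y5.
have N0le : `|N0| <= q%:R * Kg * de.
  rewrite normrM ns mul1r; apply: (le_trans (ler_norm_sum _ _ _)).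
  apply: (@le_trans _ _ (\sum_(k < q) Kg * de)); last first.
    by rewrite sumr_const card_ord -[_ *+ q]mulr_natl mulrA.
  by apply: ler_sum => k _; rewrite normrM ler_pM// frob2_entry.
have li2 : l 0 i ^+ 2 != 0 by rewrite expf_neq0// gt_eqF.
pose se2 := \sum_(k < q | k != i) eigval Gh i * eigval Gh k / (eigval Gh i - eigval Gh k) ^+ 2
      * dot c (v Gh k) ^+ 2.
have se2P : `|se2 - P| <= C2 * de.
  rewrite Pe /se2 -sumrB; apply: (le_trans (ler_norm_sum _ _ _)).
  apply: (@le_trans _ _ (\sum_(k < q) (C1 * C + Kg ^+ 2 * (2 * (q%:R * C))) * de)); last first.
    by rewrite sumr_const card_ord -[_ *+ q]mulr_natl mulrA.
  rewrite [leLHS]big_mkcond; apply: ler_sum => k _; case: ifP => ki; last first.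
    exact: mulr_ge0.
  have [sk [sk2 Awk wwk wk0]] := eigvec_oriented hv V k Ghs.
  have [z1 z2 muk1 _ _] := expk k _ Awk wwk wk0.
  set wk := sk *: v Gh k in Awk wwk wk0 z1 z2.
  pose z := dot c' (V^T *m wk).
  have ze : dot c (v Gh k) ^+ 2 = z ^+ 2.
    by rewrite /z dot_orth// /wk dotZr exprMn sk2 mul1r.
  have zc : `|z - c' k 0| <= q%:R * C * de.
    have -> : z - c' k 0 = \sum_j c' j 0 * ((V^T *m wk) j 0 - (j == k)%:R).
      rewrite /z dot_sum; under [RHS]eq_bigr do rewrite mulrBr.
      rewrite sumrB; congr (_ - _); rewrite (bigD1 k)//= eqxx mulr1 big1 ?addr0// => j jk.
      by rewrite (negbTE jk) mulr0.
    apply: (le_trans (ler_norm_sum _ _ _)).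
    apply: (@le_trans _ _ (\sum_(j < q) C * de)); last first.
      by rewrite sumr_const card_ord -[_ *+ q]mulr_natl mulrA.
    apply: ler_sum => j _; rewrite normrM -[leRHS]mul1r ler_pM//.
    have [->|jk] := eqVneq j k; last by rewrite subr0 z1.
    by apply: (le_trans z2); rewrite ler_wpM2l.
  have z11 : `|z| <= 1.
    rewrite -(@ler_pXn2r _ 2)// ?nnegrE// expr1n real_normK ?num_real//.
    have e : \sum_j (V^T *m wk) j 0 ^+ 2 = 1.
      rewrite -wwk -(dot_orth _ _ VV) dot_sum.
      by apply: eq_bigr => j _; rewrite expr2.
    by rewrite /z dot_sum (le_trans (sum_CauchySchwarz _ _))// csum mul1r e.
  set mi := eigval Gh i / l 0 i ^+ 2 in mu1; set mk := eigval Gh k / l 0 k ^+ 2 in muk1.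
  have lk2 : l 0 k ^+ 2 != 0 by rewrite expf_neq0// gt_eqF.
  have rk : 0 < r k <= K by rewrite r0 rK.
  have Cde0 : 0 <= C * de by rewrite mulr_ge0.
  have [Dn0 Wd] := wt (r k) mi mk (C * de) rk (rg k ki) Cde0 dee mu1 muk1.
  have -> : eigval Gh i * eigval Gh k / (eigval Gh i - eigval Gh k) ^+ 2
      = mi * mk * r k ^+ 2 / (mi - mk * r k ^+ 2) ^+ 2.
    have -> : eigval Gh i = mi * l 0 i ^+ 2 by rewrite /mi divfK.
    have -> : eigval Gh k = mk * r k ^+ 2 * l 0 i ^+ 2.
      by rewrite /mk /r; field; rewrite !gt_eqF.
    rewrite -mulrBl; move: (mi - mk * r k ^+ 2) Dn0 => D Dn0; move: (r k) => rr.
    by field; rewrite Dn0 gt_eqF.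
  rewrite -/(w0 k) in Wd; move: Wd; set Wk := _ / _ => Wd.
  rewrite ze.
  have -> : Wk * z ^+ 2 - c' k 0 ^+ 2 * w0 k ^+ 2 =
    (Wk - w0 k ^+ 2) * z ^+ 2 + w0 k ^+ 2 * ((z - c' k 0) * (z + c' k 0)) by ring.
  apply: (le_trans (ler_normD _ _)); rewrite [leRHS]mulrDl; apply: lerD.
    rewrite normrM -[leRHS]mulr1 ler_pM//; first by rewrite -mulrA.
    by rewrite normrX expr_le1.
  rewrite normrM -mulrA ler_pM//.
    by rewrite normrX ler_pXn2r ?nnegrE// w0up.
  have -> : 2 * (q%:R * C) * de = (q%:R * C * de) * 2 by ring.
  rewrite normrM ler_pM// (le_trans (ler_normD _ _))//.
  by have := c1 k; lra.
have se2k : kap <= se2.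
  by move: se2P; rewrite ler_norml => /andP[h _]; rewrite /kap in dek *; lra.
have Pk' : kap <= P by rewrite /kap; lra.
have isd := inv_sqrt_diff kapp se2k Pk'.
have isd' : `|(Num.sqrt se2)^-1 - (Num.sqrt P)^-1| <= C2 / (2 * Num.sqrt kap ^+ 3) * de.
  by apply: (le_trans isd); rewrite [leRHS]mulrAC ler_wpM2r// invr_ge0 ltW.
have isu : `|(Num.sqrt se2)^-1| <= (Num.sqrt kap)^-1.
  rewrite ger0_norm ?invr_ge0 ?sqrtr_ge0// lef_pV2 ?posrE//.
    exact: ler_wsqrtr.
  by rewrite sqrtr_gt0; lra.
split; last first.
  move=> k.
  have -> : diff = V *m (V^T *m diff) by rewrite mulmxA VV' mul1mx.
  rewrite Vdiff -scalemxAr mxE normrM ns mul1r mxE.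
  apply: (le_trans (ler_norm_sum _ _ _)).
  apply: (@le_trans _ _ (\sum_(j < q) 1 * (C * de))).
    apply: ler_sum => j _; rewrite normrM ler_pM//; last by rewrite mxE.
    rewrite -(@ler_pXn2r _ 2)// ?nnegrE// expr1n real_normK ?num_real//.
    have <- : (V *m V^T) k k = 1 by rewrite VV' mxE eqxx.
    rewrite mxE (bigD1 j)//= mxE expr2 lerDl sumr_ge0// => t _.
    by rewrite mxE -expr2 sqr_ge0.
  rewrite sumr_const card_ord -[_ *+ q]mulr_natl mul1r mulrA ler_wpM2r//.
  by rewrite lerDr.
rewrite -/se2.
have -> : dot (delta_mx i 0) (E *m ((s / Num.sqrt P) *: \col_k a k)) = (Num.sqrt P)^-1 * N0.
  rewrite dot_deltal -scalemxAr mxE /N0 [X in _ * X]mxE.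
  rewrite (eq_bigr (fun k => a k * E k i)) => [|k _]; last first.
    by rewrite [(\col_j a j) k 0]mxE Esym mulrC.
  by ring.
have -> : Num.sqrt m%:R / Num.sqrt se2 * dot c diff - Num.sqrt m%:R * ((Num.sqrt P)^-1 * N0) =
  Num.sqrt m%:R * ((Num.sqrt se2)^-1 * (dot c diff - N0)
    + ((Num.sqrt se2)^-1 - (Num.sqrt P)^-1) * N0) by ring.
rewrite normrM ger0_norm ?sqrtr_ge0// [leRHS]mulrAC [leRHS]mulrC ler_wpM2l ?sqrtr_ge0//.
rewrite -de2; apply: (@le_trans _ _ (CA * de ^+ 2)); last first.
  by rewrite ler_wpM2r ?sqr_ge0// lerDl.
have -> : CA * de ^+ 2 = (Num.sqrt kap)^-1 * (q%:R * C * de ^+ 2)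
   + C2 / (2 * Num.sqrt kap ^+ 3) * de * (q%:R * Kg * de) by rewrite /CA; ring.
apply: (le_trans (ler_normD _ _)).
by rewrite lerD// normrM ler_pM.
Qed.

End eigenvector_statistic.

(** * Asymptotic bounds *)

Section asymptotics.
Variable R : realType.

(** A neighbourhood of infinity on which the supremum is below a witnesses the
    infimum that defines the upper limit. *)
Lemma limn_esup_lt_near (u : nat -> \bar R) (a : \bar R) : (limn_esup u < a)%E ->
  exists2 b : \bar R, (b < a)%E & \forall n \near \oo, (u n <= b)%E.
Proof.
move=> /ereal_inf_lt[_ [V hV <-] ba]; exists (ereal_sup (u @` V)) => //.
by apply: filterS hV => n Vn; apply: ereal_sup_ubound; exists n.
Qed.

Lemma separated_near (p : nat) (X U : forall n : nat, 'M[R]_(n, p.+1))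
  (l : nat -> 'rV[R]_p.+1) (V : nat -> 'M[R]_p.+1) :
  (\forall n \near \oo, is_svd (X n) (U n) (l n) (V n)) ->
  (limn_esup (fun n => (l n 0 ord0 / l n 0 ord_max)%:E) < +oo)%E ->
  (1 < limn_einf (fun n => \big[mine/+oo]_(i < p)
      (l n 0 (widen_ord (leqnSn p) i) / l n 0 (lift ord0 i))%:E))%E ->
  exists K g : R, [/\ 1 <= K, 1 < g & \forall n \near \oo, separated K g (l n)].
Proof.
move=> hX /limn_esup_lt_near[b b_lty hb]; rewrite /limn_einf lteNr.
move=> /limn_esup_lt_near[b' b'_lt hb'].
have [K K1 hK] : exists2 K : R, 1 <= K &
    \forall n \near \oo, l n 0 ord0 / l n 0 ord_max <= K.
  move: b b_lty hb => [b _|//|_] hb.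
    exists (Num.max 1 b); first by rewrite le_max lexx.
    by apply: filterS hb => n; rewrite lee_fin le_max orbC => ->.
  by exists 1 => //; apply: filterS hb => n.
have [g g1 hg] : exists2 g : R, 1 < g & \forall n \near \oo, forall i : 'I_p,
    g <= l n 0 (widen_ord (leqnSn p) i) / l n 0 (lift ord0 i).
  have [g g1 gb] : exists2 g : R, 1 < g & (g%:E <= - b')%E.
    move: b' b'_lt {hb'} => [b'|//|_]; last by exists 2; rewrite ?ltr1n// leey.
    by rewrite lte_fin => h; exists (- b'); [lra|rewrite lee_fin].
  exists g => //; apply: filterS hb' => n hn i.
  rewrite -lee_fin (le_trans gb)// leeNl (le_trans _ hn)// leeN2.
  exact: bigmin_le.
exists K, g; split => //; near=> n.
have [_ _ _ ldec l0] : is_svd (X n) (U n) (l n) (V n) by near: n.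
have hKn : l n 0 ord0 / l n 0 ord_max <= K by near: n.
have hgn : forall i : 'I_p, g <= l n 0 (widen_ord (leqnSn p) i) / l n 0 (lift ord0 i) by near: n.
split => // j k; last first.
  move=> jk; have k0 : (0 < k)%N by exact: leq_ltn_trans jk.
  have kp : (k.-1 < p)%N by rewrite -ltnS prednK.
  have ek : k = lift ord0 (Ordinal kp) by apply/val_inj; rewrite /= /bump add1n prednK.
  have := hgn (Ordinal kp); rewrite -ek ler_pdivlMr// => h.
  by apply: (le_trans h); apply: ldec; rewrite /= -ltnS prednK.
apply: (@le_trans _ _ (l n 0 ord0)); first exact: ldec.
move: hKn; rewrite ler_pdivrMr// => /le_trans; apply.
rewrite ler_wpM2l ?(le_trans ler01)//; apply: ldec.
by rewrite -ltnS.
Unshelve. all: by end_near. Qed.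

Section thresholds.
Variable m : nat -> nat.
Hypothesis hm : m @ \oo --> \oo.

Let m_gt0 : \forall n \near \oo, (0 < m n)%N.
Proof.
have : \forall k \near \oo, (0 < k)%N by exists 1%N.
by move=> /hm.
Qed.

Lemma cvg_inv_min (a b : nat -> R) :
  (\forall n \near \oo, 0 < a n) -> (\forall n \near \oo, 0 < b n) ->
  ((m n)%:R * a n)^-1 @[n --> \oo] --> (0 : R) ->
  ((m n)%:R * b n)^-1 @[n --> \oo] --> (0 : R) ->
  ((m n)%:R * Num.min (a n) (b n))^-1 @[n --> \oo] --> (0 : R).
Proof.
move=> a0 b0 ha hb.
apply: (@squeeze_cvgr _ _ _ _ (fun=> 0) (fun n => ((m n)%:R * a n)^-1 + ((m n)%:R * b n)^-1)).
- near=> n.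
  have m0 : 0 < (m n)%:R :> R by rewrite ltr0n; near: n.
  have a0n : 0 < a n by near: n. have b0n : 0 < b n by near: n.
  have ma := mulr_gt0 m0 a0n; have mb := mulr_gt0 m0 b0n.
  rewrite invr_ge0 mulr_ge0 ?(ltW m0)//=; last by rewrite le_min !ltW.
  by rewrite /Num.min; case: ifP => _; rewrite ?lerDl ?lerDr invr_ge0 ltW.
- exact: cvg_cst.
- by rewrite -[X in _ --> X](addr0 0); exact: cvgD.
Unshelve. all: by end_near. Qed.

Lemma cvg_inv_cst (a : R) : ((m n)%:R * a)^-1 @[n --> \oo] --> (0 : R).
Proof.
rewrite (_ : (fun n => _) = (fun n => ((m n)%:R)^-1 * a^-1)); last first.
  by apply: boolp.funext => n; rewrite invfM.
by rewrite -[X in _ --> X](mul0r a^-1); apply: cvgM; [exact: cvg_inv_m|exact: cvg_cst].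
Qed.

Lemma cvg_inv_sqrt (a : R) :
  ((m n)%:R * (a / Num.sqrt (m n)%:R))^-1 @[n --> \oo] --> (0 : R).
Proof.
have h : (Num.sqrt ((m n)%:R^-1) : R) @[n --> \oo] --> (0 : R).
  rewrite -[X in _ --> X](@sqrtr0 R).
  by apply: continuous_cvg; [exact: sqrt_continuous|exact: cvg_inv_m].
have h2 : Num.sqrt ((m n)%:R^-1) * a^-1 @[n --> \oo] --> (0 : R).
  by rewrite -[X in _ --> X](mul0r a^-1); apply: cvgM; [exact: h|exact: cvg_cst].
apply: cvg_trans h2; apply: near_eq_cvg; near=> n.
have m0 : 0 < (m n)%:R :> R by rewrite ltr0n; near: n.
have s0 : 0 < Num.sqrt (m n)%:R :> R by rewrite sqrtr_gt0.
rewrite sqrtrV ?ltW//; have := sqr_sqrtr (ltW m0); move: s0.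
move: (Num.sqrt (m n)%:R) => s s0 <-; rewrite -invfM; congr (_^-1).
by field; rewrite gt_eqF.
Unshelve. all: by end_near. Qed.

(** The threshold must make sqrt m th small while m th tends to infinity; it is
    a multiple of 1 / sqrt m. *)
Lemma second_order_threshold (q : nat) (U : forall n, 'M[R]_(n, q))
    (Z : forall n, 'M[R]_(m n, n) -> R) (L : forall n, 'M[R]_(m n, n) -> R) (C d1 : R) :
  0 <= C -> 0 < d1 ->
  (\forall n \near \oo, forall A : 'M[R]_(m n, n), frob2 (sketch_err (U n) A) <= d1 ->
     `|Z n A - L n A| <= C * Num.sqrt (m n)%:R * frob2 (sketch_err (U n) A)) ->
  forall e, 0 < e -> exists th : nat -> R,
    [/\ \forall n \near \oo, 0 < th n,
        ((m n)%:R * th n)^-1 @[n --> \oo] --> (0 : R),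
        forall n, th n <= d1
      & \forall n \near \oo, forall A : 'M[R]_(m n, n), e < `|Z n A - L n A| ->
         th n <= frob2 (sketch_err (U n) A)].
Proof.
move=> C0 d10 h e e0; have C1 : 0 < C + 1 by lra.
exists (fun n => Num.min d1 (e / (C + 1) / Num.sqrt (m n)%:R)).
have b0 : \forall n \near \oo, 0 < e / (C + 1) / Num.sqrt (m n)%:R.
  near=> n; rewrite !divr_gt0// sqrtr_gt0 ltr0n; near: n.
  exact: m_gt0.
split.
- by apply: filterS b0 => n; rewrite lt_min d10.
- apply: cvg_inv_min => //; first exact: nearW.
  + exact: cvg_inv_cst.
  + exact: cvg_inv_sqrt.
- by move=> n; rewrite ge_min lexx.
- near=> n => A eA.
  have s0 : 0 < Num.sqrt (m n)%:R :> R by rewrite sqrtr_gt0 ltr0n; near: n; exact: m_gt0.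
  rewrite ge_min; have [hd|/ltW ->//] := leP (frob2 (sketch_err (U n) A)) d1.
  have hn : forall A : 'M[R]_(m n, n), frob2 (sketch_err (U n) A) <= d1 ->
     `|Z n A - L n A| <= C * Num.sqrt (m n)%:R * frob2 (sketch_err (U n) A) by near: n.
  have := hn A hd; set f := frob2 _ => hf; apply/orP; right.
  rewrite !ler_pdivrMr//; apply: (le_trans (ltW eA)); apply: (le_trans hf).
  have -> : f * Num.sqrt (m n)%:R * (C + 1) =
    C * Num.sqrt (m n)%:R * f + f * Num.sqrt (m n)%:R by ring.
  by rewrite lerDl mulr_ge0 ?frob2_ge0// ltW.
Unshelve. all: by end_near. Qed.

End thresholds.
End asymptotics.

(** * The limit laws *)

Theorem mainTheorem7 (R : realType) (p : nat)
  (m : nat -> nat) (zeta : nat -> nat)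
  (X U : forall n : nat, 'M[R]_(n, p.+1))
  (l : nat -> 'rV[R]_p.+1) (V : nat -> 'M[R]_p.+1)
  (d : nat -> measure_display) (T : forall n, measurableType (d n))
  (P : forall n, probability (T n) R)
  (S : forall n, T n -> 'M[R]_(m n, n))
  (v : 'M[R]_p.+1 -> 'I_p.+1 -> 'cV[R]_p.+1)
  (hv : eigvec_choice v)
  (hX : \forall n \near \oo, is_svd (X n) (U n) (l n) (V n))
  (hcond : (limn_esup (fun n => (l n 0 ord0 / l n 0 ord_max)%:E) < +oo)%E)
  (hgap : (1 < limn_einf (fun n => \big[mine/+oo]_(i < p)
      (l n 0 (widen_ord (leqnSn p) i) / l n 0 (lift ord0 i))%:E))%E)
  (hzeta : forall k, (0 < zeta k)%N)
  (hS : \forall n \near \oo,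
      sparse_sign_embedding (P n) (zeta (m n)) (S n))
  (hmn : \forall n \near \oo, (m n < n)%N)
  (hm : m @ \oo --> \oo)
  (hsparse : (zeta (m n))%:R ^+ 2 / (m n)%:R @[n --> \oo] --> (0 : R))
  (hU : Num.sqrt (m n)%:R / (zeta (m n))%:R
        * (\sum_(k < n) \sum_(j < p.+1) U n k j ^+ 4)
        @[n --> \oo] --> (0 : R))
  (i : 'I_p.+1) :
  let G n := (X n)^T *m X n in
  let Ghat n (w : T n) := (X n)^T *m (S n w)^T *m S n w *m X n in
  let L n := eigval (G n) i in
  let Lhat n (w : T n) k := eigval (Ghat n w) k in
  let vhat n (w : T n) k := v (Ghat n w) k in
  let se n (w : T n) (c : 'cV[R]_p.+1) :=
    Num.sqrt (\sum_(k < p.+1 | k != i)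
      Lhat n w i * Lhat n w k / (Lhat n w i - Lhat n w k) ^+ 2
      * dot c (vhat n w k) ^+ 2) in
  cvg_in_distribution P
    (fun n w => Num.sqrt ((m n)%:R / 2) * (Lhat n w i)^-1 * (Lhat n w i - L n))
    (normal_prob 0 1) /\
  forall c : 'cV[R]_p.+1, dot c c = 1 ->
    (limn_esup (fun n => (dot c (v (G n) i) ^+ 2)%:E) < 1)%E ->
    cvg_in_distribution P
      (fun n w => Num.sqrt (m n)%:R * (se n w c)^-1
         * dot c (align (v (G n) i) (vhat n w i) - v (G n) i))
      (normal_prob 0 1) /\
    (Num.sqrt (m n)%:R * `|v (G n) i ord0 0| @[n --> \oo] --> +oo ->
     cvg_in_distribution P
       (fun n w => Num.sqrt (m n)%:R * (se n w c)^-1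
          * dot c (vhat n w i - v (G n) i))
       (normal_prob 0 1)).
Proof.
move=> G Ghat L Lhat vhat se.
have [K [g [K1 g1 hsep]]] := separated_near hX hcond hgap.
have hUU : \forall n \near \oo, (U n)^T *m U n = 1%:M.
  by apply: filterS hX => n [].
have hm0 : \forall n \near \oo, (0 < m n)%N.
  have : \forall k \near \oo, (0 < k)%N by exists 1%N.
  by move=> /hm.
have dii : dot (delta_mx i 0) (delta_mx i 0) = 1 :> R.
  by rewrite dot_deltal mxE !eqxx.
split.
  have [C [d1 [C0 d10 hlin]]] := eigval_linearized hv K1 g1.
  pose Z n (A : 'M[R]_(m n, n)) : R := Num.sqrt ((m n)%:R / 2)
    * (eigval ((X n)^T *m A^T *m A *m X n) i)^-1
    * (eigval ((X n)^T *m A^T *m A *m X n) i - eigval (G n) i).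
  (* |y|^2 = (x . y)^2 = 1/2 for x the i-th axis *)
  pose y : 'cV[R]_p.+1 := (Num.sqrt 2)^-1 *: delta_mx i 0.
  apply: (cvg_of_linearization hzeta hUU hS hm hsparse hU (Z := Z)
    (x := fun=> delta_mx i 0) (y := fun=> y)).
  - by apply: nearW.
  - apply: nearW => n; rewrite /y dotZl !dotZr dii !mulr1 -expr2 exprVn sqr_sqrtr//.
    by field.
  - move=> e e0.
    have [|th [h1 h2 _ h4]] := second_order_threshold (U := U) (Z := Z)
        (L := fun n A => Num.sqrt (m n)%:R * dot (delta_mx i 0) (sketch_err (U n) A *m y))
        hm C0 d10 _ e0; last by exists th.
    near=> n => A fA.
    have svd : is_svd (X n) (U n) (l n) (V n) by near: n.
    have sep : separated K g (l n) by near: n.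
    exact: (hlin (m n) n (X n) (U n) (l n) (V n) A i svd sep fA _ erefl).
move=> c cc /limn_esup_lt_near[b b1 hb].
have [eta eta0 heta] : exists2 eta : R, 0 < eta &
    \forall n \near \oo, eta <= 1 - dot c (v (G n) i) ^+ 2.
  move: b b1 hb => [b|//|_] hb.
    rewrite lte_fin in hb => hbn; exists (1 - b); first by rewrite subr_gt0.
    by apply: filterS hbn => n; rewrite lee_fin lerD2l lerN2.
  by exists 1 => //; apply: filterS hb => n; rewrite leeNy_eq.
have [C [d1 [C0 d10 hlin]]] := eigvec_linearized hv K1 g1 eta0.
(* a direction y supplied by eigvec_linearized is chosen for each large n; the
   default 0 is used for the finitely many others *)
pose good n (y : 'cV[R]_p.+1) := [/\ dot y y = 1, dot (delta_mx i 0) y = 0 &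
  forall m (S : 'M[R]_(m, n)), frob2 (sketch_err (U n) S) <= d1 ->
  forall Gh : 'M[R]_p.+1, Gh = (X n)^T *m S^T *m S *m X n ->
  forall diff : 'cV[R]_p.+1, diff = align (v (G n) i) (v Gh i) - v (G n) i ->
  `|Num.sqrt m%:R * (Num.sqrt (\sum_(k < p.+1 | k != i)
      eigval Gh i * eigval Gh k / (eigval Gh i - eigval Gh k) ^+ 2
      * dot c (v Gh k) ^+ 2))^-1 * dot c diff
    - Num.sqrt m%:R * dot (delta_mx i 0) (sketch_err (U n) S *m y)|
  <= C * Num.sqrt m%:R * frob2 (sketch_err (U n) S) /\
  forall k, `|diff k 0| <= C * Num.sqrt (frob2 (sketch_err (U n) S))].
pose y n : 'cV[R]_p.+1 := xget 0 [set y | good n y].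
have hy : \forall n \near \oo, good n (y n).
  near=> n; apply: (@xgetPex _ 0 [set y | good n y]).
  have svd : is_svd (X n) (U n) (l n) (V n) by near: n.
  have sep : separated K g (l n) by near: n.
  apply: (hlin n (X n) (U n) (l n) (V n) i c svd sep cc).
  by near: n.
pose Sd n (A : 'M[R]_(m n, n)) : R := let Gh := (X n)^T *m A^T *m A *m X n in
  Num.sqrt (m n)%:R * (Num.sqrt (\sum_(k < p.+1 | k != i)
      eigval Gh i * eigval Gh k / (eigval Gh i - eigval Gh k) ^+ 2
      * dot c (v Gh k) ^+ 2))^-1.
pose Z2 n (A : 'M[R]_(m n, n)) : R := Sd n A *
  dot c (align (v (G n) i) (v ((X n)^T *m A^T *m A *m X n) i) - v (G n) i).
pose Z3 n (A : 'M[R]_(m n, n)) : R := Sd n A *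
  dot c (v ((X n)^T *m A^T *m A *m X n) i - v (G n) i).
pose Ln n (A : 'M[R]_(m n, n)) : R :=
  Num.sqrt (m n)%:R * dot (delta_mx i 0) (sketch_err (U n) A *m y n).
have hyy : \forall n \near \oo, dot (y n) (y n) + dot (delta_mx i 0) (y n) ^+ 2 = 1.
  by apply: filterS hy => n [-> -> _]; rewrite expr0n addr0.
have hZ2 : \forall n \near \oo, forall A : 'M[R]_(m n, n),
    frob2 (sketch_err (U n) A) <= d1 ->
    `|Z2 n A - Ln n A| <= C * Num.sqrt (m n)%:R * frob2 (sketch_err (U n) A).
  by apply: filterS hy => n [_ _ h] A fA; have [] := h (m n) A fA _ erefl _ erefl.
have xx : \forall n \near \oo, dot (delta_mx i 0 : 'cV[R]_p.+1) (delta_mx i 0) = 1.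
  exact: nearW.
split.
  apply: (cvg_of_linearization hzeta hUU hS hm hsparse hU (Z := Z2) xx hyy) => e e0.
  have [th [h1 h2 _ h4]] := second_order_threshold hm C0 d10 hZ2 e0.
  by exists th.
move=> hv0.
apply: (cvg_of_linearization hzeta hUU hS hm hsparse hU (Z := Z3) xx hyy) => e e0.
have [th [h1 h2 h3 h4]] := second_order_threshold hm C0 d10 hZ2 e0.
pose v0 n := `|v (G n) i ord0 0|.
(* below th' the aligned eigenvector keeps the sign of the first coordinate of
   the population one, hence is the one that the sign rule selects *)
pose th' n := (v0 n / (C + 1)) ^+ 2.
have C1 : 0 < C + 1 by lra.
have v00 : \forall n \near \oo, 0 < v0 n.
  have h : \forall n \near \oo, 0 < Num.sqrt (m n)%:R * v0 n.
    by move/cvgryPgt : hv0; apply.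
  apply: filterS h => n; rewrite lt_neqAle => /andP[h _].
  by rewrite lt_neqAle normr_ge0 andbT; apply: contraNneq h => <-; rewrite mulr0.
have th'0 : \forall n \near \oo, 0 < th' n.
  by apply: filterS v00 => n h; rewrite exprn_gt0// divr_gt0.
exists (fun n => Num.min (th n) (th' n)); split.
- by near=> n; rewrite lt_min; apply/andP; split; near: n.
- apply: cvg_inv_min => //.
  have inv0 : ((Num.sqrt (m n)%:R * v0 n)^-1 : R) @[n --> \oo] --> (0 : R).
    apply/gtr0_cvgV0; last exact: hv0.
    by move/cvgryPgt : hv0; apply.
  have h : ((Num.sqrt (m n)%:R * v0 n)^-1 * (Num.sqrt (m n)%:R * v0 n)^-1 * (C + 1) ^+ 2 : R)
      @[n --> \oo] --> (0 : R).
    rewrite -[X in _ --> X](mul0r ((C + 1) ^+ 2)) -[X in X * _](mul0r 0).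
    by apply: cvgM; [apply: cvgM|exact: cvg_cst].
  apply: cvg_trans h; apply: near_eq_cvg; near=> n.
  have m0 : 0 < (m n)%:R :> R by rewrite ltr0n; near: n.
  have w0 : 0 < v0 n by near: n.
  rewrite /th'; move: w0; move: (v0 n) => w w0.
  have := sqr_sqrtr (ltW m0); have : 0 < Num.sqrt (m n)%:R :> R by rewrite sqrtr_gt0.
  move: (Num.sqrt (m n)%:R) => s s0 <-.
  by field; rewrite !gt_eqF.
- near=> n => A eA.
  have [gy1 gy2 gy3] : good n (y n) by near: n.
  have h4n : forall A : 'M[R]_(m n, n), e < `|Z2 n A - Ln n A| ->
    th n <= frob2 (sketch_err (U n) A) by near: n.
  have w0 : 0 < v0 n by near: n.
  rewrite leNgt; apply/negP; rewrite lt_min => /andP[fth fth'].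
  have fd : frob2 (sketch_err (U n) A) <= d1 by rewrite (le_trans (ltW fth)).
  have [_ dk] := gy3 (m n) A fd _ erefl _ erefl.
  have {}dk := dk ord0.
  set Gh := (X n)^T *m A^T *m A *m X n in dk.
  have Ghs : Gh^T = Gh by exact: gram_sym.
  have small : C * Num.sqrt (frob2 (sketch_err (U n) A)) < v0 n.
    have sf : Num.sqrt (frob2 (sketch_err (U n) A)) < v0 n / (C + 1).
      have q0 : 0 <= v0 n / (C + 1) by rewrite divr_ge0// ltW.
      by rewrite -(ger0_norm q0) -sqrtr_sqr ltr_sqrt// exprn_gt0// divr_gt0.
    move: sf; rewrite ltr_pdivlMr// mulrDr mulr1 => sf.
    have := sqrtr_ge0 (frob2 (sketch_err (U n) A)).
    by rewrite mulrC; lra.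
  have [_ _ [j [vj0 vj]]] := hv _ i (gram0_sym (X n)).
  have vpos : 0 < v (G n) i ord0 0.
    have [->//|j0] := eqVneq ord0 j.
    have : v (G n) i ord0 0 = 0 by apply: vj; rewrite lt0n; apply: contra j0 => /eqP e'; apply/eqP/val_inj.
    by move=> z; move: w0; rewrite /v0 z normr0 ltxx.
  have v0E : v0 n = v (G n) i ord0 0 by rewrite /v0 gtr0_norm.
  have apos : 0 < align (v (G n) i) (v Gh i) ord0 0.
    have dE (a a' : 'cV[R]_p.+1) : (a - a') ord0 0 = a ord0 0 - a' ord0 0 by rewrite !mxE.
    move: dk; rewrite dE ler_norml => /andP[h _].
    by rewrite v0E in small; lra.
  have aE : align (v (G n) i) (v Gh i) = v Gh i.
    have [_ [//|aN]] := align_spec (v (G n) i) (v Gh i).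
    have [_ _ [j' [vj'0 vj']]] := hv _ i Ghs.
    move: apos; rewrite aN mxE oppr_gt0 => neg.
    have [e'|j0] := eqVneq ord0 j'; first by move: vj'0; rewrite -e' ltNge (ltW neg).
    have : v Gh i ord0 0 = 0 by apply: vj'; rewrite lt0n; apply: contra j0 => /eqP e'; apply/eqP/val_inj.
    by move=> z; move: neg; rewrite z ltxx.
  have Z23 : Z3 n A = Z2 n A by rewrite /Z3 /Z2 -/Gh aE.
  have := h4n A; rewrite -Z23 => /(_ eA).
  by rewrite leNgt fth.
Unshelve. all: by end_near. Qed.
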